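(* Let $\mathcal{A}$ be a hyperplane arrangement in $V=\mathbb{K}^\ell$, $H\in\mathcal{A}$, and $\mathcal{A}'=\mathcal{A}\setminus\{H\}$. Assume that $\mathcal{A}^H$ is tame and that $\mathcal{A}'$ is locally free along $H$. Then $\mathcal{A}$ is tame if $\mathcal{A}'$ is tame.
   Context: Let $\mathbb{K}$ be a field, $V=\mathbb{K}^\ell$, $S=\mathbb{K}[x_1,\ldots,x_\ell]$ the coordinate ring of $V$. An arrangement $\mathcal{A}$ in $V$ is a finite set of linear hyperplanes of $V$; for each $H\in\mathcal{A}$ fix a linear form $\alpha_H\in V^*$ with $H=\ker\alpha_H$, and put $Q(\mathcal{A})=\prod_{H\in\mathcal{A}}\alpha_H$. Let $\Omega^1_V=\bigoplus_{i=1}^\ell S\,dx_i$ and $\Omega^p_V=\wedge^p\Omega^1_V$. For $0\le p\le\ell$ the module of logarithmic $p$-forms is $$\Omega^p(\mathcal{A})=\{\omega\in \tfrac{1}{Q(\mathcal{A})}\Omega^p_V \mid Q(\mathcal{A})\,d\alpha_H\wedge\omega\in\alpha_H\Omega^{p+1}_V\ (\forall H\in\mathcal{A})\}.$$ $\mathcal{A}$ is free if $\Omega^1(\mathcal{A})$ is a free $S$-module (of rank $\ell$). $\mathcal{A}$ is tame if $\mathrm{pd}_S\,\Omega^p(\mathcal{A})\le p$ for all $0\le p\le\ell$, where $\mathrm{pd}_S$ is projective dimension over $S$. For $x\in V$ let $\mathcal{A}_x=\{L\in\mathcal{A}\mid x\in L\}$ (an arrangement in $V$). For $X\subset V$, $\mathcal{A}$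 is locally free along $X$ if $\mathcal{A}_x$ is free for all $0\ne x\in X$. For $H\in\mathcal{A}$, the restriction $\mathcal{A}^H=\{H\cap L\mid L\in\mathcal{A}\setminus\{H\}\}$ is an arrangement in $H\cong\mathbb{K}^{\ell-1}$, whose logarithmic forms and tameness are defined over $\overline{S}=S/\alpha_HS$. *)

(* Defs.v *)
From HB Require Import structures.
From mathcomp Require Import all_boot all_order all_algebra.
From mathcomp Require Import finmap boolp mpoly.

Set Implicit Arguments.
Unset Strict Implicit.
Unset Printing Implicit Defensive.

Import GRing.Theory.
Local Open Scope ring_scope.

Section Modules.
Variable R : nzRingType.

Definition has_basis (M : lmodType R) (r : nat) : Prop :=
  exists b : 'I_r -> M,
    forall m : M, exists! c : {ffun 'I_r -> R}, m = \sum_i c i *: b i.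

Definition projective (P : lmodType R) : Prop :=
  forall (M N : lmodType R) (g : {linear M -> N}) (f : {linear P -> N}),
    (forall y, exists x, g x = y) ->
    exists h : {linear P -> M}, forall x, g (h x) = f x.

Definition exact_at (L M N : lmodType R)
    (f : {linear L -> M}) (g : {linear M -> N}) : Prop :=
  forall y, g y = 0 <-> exists x, f x = y.

(* pd M <= d: there is a projective resolution                              *)
(*   ... -> P 1 -> P 0 -> M -> 0  with P i = 0 for all i > d.               *)
Definition pd_le (M : lmodType R) (d : nat) : Prop :=
  exists (P : nat -> lmodType R) (del : forall i, {linear P i.+1 -> P i})
         (eps : {linear P 0%N -> M}),
    [/\ forall i, projective (P i),
        forall i, (d < i)%N -> forall x : P i, x = 0,
        forall m, exists x, eps x = m,
        exact_at (del 0%N) eps &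
        forall i, exact_at (del i.+1) (del i)].

End Modules.

(* The exterior algebra of the free module (+)_(i < n) R dx_i: the form     *)
(* w is \sum_I w I dx_I, where dx_I is the wedge of the dx_i, i \in I, in   *)
(* increasing order.                                                        *)
Notation extform R n := {ffun {set 'I_n} -> R}.

Section Exterior.
Variables (R : nzRingType) (n : nat).

Definition homogeneous (p : nat) (w : extform R n) : Prop :=
  forall I : {set 'I_n}, #|I| != p -> w I = 0.

Definition inversions (I J : {set 'I_n}) : nat :=
  #|[set ij : 'I_n * 'I_n | [&& ij.1 \in I, ij.2 \in J & (ij.2 < ij.1)%N]]|.

Definition wedge (w e : extform R n) : extform R n :=
  [ffun J : {set 'I_n} => \sum_(I : {set 'I_n} | I \subset J)
     (-1) ^+ inversions I (J :\: I) * (w I * e (J :\: I))].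

Lemma wedge0 w : wedge w 0 = 0.
Proof.
by apply/ffunP => J; rewrite !ffunE big1 // => I _; rewrite ffunE !mulr0.
Qed.

Lemma wedgeDr w e1 e2 : wedge w (e1 + e2) = wedge w e1 + wedge w e2.
Proof.
apply/ffunP => J; rewrite !ffunE -big_split /=.
by apply: eq_bigr => I _; rewrite ffunE !mulrDr.
Qed.

End Exterior.

Definition exterior_d (K : fieldType) (n : nat) (f : {mpoly K[n]}) :
    extform {mpoly K[n]} n :=
  [ffun I : {set 'I_n} => \sum_(i | I == [set i]) f^`M(i)].

(* {fraction S} has no S-module structure in the library; the alias ratfun  *)
(* carries it.                                                              *)
Section RatFun.
Variables (K : fieldType) (n : nat).

Definition ratfun : Type := {fraction {mpoly K[n]}}.
HB.instance Definition _ := GRing.Field.on ratfun.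

Definition ratpoly (f : {mpoly K[n]}) : ratfun := tofrac f.

Definition ratfun_scale (f : {mpoly K[n]}) (r : ratfun) : ratfun :=
  ratpoly f * r.

Lemma ratfun_scaleA f g r :
  ratfun_scale f (ratfun_scale g r) = ratfun_scale (f * g) r.
Proof. by rewrite /ratfun_scale /ratpoly tofracM mulrA. Qed.

Lemma ratfun_scale1 : left_id 1 ratfun_scale.
Proof. by move=> r; rewrite /ratfun_scale /ratpoly tofrac1 mul1r. Qed.

Lemma ratfun_scaleDr : right_distributive ratfun_scale +%R.
Proof. by move=> f r s; rewrite /ratfun_scale mulrDr. Qed.

Lemma ratfun_scaleDl r : {morph ratfun_scale^~ r : f g / f + g}.
Proof. by move=> f g; rewrite /ratfun_scale /ratpoly tofracD mulrDl. Qed.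

HB.instance Definition _ := GRing.Zmodule_isLmodule.Build {mpoly K[n]} ratfun
  ratfun_scaleA ratfun_scale1 ratfun_scaleDr ratfun_scaleDl.

Lemma ratfun_scaleE (f : {mpoly K[n]}) (r : ratfun) : f *: r = ratpoly f * r.
Proof. by []. Qed.

Definition ratform (w : extform {mpoly K[n]} n) : extform ratfun n :=
  [ffun I => ratpoly (w I)].

Lemma wedgeZr (f : {mpoly K[n]}) (w e : extform ratfun n) :
  wedge w (f *: e) = f *: wedge w e.
Proof.
apply/ffunP => J; rewrite !ffunE ratfun_scaleE mulr_sumr.
apply: eq_bigr => I _; rewrite ffunE ratfun_scaleE.
by rewrite (mulrCA (w I)) (mulrCA (_ ^+ _)).
Qed.

End RatFun.

Section Arrangements.
Variables (K : fieldType) (n : nat).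
Implicit Types (L H : {vspace 'rV[K]_n}) (A : {fset {vspace 'rV[K]_n}}).

Definition hyperplane L : Prop := (\dim L).+1 = n.

Definition arrangement A : Prop := forall L, L \in A -> hyperplane L.

Lemma hyperplane_form L : hyperplane L ->
  exists a : 'Hom('rV[K]_n, K^o), lker a == L.
Proof.
rewrite /hyperplane => hL; pose U := (L^C)%VS.
have dU : \dim U = 1%N by rewrite dimv_compl dimvf /dim /= mul1n -[X in (X - _)%N]hL subSnn.
have [v vU v0] : exists2 v, v \in U & v != 0.
  by exists (vpick U); rewrite ?memv_pick // vpick0 -dimv_eq0 dU.
have UE : U = <[v]>%VS.
  by apply/esym/eqP; rewrite eqEdim -memvE vU dim_vline v0 dU.
have UL0 : (U :&: L = 0)%VS by rewrite capvC capv_compl.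
have LU0 : (L :&: U = 0)%VS by rewrite capv_compl.
have ULf : (U + L = fullv)%VS by rewrite addvC addv_complf.
pose a : 'Hom('rV[K]_n, K^o) :=
  (linfun (coord [tuple v] ord0 : 'rV[K]_n -> K^o) \o daddv_pi U L)%VF.
exists a; apply/eqP/vspaceP => w; rewrite memv_ker.
have wE : daddv_pi U L w + daddv_pi L U w = w.
  by apply: daddv_pi_add; rewrite // ULf memvf.
rewrite comp_lfunE lfunE /=; apply/eqP/idP => [h|wL]; last first.
  have /eqP : daddv_pi L U w = w by apply: daddv_pi_id.
  rewrite -{2}wE -subr_eq0 opprD addrCA subrr addr0 oppr_eq0 => /eqP ->.
  by rewrite linear0.
suff d0 : daddv_pi U L w = 0 by rewrite -wE d0 add0r memv_pi.
have : daddv_pi U L w \in <<[tuple v]>>%VS.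
  by rewrite span_seq1 -UE memv_pi.
by move/coord_span; rewrite big_ord1 h scale0r.
Qed.

(* A chosen linear form with kernel L, for a hyperplane L (0 otherwise). *)
Definition alpha L : 'Hom('rV[K]_n, K^o) :=
  if pselect (exists a : 'Hom('rV[K]_n, K^o), lker a == L) is left ex
  then xchoose ex else 0.

Lemma lker_alpha L : hyperplane L -> lker (alpha L) = L.
Proof.
move=> /hyperplane_form ex; rewrite /alpha; case: pselect => // ex'.
exact/eqP/(xchooseP ex').
Qed.

Definition alpha_poly L : {mpoly K[n]} :=
  \sum_(i < n) alpha L (delta_mx 0 i) *: 'X_i.

Definition defpoly A : {mpoly K[n]} := \prod_(L <- A) alpha_poly L.

Definition logarithmic A (p : nat) (w : extform (ratfun K n) n) : Prop :=
  (exists2 e : extform {mpoly K[n]} n, homogeneous p e &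
     w = [ffun I => ratpoly (e I) / ratpoly (defpoly A)]) /\
  (forall L, L \in A ->
     exists2 e : extform {mpoly K[n]} n, homogeneous p.+1 e &
       defpoly A *: wedge (ratform (exterior_d (alpha_poly L))) w
       = alpha_poly L *: ratform e).

Definition logforms A (p : nat) : {pred extform (ratfun K n) n} :=
  fun w => `[< logarithmic A p w >].

Lemma logforms_submod_closed A p : submod_closed (logforms A p).
Proof.
split=> [|f u v /asboolP[[e1 he1 uE] hu] /asboolP[[e2 he2 vE] hv]].
  apply/asboolP; split=> [|L LA].
    exists 0 => [I _|]; first by rewrite ffunE.
    by apply/ffunP=> I; rewrite !ffunE /ratpoly tofrac0 mul0r.
  exists 0 => [I _|]; first by rewrite ffunE.
  rewrite wedge0 scaler0; apply/ffunP=> I.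
  by rewrite !ffunE /ratpoly tofrac0 scaler0.
apply/asboolP; split=> [|L LA].
  exists ([ffun I => f * e1 I + e2 I]) => [I hI|].
    by rewrite ffunE he1 // he2 // mulr0 addr0.
  apply/ffunP=> I; rewrite uE vE !ffunE ratfun_scaleE.
  by rewrite /ratpoly tofracD tofracM mulrDl mulrA.
have [e1' he1' uE'] := hu L LA; have [e2' he2' vE'] := hv L LA.
exists ([ffun I => f * e1' I + e2' I]) => [I hI|].
  by rewrite ffunE he1' // he2' // mulr0 addr0.
rewrite wedgeDr wedgeZr scalerDr vE' scalerA mulrC -scalerA uE' scalerA mulrC.
rewrite -scalerA -scalerDr; congr (_ *: _).
apply/ffunP=> I; rewrite !ffunE ratfun_scaleE /ratpoly.
by rewrite tofracD tofracM.
Qed.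

HB.instance Definition _ A p :=
  GRing.isSubmodClosed.Build {mpoly K[n]} _ (logforms A p)
    (logforms_submod_closed A p).

Record logmod A (p : nat) : Type :=
  LogForm { logval : extform (ratfun K n) n; _ : logval \in logforms A p }.
HB.instance Definition _ A p := [isSub for @logval A p].
HB.instance Definition _ A p := [Choice of logmod A p by <:].
HB.instance Definition _ A p :=
  [SubChoice_isSubLmodule of logmod A p by <:].

Definition free_arrangement A : Prop := has_basis (logmod A 1) n.

Definition tame A : Prop :=
  forall p, (p <= n)%N -> pd_le (logmod A p) p.

Definition localization A (x : 'rV[K]_n) : {fset {vspace 'rV[K]_n}} :=
  [fset L in A | x \in L]%fset.

Definition locally_free_along A (X : {pred 'rV[K]_n}) : Prop :=
  forall x, x \in X -> x != 0 -> free_arrangement (localization A x).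

Definition coords_fun H (u : 'rV[K]_(\dim H)) : 'rV[K]_n :=
  \sum_i u 0 i *: (vbasis H)`_i.

Lemma coords_fun_linear H : linear (@coords_fun H).
Proof.
move=> c u v; rewrite /coords_fun scaler_sumr -big_split /=.
by apply: eq_bigr => i _; rewrite !mxE scalerDl scalerA.
Qed.

HB.instance Definition _ H :=
  GRing.isLinear.Build K 'rV[K]_(\dim H) 'rV[K]_n *:%R (@coords_fun H)
    (@coords_fun_linear H).

(* The isomorphism of K^(dim H) onto H given by the basis vbasis H. *)
Definition coords H : 'Hom('rV[K]_(\dim H), 'rV[K]_n) :=
  linfun (@coords_fun H).

End Arrangements.

(* The restriction A^H, as an arrangement in K^(dim H); correspondingly its *)
(* forms are taken over K[y_1, ..., y_(dim H)], the coordinate ring         *)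
(* S / alpha_H S of H.                                                      *)
Definition restriction (K : fieldType) (n : nat)
    (A : {fset {vspace 'rV[K]_n}}) (H : {vspace 'rV[K]_n}) :
    {fset {vspace 'rV[K]_(\dim H)}} :=
  [fset (coords H @^-1: (H :&: L))%VS | L in (A `\ H)%fset]%fset.

Section RestrictionFacts.
Variables (K : fieldType) (n : nat).
Implicit Types (L H : {vspace 'rV[K]_n}) (A : {fset {vspace 'rV[K]_n}}).

Lemma coordsE H u : coords H u = \sum_i u 0 i *: (vbasis H)`_i.
Proof. by rewrite lfunE. Qed.

Lemma lker_coords H : lker (coords H) = 0%VS.
Proof.
apply/eqP; rewrite -subv0; apply/subvP => u; rewrite memv_ker coordsE => /eqP h.
have /freeP fr := basis_free (vbasisP H).
rewrite memv0; apply/eqP/rowP => i; rewrite mxE; exact: (fr (fun i => u 0 i)).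
Qed.

Lemma limg_coords H : limg (coords H) = H.
Proof.
apply/eqP; rewrite eqEsubv; apply/andP; split; apply/subvP=> v.
  case/memv_imgP => u _ ->; rewrite coordsE; apply: memv_suml => i _.
  by rewrite memvZ // vbasis_mem // mem_nth // size_tuple.
move=> vH; apply/memv_imgP.
exists (\row_i coord (vbasis H) i v); rewrite ?memvf // coordsE.
by rewrite {1}(coord_vbasis vH); apply: eq_bigr => i _; rewrite mxE.
Qed.

Lemma restriction_arrangement A H :
  arrangement A -> H \in A -> arrangement (restriction A H).
Proof.
move=> hA HA U /imfsetP[L /= /fsetD1P[LH LA] ->].
have := hA _ HA; have := hA _ LA; rewrite /hyperplane => dL dH.
have HLf : (H + L = fullv)%VS.
  apply/eqP; rewrite eqEdim subvf dimvf /dim /= mul1n -[X in (X <= _)%N]dH.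
  rewrite ltn_neqAle dimvS ?addvSl // andbT; apply: contraNneq LH => h.
  have HE : (H == H + L)%VS by rewrite eqEdim addvSl h leqnn.
  have LsH : (L <= H)%VS by rewrite (eqP HE) addvSr.
  by rewrite eqEdim LsH -ltnS dH dL leqnn.
have := dimv_sum_cap H L; rewrite HLf dimvf /dim /= mul1n => hd.
have dHL : (\dim (H :&: L)).+1 = \dim H.
  by move: hd; rewrite -{1}dL => hd; apply/eqP; rewrite -(eqn_add2r (\dim L)) -hd addSnnS addnC.
have /eqP k0 := lker_coords H.
rewrite -[RHS]dHL; congr _.+1.
rewrite -[LHS](limg_dim_eq (f := coords H)); last by rewrite (eqP k0) capv0.
by rewrite lpreimK // limg_coords capvSl.
Qed.

End RestrictionFacts.

(* Main.v *)
(* Let A' = A \ {H}. The residue along H gives exact sequences of S-modules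
     0 -> Omega^p(A') -> Omega^p(A) -> Omega^(p-1)(A^H).
   When 1 <= p <= l - 3 the residue is surjective. Lifts exist in codimension
   two, and where A' is free they glue since Omega^p(A') is a free module; as A'
   is locally free along H, the ideal of those g for which g * eta lifts
   contains x_i^N for all i. These lifts of x_i^N * eta glue to a lift of eta,
   because the Koszul cohomology H^2(x_1^N, ..., x_l^N; Omega^p(A')) vanishes as
   soon as pd Omega^p(A') + 2 < l. The horseshoe lemma then gives
   pd Omega^p(A) <= p, as the projective dimension over S of a module over S / a
   exceeds the one over S / a by at most 1. When p >= l - 2, Omega^p(A) is a
   second syzygy, so its projective dimension is at most l - 2 by Hilbert's
   syzygy theorem; and Omega^0(A') = Omega^0(A). *)

From HB Require Import structures.
Require Import Defs.
From mathcomp Require Import all_boot all_order all_algebra.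
From mathcomp Require Import finmap boolp mpoly.
From mathcomp Require Import functions zify ring.
From mathcomp Require classical_sets.

Set Implicit Arguments.
Unset Strict Implicit.
Unset Printing Implicit Defensive.
Import GRing.Theory.
Local Open Scope ring_scope.

(** * Submodules, quotients and free modules *)

(** Numerators [e] replace forms [e / Q]: being logarithmic along a hyperplane becomes one
    divisibility that involves neither the other hyperplanes nor the scaling of its form. Several
    hyperplanes of A' may have the same trace on H. Reading the numerator of the residue over the
    reduced polynomial Q(A^H) multiplies the residue by the quotient of the restricted Q(A') by
    Q(A^H); without this factor the poles would be too high. Both gluings are instances of one
    statement on an exact 0 -> M' -> M -> N: lifts of g * eta, for g in a finite sequence, give a
    lift of eta if H^2 of M', H^1 of M and H^0 of N vanish. M is a kernel between free modules, so
    H^1 only asks for depth two of the sequence on S; H^0 asks for one regular element on N; H^2 of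
    M' is the real obstacle. For free arrangements it is settled by making M' a retract of a free
    module and using that the equation of H, with the products of the forms whose trace on H differs
    from a given one, generates an ideal of depth three. Globally it is the source of the bound l -
    3. *)

Definition mklin (R : nzRingType) (M N : lmodType R) (f : M -> N)
    (hf : linear f) : {linear M -> N} :=
  HB.pack f (GRing.isLinear.Build R M N *:%R f hf).

Definition surj (T U : Type) (f : T -> U) : Prop := forall y, exists x, f x = y.

Section Submodules.
Variables (R : nzRingType) (V : lmodType R).

Definition submodule (U : V -> Prop) : Prop :=
  U 0 /\ forall a u v, U u -> U v -> U (a *: u + v).

Record subm (U : submodClosed V) := Subm { subm_val : V; _ : subm_val \in U }.
HB.instance Definition _ U := [isSub for @subm_val U].
HB.instance Definition _ U := [Choice of subm U by <:].
HB.instance Definition _ U := [SubChoice_isSubLmodule of subm U by <:].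

(** Modules of forms are used below only through an embedding with prescribed image; this trades a
    subset for an abstract module with such an embedding. *)
Lemma ex_submodule (U : V -> Prop) : submodule U ->
  exists (W : lmodType R) (i : {linear W -> V}),
    injective i /\ forall v, U v <-> exists w, i w = v.
Proof.
move=> [U0 UL]; pose P : {pred V} := fun v => `[<U v>].
have cl : submod_closed P.
  by split=> [|a u v /asboolP hu /asboolP hv]; apply/asboolP => //; exact: UL.
pose U' : submodClosed V := HB.pack P (GRing.isSubmodClosed.Build R V P cl).
have lin : linear (@subm_val U') by move=> a u v.
exists (subm U'), (mklin lin); split; first exact: val_inj.
move=> v; split=> [hv|[w <-]]; last by have /asboolP := valP w.
by have vU : v \in U' by [exact/asboolP]; exists (Subm vU).
Qed.

Section QuotientModule.
Variables (U : zmodClosed V) (UZ : forall a v, v \in U -> a *: v \in U).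
(** Stability under scaling is an argument of the type because the module structure attached to the
    type depends on that proof. *)
Definition quotmod of (forall a v, v \in U -> a *: v \in U) : Type :=
  Quotient.quot U.
Local Notation quot := (quotmod UZ).
HB.instance Definition _ := GRing.Zmodule.on quot.
Local Open Scope quotient_scope.

Definition quot_pi (v : V) : quot := \pi_(Quotient.quot U) v.
Definition quot_scale (a : R) (x : quot) : quot :=
  quot_pi (a *: repr (x : Quotient.quot U)).

Lemma quot_piK (x : quot) : quot_pi (repr (x : Quotient.quot U)) = x.
Proof. exact: reprK. Qed.

Lemma quot_piE u v : quot_pi u = quot_pi v <-> u - v \in U.
Proof. by rewrite Quotient.idealrBE; split=> [/eqP|/eqP]. Qed.

Lemma quot_piD : {morph quot_pi : u v / u + v}.
Proof. exact: raddfD. Qed.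

Lemma quot_scale_pi a v : quot_scale a (quot_pi v) = quot_pi (a *: v).
Proof.
by apply/quot_piE; rewrite -scalerBr; apply: UZ; apply/quot_piE/quot_piK.
Qed.

Lemma quot_scaleA a b x : quot_scale a (quot_scale b x) = quot_scale (a * b) x.
Proof. by rewrite -[x]quot_piK !quot_scale_pi scalerA. Qed.
Lemma quot_scale1 : left_id 1 quot_scale.
Proof. by move=> x; rewrite -[x in LHS]quot_piK quot_scale_pi scale1r quot_piK. Qed.
Lemma quot_scaleDr : right_distributive quot_scale +%R.
Proof.
move=> a x y; rewrite -[x]quot_piK -[y]quot_piK -quot_piD !quot_scale_pi.
by rewrite scalerDr quot_piD.
Qed.
Lemma quot_scaleDl x : {morph quot_scale^~ x : a b / a + b}.
Proof.
by move=> a b; rewrite -[x]quot_piK !quot_scale_pi scalerDl quot_piD.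
Qed.

HB.instance Definition _ := GRing.Zmodule_isLmodule.Build R quot
  quot_scaleA quot_scale1 quot_scaleDr quot_scaleDl.

Lemma quot_pi_linear : linear quot_pi.
Proof. by move=> a u v; rewrite quot_piD -quot_scale_pi. Qed.
End QuotientModule.

Lemma ex_quotient (U : V -> Prop) : submodule U ->
  exists (W : lmodType R) (p : {linear V -> W}),
    surj p /\ forall v, p v = 0 <-> U v.
Proof.
move=> [U0 UL]; pose P : {pred V} := fun v => `[<U v>].
have cl : zmod_closed P.
  split=> [|u v /asboolP hu /asboolP hv]; apply/asboolP => //.
  by rewrite addrC -scaleN1r; apply: UL.
pose U' : zmodClosed V := HB.pack P (GRing.isZmodClosed.Build V P cl).
have UZ a v : v \in U' -> a *: v \in U'.
  by move=> /asboolP hv; apply/asboolP; rewrite -[_ *: _]addr0; apply: UL.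
exists (quotmod UZ : lmodType R), (mklin (quot_pi_linear UZ)); split.
  by move=> y; eexists; apply: quot_piK.
move=> v; split => [h|hv].
  have /quot_piE : quot_pi UZ v = quot_pi UZ 0.
    by rewrite [RHS](raddf0 (mklin (quot_pi_linear UZ))).
  by rewrite subr0 => /asboolP.
rewrite -[RHS](raddf0 (mklin (quot_pi_linear UZ))).
by apply/quot_piE; rewrite subr0; apply/asboolP.
Qed.

End Submodules.


(** * Finitely supported functions and free modules on arbitrary sets *)

Section FinitelySupported.
Variables (R : nzRingType) (X : eqType) (W : lmodType R).

Definition fin_supported (f : X -> W) : Prop :=
  exists s : seq X, forall x, x \notin s -> f x = 0.

Definition fsfct_pred : {pred X -> W} := fun f => `[< fin_supported f >].

Lemma fsfct_closed : submod_closed fsfct_pred.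
Proof.
split=> [|a f g /asboolP[s hs] /asboolP[t ht]]; apply/asboolP; first by exists [::].
exists (s ++ t) => x; rewrite mem_cat negb_or => /andP[xs xt].
by rewrite /= -[LHS]/(a *: f x + g x) hs // ht // scaler0 addr0.
Qed.
HB.instance Definition _ :=
  GRing.isSubmodClosed.Build R (X -> W) fsfct_pred fsfct_closed.

Definition fsfct : Type := subm fsfct_pred.
HB.instance Definition _ := GRing.Lmodule.on fsfct.

Definition fscoef (f : fsfct) : X -> W := subm_val f.

Lemma fscoefP f : exists2 s : seq X, uniq s & forall x, x \notin s -> fscoef f x = 0.
Proof.
have /asboolP[s hs] := valP f; exists (undup s); first exact: undup_uniq.
by move=> x; rewrite mem_undup => /hs.
Qed.

Lemma fsfct_eq (f g : fsfct) : (forall x, fscoef f x = fscoef g x) -> f = g.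
Proof. by move=> h; apply/val_inj/funext. Qed.

Lemma fscoefD f g x : fscoef (f + g) x = fscoef f x + fscoef g x.
Proof. by []. Qed.
Lemma fscoefZ a f x : fscoef (a *: f) x = a *: fscoef f x.
Proof. by []. Qed.
Lemma fscoef0 x : fscoef 0 x = 0.
Proof. by []. Qed.
Lemma fscoefN f x : fscoef (- f) x = - fscoef f x.
Proof. by []. Qed.
Lemma fscoef_sum I (r : seq I) (F : I -> fsfct) x :
  fscoef (\sum_(i <- r) F i) x = \sum_(i <- r) fscoef (F i) x.
Proof.
elim/big_rec2: _ => // i y1 y2 _ <-.
exact: fscoefD.
Qed.

Lemma mk_fsfct (f : X -> W) : fin_supported f -> exists g, fscoef g = f.
Proof. by move=> hf; have fP : f \in fsfct_pred by [exact/asboolP]; exists (Subm fP). Qed.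

Lemma single_supported x w : fin_supported (fun y => if y == x then w else 0).
Proof. by exists [:: x] => y; rewrite inE => /negbTE ->. Qed.

Definition fsingle x w : fsfct :=
  @Subm _ _ fsfct_pred _ (introT (asboolP _) (single_supported x w)).

Lemma fsingleE x w y : fscoef (fsingle x w) y = if y == x then w else 0.
Proof. by []. Qed.

Lemma fsingle_linear x : linear (fsingle x).
Proof.
move=> a u v; apply: fsfct_eq => y; rewrite fscoefD fscoefZ !fsingleE.
by case: eqP => // _; rewrite scaler0 addr0.
Qed.
HB.instance Definition _ x := GRing.isLinear.Build R W fsfct *:%R (fsingle x)
  (fsingle_linear x).

Definition fssupp (f : fsfct) : seq X := s2val (cid2 (fscoefP f)).
Lemma fssupp_uniq f : uniq (fssupp f).
Proof. by rewrite /fssupp; case: cid2. Qed.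
Lemma fssuppN f x : x \notin fssupp f -> fscoef f x = 0.
Proof. by rewrite /fssupp; case: cid2 => s /= _; apply. Qed.

Section Extension.
Variables (M : zmodType) (g : X -> {additive W -> M}).

Definition fsext (f : fsfct) : M := \sum_(x <- fssupp f) g x (fscoef f x).

(** A chosen support may be larger than the set of nonzero values, so two supports are compared
    through their union, where the extra terms vanish. *)
Lemma fsextE (s : seq X) f : uniq s -> (forall x, x \notin s -> fscoef f x = 0) ->
  fsext f = \sum_(x <- s) g x (fscoef f x).
Proof.
have sub (t u : seq X) : uniq t -> uniq u -> {subset t <= u} ->
   (forall x, x \notin t -> fscoef f x = 0) ->
   \sum_(x <- t) g x (fscoef f x) = \sum_(x <- u) g x (fscoef f x).
  move=> ut uu tu h; rewrite [RHS](bigID (mem t)) /= [X in _ + X]big1 ?addr0.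
    rewrite -[RHS]big_filter; apply: perm_big; apply: uniq_perm => //.
      exact: filter_uniq.
    by move=> x; rewrite mem_filter; apply/idP/andP=> [xt|[]//]; split=> //; apply: tu.
  by move=> x /h ->; rewrite raddf0.
move=> us hs; rewrite /fsext.
pose u := undup (s ++ fssupp f).
rewrite (sub _ u) ?fssupp_uniq ?undup_uniq //; last exact: fssuppN.
  rewrite (sub s u) ?undup_uniq // => x xs.
  by rewrite mem_undup mem_cat xs.
by move=> x xs; rewrite mem_undup mem_cat xs orbT.
Qed.

Lemma fsextD : {morph fsext : f1 f2 / f1 + f2}.
Proof.
move=> f1 f2; pose u := undup (fssupp f1 ++ fssupp f2).
have u1 x : x \notin u -> fscoef f1 x = 0.
  by rewrite mem_undup mem_cat negb_or => /andP[/fssuppN].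
have u2 x : x \notin u -> fscoef f2 x = 0.
  by rewrite mem_undup mem_cat negb_or => /andP[_ /fssuppN].
rewrite !(@fsextE u) ?undup_uniq // => [|x xu]; last first.
  by rewrite fscoefD u1 // u2 // addr0.
by rewrite -big_split; apply: eq_bigr => x _; rewrite fscoefD raddfD.
Qed.

Lemma fsext_single x w : fsext (fsingle x w) = g x w.
Proof.
rewrite (@fsextE [:: x]) //; first by rewrite big_seq1 fsingleE eqxx.
by move=> y; rewrite inE fsingleE => /negbTE ->.
Qed.
End Extension.

Lemma fsfctE f : f = \sum_(x <- fssupp f) fsingle x (fscoef f x).
Proof.
apply: fsfct_eq => x; rewrite fscoef_sum.
case: (boolP (x \in fssupp f)) => [xs|xs].
  rewrite (bigD1_seq x) ?fssupp_uniq // fsingleE eqxx big1 => [|y yx].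
    by rewrite -[RHS]/(_ + _) addr0.
  by rewrite fsingleE eq_sym (negbTE yx).
rewrite fssuppN //; symmetry; apply: big1_seq => y /andP[_ ys]; rewrite fsingleE; case: eqP => // xy.
by rewrite -xy (negbTE xs) in ys.
Qed.

Lemma fsext_linear (M : lmodType R) (g : X -> {linear W -> M}) :
  linear (fsext g).
Proof.
move=> a u v; rewrite fsextD; congr (_ + _).
rewrite (@fsextE _ _ (fssupp u)) ?fssupp_uniq //.
  by rewrite scaler_sumr; apply: eq_bigr => x _; rewrite fscoefZ; exact: (linearZ_LR (g x)).
by move=> x xu; rewrite fscoefZ fssuppN // scaler0.
Qed.

End FinitelySupported.

Notation freemod R X := (fsfct X (R^o : lmodType R)).

Lemma fsfct_projective (R : nzRingType) (X : eqType) (W : lmodType R) :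
  projective W -> projective (fsfct X W : lmodType R).
Proof.
move=> hW M N g f gs.
have ex x : exists h : {linear W -> M}, forall w, g (h w) = f (fsingle x w).
  have hl : linear (fun w => f (fsingle x w)) by move=> a u v; rewrite !linearP.
  exact: (hW M N g (mklin hl) gs).
pose h x := projT1 (cid (ex x)).
have hE x w : g (h x w) = f (fsingle x w) by rewrite /h; case: cid => h' /=.
exists (mklin (fsext_linear h)) => u; rewrite -[mklin _ u]/(fsext h u).
rewrite /fsext raddf_sum [in RHS](fsfctE u) raddf_sum.
by apply: eq_bigr => x _; exact: hE.
Qed.

Lemma regular_projective (R : nzRingType) : projective (R^o : lmodType R).
Proof.
move=> M N g f gs; have [m mE] := gs (f 1).
have hl : linear (fun a : R^o => a *: m) by move=> a u v; rewrite scalerDl scalerA.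
exists (mklin hl) => a; rewrite -[mklin hl a]/(a *: m) linearZ /= mE -linearZ /=.
by rewrite -[_ *: 1]/(_ * 1) mulr1.
Qed.

Lemma free_projective (R : nzRingType) (X : eqType) :
  projective (freemod R X : lmodType R).
Proof. exact/fsfct_projective/regular_projective. Qed.

Section Cover.
Variables (R : nzRingType) (M : lmodType R).
Definition cover_gen (m : M) (a : R^o) : M := a *: m.
Lemma cover_gen_linear m : linear (cover_gen m).
Proof. by move=> a u v; rewrite /cover_gen scalerDl scalerA. Qed.
Definition free_cover : {linear (freemod R M : lmodType R) -> M} :=
  mklin (fsext_linear (fun m => mklin (cover_gen_linear m))).
Lemma free_cover_single m : free_cover (fsingle m (1 : R^o)) = m.
Proof.
rewrite -[LHS]/(fsext _ _) fsext_single -[LHS]/(1 *: m).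
exact: scale1r.
Qed.
Lemma free_cover_surj : surj free_cover.
Proof. by move=> m; exists (fsingle m (1 : R^o)); apply: free_cover_single. Qed.
End Cover.

(** * Projective dimension *)

Section LinearMaps.
Variables (R : nzRingType) (M N : lmodType R) (f : {linear M -> N}).
Lemma linD x y : f (x + y) = f x + f y. Proof. exact: raddfD. Qed.
Lemma linB x y : f (x - y) = f x - f y. Proof. exact: raddfB. Qed.
Lemma linN x : f (- x) = - f x. Proof. exact: raddfN. Qed.
Lemma lin_0 : f 0 = 0. Proof. exact: raddf0. Qed.
Lemma linZ a x : f (a *: x) = a *: f x. Proof. exact: linearZ_LR. Qed.
End LinearMaps.

Section ProjectiveDimension.
Variable R : nzRingType.
Implicit Types (A B C D M N P Q Z E : lmodType R).

Definition ses A B C (i : {linear A -> B}) (e : {linear B -> C}) : Prop :=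
  [/\ injective i, surj e & exact_at i e].

Lemma lin_inj A B (f : {linear A -> B}) :
  (forall x, f x = 0 -> x = 0) -> injective f.
Proof.
by move=> h x y xy; apply/subr0_eq/h; rewrite linB xy subrr.
Qed.

Lemma ses_comp0 A B C (i : {linear A -> B}) (e : {linear B -> C}) x :
  ses i e -> e (i x) = 0.
Proof. by case=> _ _ h; apply/h; exists x. Qed.

(** A pointwise choice of preimages suffices, since linearity is inherited through the injection.
    Maps into kernels and submodules are produced in this way below. *)
Lemma lift_inj A B C (i : {linear A -> B}) (f : {linear C -> B}) :
  injective i -> (forall c, exists a, i a = f c) ->
  exists g : {linear C -> A}, forall c, i (g c) = f c.
Proof.
move=> iI h; pose g c := projT1 (cid (h c)).
have gE c : i (g c) = f c by rewrite /g; case: cid.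
have gl : linear g by move=> a u v; apply: iI; rewrite linearP !gE linearP.
by exists (mklin gl).
Qed.

Lemma ex_kernel A B (e : {linear A -> B}) :
  exists (Z : lmodType R) (i : {linear Z -> A}), injective i /\ exact_at i e.
Proof.
have [|Z [i [iI iE]]] := @ex_submodule R A (fun x => e x = 0).
  by split=> [|a u v hu hv]; rewrite ?lin_0 // linearP hu hv scaler0 addr0.
by exists Z, i.
Qed.

Lemma ex_image A B (f : {linear A -> B}) :
  exists (I : lmodType R) (i : {linear I -> B}) (e : {linear A -> I}),
    [/\ injective i, surj e & forall a, i (e a) = f a].
Proof.
have [|Z [i [iI iE]]] := @ex_submodule R B (fun y => exists x, f x = y).
  split=> [|a u v [x <-] [y <-]]; first by exists 0; rewrite lin_0.
  by exists (a *: x + y); rewrite linearP.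
have [|e eE] := lift_inj (f := f) iI; first by move=> c; apply/iE; exists c.
exists Z, i, e; split=> // y; have [x xE] := (iE (i y)).2 (ex_intro _ y erefl).
by exists x; apply: iI; rewrite eE.
Qed.

Lemma proj_retract P Q (s : {linear Q -> P}) (r : {linear P -> Q}) :
  (forall x, r (s x) = x) -> projective P -> projective Q.
Proof.
move=> rs hP M N g f gs.
have [h hE] := hP M N g (f \o r : {linear P -> N}) gs.
by exists (h \o s : {linear Q -> M}) => x /=; rewrite hE /= rs.
Qed.

Lemma proj_prod P Q : projective P -> projective Q ->
  projective ((P * Q)%type : lmodType R).
Proof.
move=> hP hQ M N g f gs.
have l1 : linear (fun p : P => f (p, 0)).
  move=> a u v; rewrite -linearP; congr (f _); congr (_, _).
  by rewrite /= scaler0 addr0.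
have l2 : linear (fun q : Q => f (0, q)).
  move=> a u v; rewrite -linearP; congr (f _); congr (_, _).
  by rewrite /= scaler0 addr0.
have [h1 h1E] := hP M N g (mklin l1) gs.
have [h2 h2E] := hQ M N g (mklin l2) gs.
have hl : linear (fun x : P * Q => h1 x.1 + h2 x.2).
  by move=> a u v; rewrite !linearP /= scalerDr addrACA.
exists (mklin hl) => -[p q]; rewrite -[mklin hl _]/(h1 p + h2 q) linD h1E h2E.
rewrite -[mklin l1 p]/(f (p, 0)) -[mklin l2 q]/(f (0, q)) -linD.
by congr (f _); congr (_, _); rewrite /= ?addr0 ?add0r.
Qed.

Lemma ses_split A B C (i : {linear A -> B}) (e : {linear B -> C}) :
  ses i e -> projective C ->
  exists (s : {linear C -> B}) (r : {linear B -> A}),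
    [/\ forall c, e (s c) = c, forall a, r (i a) = a &
        forall b, b = i (r b) + s (e b)].
Proof.
move=> [iI es ex] hC.
have il : linear (fun c : C => c) by [].
have [s sE] := hC B C e (mklin il) es.
have fl : linear (fun b => b - s (e b)).
  by move=> a u v; rewrite (linD e) (linZ e) (linD s) (linZ s) scalerBr opprD addrACA.
have [|r rE] := lift_inj (f := mklin fl) iI.
  by move=> b; apply/ex; rewrite -[mklin fl b]/(b - s (e b)) linB sE subrr.
exists s, r; split=> // [a|b].
  apply: iI; rewrite rE -[mklin fl _]/(i a - s (e (i a))).
  by rewrite ((ex _).2 (ex_intro _ a erefl)) lin_0 subr0.
by rewrite rE -[mklin fl _]/(b - s (e b)) subrK.
Qed.

(** Syzygies are peeled off one at a time, which allows induction on [d] without handling complexes;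
    [pd_leP] compares this with resolutions. *)
Fixpoint pdI (d : nat) M : Prop :=
  if d is d'.+1 then
    exists (P Q : lmodType R) (i : {linear Q -> P}) (e : {linear P -> M}),
      [/\ projective P, ses i e & pdI d' Q]
  else projective M.

Definition linid M : {linear M -> M} := mklin (fun a u v => erefl : a *: u + v = _).

Lemma zero_projective : projective ('rV[R]_0 : lmodType R).
Proof.
move=> M N g f _.
have hl : linear (fun _ : 'rV[R]_0 => 0 : M) by move=> a u v; rewrite scaler0 addr0.
exists (mklin hl) => x; rewrite -[mklin hl x]/(0 : M) lin_0.
by rewrite (thinmx0 x) lin_0.
Qed.

Definition lin0 M N : {linear M -> N} := \0%R.

Lemma pdI_S d M : pdI d M -> pdI d.+1 M.
Proof.
elim: d M => [|d IH] M.
  move=> hM; exists M, 'rV[R]_0, (lin0 _ _), (linid M); split=> //; last first.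
    exact: zero_projective.
  split=> [x y _|y|y]; first by rewrite (thinmx0 x) (thinmx0 y).
    by exists y.
  split=> [hy|[x <-]] //; exists 0; first by rewrite lin_0 -hy.
by move=> [P [Q [i [e [hP hs hQ]]]]]; exists P, Q, i, e; split=> //; apply: IH.
Qed.

Lemma pdI_mono d d' M : (d <= d')%N -> pdI d M -> pdI d' M.
Proof.
move=> /subnK <-; elim: (d' - d)%N => // k IH h; rewrite addSn.
exact/pdI_S/IH.
Qed.

Lemma inv_bij M N (f : {linear M -> N}) : injective f -> surj f ->
  exists g : {linear N -> M}, (forall x, g (f x) = x) /\ (forall y, f (g y) = y).
Proof.
move=> fI fs; have [|g gE] := lift_inj (f := linid N) fI.
  by move=> y; apply: fs.
by exists g; split=> // x; apply: fI; rewrite gE.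
Qed.

Lemma pdI_iso d M N (f : {linear M -> N}) : injective f -> surj f ->
  pdI d M -> pdI d N.
Proof.
move=> fI fs; case: d => [|d] /=.
  have [g [gf fg]] := inv_bij fI fs; exact: (proj_retract fg).
move=> [P [Q [i [e [hP [iI es ex] hQ]]]]].
exists P, Q, i, (f \o e : {linear P -> N}); split=> //; split=> // [y|y].
  by have [x <-] := fs y; have [z <-] := es x; exists z.
by rewrite -ex /=; split=> [h|->]; [apply: fI; rewrite h lin_0 | rewrite lin_0].
Qed.

(** Lift [PC -> C] through [B] and add: [PA * PC] covers [B], and the kernel of this cover is an
    extension of [QC] by [QA], to which the induction applies. *)
Lemma horseshoe d A B C (i : {linear A -> B}) (e : {linear B -> C}) :
  ses i e -> pdI d A -> pdI d C -> pdI d B.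
Proof.
elim: d A B C i e => [|d IH] A B C i e hs.
  move=> hA hC; have [s [r [es ri bE]]] := ses_split hs hC.
  have fl : linear (fun x : A * C => i x.1 + s x.2).
    by move=> a u v; rewrite !linearP /= scalerDr addrACA.
  have gl : linear (fun b => (r b, e b)).
    by move=> a u v; rewrite !linearP.
  apply: (proj_retract (s := mklin gl) (r := mklin fl)) (proj_prod hA hC).
  by move=> b; rewrite -[LHS]/(i (r b) + s (e b)) -bE.
move=> [PA [QA [iA [eA [hPA [iAI eAs exA] hQA]]]]].
move=> [PC [QC [iC [eC [hPC [iCI eCs exC] hQC]]]]].
have [iI es ex] := hs.
have [l lE] := hPC B C e eC es.
have fl : linear (fun x : PA * PC => i (eA x.1) + l x.2).
  by move=> a u v; rewrite !linearP /= scalerDr addrACA.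
pose f : {linear (PA * PC)%type -> B} := mklin fl.
have fE x : f x = i (eA x.1) + l x.2 by [].
have [Z [j [jI jE]]] := ex_kernel f.
exists (PA * PC)%type, Z, j, f; split.
- exact: proj_prod.
- split=> // b; have [c cE] := eCs (e b).
  have /ex[a aE] : e (b - l c) = 0 by rewrite linB lE cE subrr.
  have [p pE] := eAs a; exists (p, c); rewrite fE /= pE aE subrK //.
have l1 : linear (fun q : QA => (iA q, 0) : PA * PC).
  by move=> a u v; rewrite linearP; congr (_, _); rewrite /= scaler0 addr0.
have [|u uE] := lift_inj (f := mklin l1) jI.
  move=> q; apply/jE; rewrite fE /=.
  by rewrite ((exA _).2 (ex_intro _ q erefl)) !lin_0 addr0.
have l2 : linear (fun z : Z => (j z).2).
  by move=> a v w; rewrite !linearP.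
have [|v vE] := lift_inj (f := mklin l2) iCI.
  move=> z; apply/exC; rewrite -[mklin l2 z]/((j z).2) -lE.
  have /(congr1 e) := (jE _).2 (ex_intro _ z erefl).
  by rewrite fE linD lin_0 ((ex _).2 (ex_intro _ _ erefl)) add0r.
apply: (IH _ _ _ u v) => //; split.
- by move=> x y xy; apply: iAI; have /(congr1 j) := xy; rewrite !uE => -[].
- move=> q.
  have /ex[a aE] : e (l (iC q)) = 0.
    by rewrite lE; apply/exC; exists q.
  have [p pE] := eAs a.
  (* [l (iC q)] need not vanish: it lies in the image of [A], and the first component corrects
     it. *)
  have /jE[z zE] : f (- p, iC q) = 0 by rewrite fE /= linN pE linN aE addNr.
  by exists z; apply: iCI; rewrite vE -[mklin l2 z]/((j z).2) zE.
move=> z; split=> [hz|[q <-]]; last first.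
  by apply: iCI; rewrite vE lin_0 -[mklin l2 _]/((j _).2) uE.
have z2 : (j z).2 = 0.
  by rewrite -[LHS]/(mklin l2 z) -vE hz lin_0.
have : f (j z) = 0 by apply/jE; exists z.
rewrite fE z2 lin_0 addr0 => h0.
have /exA[q qE] : eA (j z).1 = 0 by apply: iI; rewrite h0 lin_0.
by exists q; apply: jI; rewrite uE -[mklin l1 q]/(iA q, 0) qE -z2; case: (j z).
Qed.

(* The kernel of a surjection [P -> B -> C] is an extension of
   [ker (B -> C)] by [ker (P -> B)]. *)
Lemma ses_syzygy A B C P Z (i : {linear A -> B}) (e : {linear B -> C})
    (k : {linear Z -> P}) (f : {linear P -> B}) :
  ses i e -> ses k f ->
  exists (E : lmodType R) (j : {linear E -> P}) (k' : {linear Z -> E})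
      (f' : {linear E -> A}),
    [/\ ses j (e \o f : {linear P -> C}), ses k' f',
        forall z, j (k' z) = k z & forall x, i (f' x) = f (j x)].
Proof.
move=> [iI es ex] [kI fs kx].
have [E [j [jI jE]]] := ex_kernel (e \o f : {linear P -> C}).
have [|k' k'E] := lift_inj (f := k) jI.
  move=> z; apply/jE; rewrite /= ((kx _).2 (ex_intro _ z erefl)) lin_0 //.
have [|f' f'E] := lift_inj (f := f \o j : {linear E -> B}) iI.
  by move=> x; apply/ex; apply/jE; exists x.
exists E, j, k', f'; split=> //.
  split=> // c; have [b <-] := es c; have [p <-] := fs b; by exists p.
split.
- by move=> x y /(congr1 j); rewrite !k'E => /kI.
- move=> a; have [p pE] := fs (i a).
  have /jE[x xE] : (e \o f : {linear P -> C}) p = 0.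
    by rewrite /= pE; apply/ex; exists a.
  by exists x; apply: iI; rewrite f'E /= xE.
move=> x; split=> [hx|[z <-]]; last first.
  by apply: iI; rewrite f'E /= k'E lin_0; apply/kx; exists z.
have /kx[z zE] : f (j x) = 0 by rewrite -[LHS]/((f \o j) x) -f'E hx lin_0.
by exists z; apply: jI; rewrite k'E.
Qed.

(** As [C] is projective, the kernel [E] of [P -> B -> C] is a summand of [P]; hence a presentation
    of [B] turns into one of [A] with the same syzygy [Z]. *)
Lemma pdI_ses_projective d A B C (i : {linear A -> B}) (e : {linear B -> C}) :
  ses i e -> projective C -> pdI d B -> pdI d A.
Proof.
move=> hs hC; case: d => [|d] hB.
  have [s [r [es ri bE]]] := ses_split hs hC.
  exact: (proj_retract ri) hB.
move: hB => [P [Z [k [f [hP hk hZ]]]]].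
have [E [j [k' [f' [hj hk' _ _]]]]] := ses_syzygy hs hk.
exists E, Z, k', f'; split=> //.
have [s [r [_ ri _]]] := ses_split hj hC.
exact: (proj_retract ri) hP.
Qed.

(** Schanuel's argument: the fibre product [E] of [P] and [P1] over [M] is an extension of [P] by
    [Q1] and of [P1] by [Q]. The first bounds its dimension, the second passes the bound on to
    [Q]. *)
Lemma pdI_syzygy d Q P M (i : {linear Q -> P}) (e : {linear P -> M}) :
  ses i e -> projective P -> pdI d.+1 M -> pdI d Q.
Proof.
move=> [iI es ex] hP [P1 [Q1 [i1 [e1 [hP1 [i1I e1s ex1] hQ1]]]]].
have gl : linear (fun x : P * P1 => e x.1 - e1 x.2).
  by move=> a u v; rewrite (linD e) (linZ e) (linD e1) (linZ e1) scalerBr opprD addrACA.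
have [E [j [jI jE]]] := ex_kernel (mklin gl).
have jE' z : e (j z).1 = e1 (j z).2.
  by apply/subr0_eq/jE; exists z.
have mkE p p1 : e p = e1 p1 -> exists z, j z = (p, p1).
  by move=> h; apply/jE; rewrite -[LHS]/(e p - e1 p1) h subrr.
have l1 : linear (fun q : Q => (i q, 0) : P * P1).
  by move=> a u v; rewrite linearP; congr (_, _); rewrite /= scaler0 addr0.
have [|u uE] := lift_inj (f := mklin l1) jI.
  by move=> q; apply: mkE; rewrite lin_0; apply/ex; exists q.
have l2 : linear (fun q : Q1 => (0, i1 q) : P * P1).
  by move=> a v w; rewrite linearP; congr (_, _); rewrite /= scaler0 addr0.
have [|w wE] := lift_inj (f := mklin l2) jI.
  by move=> q; apply: mkE; rewrite lin_0; apply/esym/ex1; exists q.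
have p1 : linear (fun z => (j z).1) by move=> a x y; rewrite !linearP.
have p2 : linear (fun z => (j z).2) by move=> a x y; rewrite !linearP.
apply: (@pdI_ses_projective d _ E P1 u (mklin p2)) => //.
  split.
  - by move=> x y /(congr1 j); rewrite !uE => -[/iI].
  - move=> y; have [x xE] := es (e1 y); have [z zE] := mkE _ _ xE.
    by exists z; rewrite -[LHS]/((j z).2) zE.
  - move=> z; split=> [hz|[q <-]]; last by rewrite -[LHS]/((j (u q)).2) uE.
    have hz' : (j z).2 = 0 by [].
    have /ex[q qE] : e (j z).1 = 0 by rewrite jE' hz' lin_0.
    exists q; apply: jI; rewrite uE -[LHS]/(i q, 0) qE -hz'; by case: (j z).
apply: (@horseshoe d _ E P w (mklin p1)) => //; last first.
  by case: (d) => // d'; apply: (@pdI_mono 0).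
split.
- by move=> x y /(congr1 j); rewrite !wE => -[/i1I].
- move=> y; have [x /esym xE] := e1s (e y); have [z zE] := mkE _ _ xE.
  by exists z; rewrite -[LHS]/((j z).1) zE.
move=> z; split=> [hz|[q <-]]; last by rewrite -[LHS]/((j (w q)).1) wE.
have hz' : (j z).1 = 0 by [].
have /ex1[q qE] : e1 (j z).2 = 0 by rewrite -jE' hz' lin_0.
exists q; apply: jI; rewrite wE -[LHS]/(0, i1 q) qE -hz'; by case: (j z).
Qed.

(** The kernel of [P -> B -> C] is an extension of [A] by [Z], both of dimension at most [d]. *)
Lemma pdI_ses_quotient d A B C (i : {linear A -> B}) (e : {linear B -> C}) :
  ses i e -> pdI d A -> pdI d.+1 B -> pdI d.+1 C.
Proof.
move=> hs hA [P [Z [k [f [hP hk hZ]]]]].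
have [E [j [k' [f' [hj hk' _ _]]]]] := ses_syzygy hs hk.
exists P, E, j, (e \o f : {linear P -> C}); split=> //.
exact: (horseshoe hk').
Qed.

Lemma ses_kernel A B (e : {linear A -> B}) : surj e ->
  exists (Z : lmodType R) (i : {linear Z -> A}), ses i e.
Proof. by move=> es; have [Z [i [iI ex]]] := ex_kernel e; exists Z, i. Qed.

Definition linprod A B C D (f : {linear A -> C}) (g : {linear B -> D}) :
    A * B -> C * D := fun x => (f x.1, g x.2).
Lemma linprod_linear A B C D (f : {linear A -> C}) (g : {linear B -> D}) :
  linear (linprod f g).
Proof. by move=> a u v; rewrite /linprod !linearP. Qed.

Lemma ses_prod A B C (A' B' C' : lmodType R) (i : {linear A -> B}) (e : {linear B -> C})
   (i' : {linear A' -> B'}) (e' : {linear B' -> C'}) : ses i e -> ses i' e' ->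
  ses (mklin (linprod_linear i i')) (mklin (linprod_linear e e')).
Proof.
move=> [iI es ex] [iI' es' ex']; split.
- by move=> [x x'] [y y'] [/iI -> /iI' ->].
- move=> [y y']; have [x xE] := es y; have [x' xE'] := es' y'.
  by exists (x, x'); rewrite -[LHS]/(e x, e' x') xE xE'.
move=> [y y']; split=> [[/ex[x xE] /ex'[x' xE']]|[[x x'] [<- <-]]].
  by exists (x, x'); rewrite -[LHS]/(i x, i' x') xE xE'.
by congr (_, _); [apply/ex; exists x | apply/ex'; exists x'].
Qed.

(** The complement varies in the induction: the syzygies of [M] and [N] for their free covers add up
    to a syzygy of [M * N], so the given resolution never has to be split. *)
Lemma pdI_summand d M N : pdI d ((M * N)%type : lmodType R) -> pdI d M.
Proof.
elim: d M N => [|d IH] M N hMN.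
  have l1 : linear (fun x : M => (x, 0) : M * N).
    by move=> a u v; congr (_, _); rewrite /= scaler0 addr0.
  have l2 : linear (fun x : M * N => x.1) by [].
  exact: (@proj_retract (M * N)%type M (mklin l1) (mklin l2)) hMN.
have [Z [i hi]] := ses_kernel (@free_cover_surj R M).
have [Z' [i' hi']] := ses_kernel (@free_cover_surj R N).
exists (freemod R M), Z, i, (free_cover M); split=> //; first exact: free_projective.
apply: (IH _ Z'); apply: (pdI_syzygy (ses_prod hi hi')) hMN.
by apply: proj_prod; apply: free_projective.
Qed.

(** A resolution is shifted or spliced at the first syzygy; for [d = 0] the vanishing of [P 1] makes
    [eps] an isomorphism. *)
Lemma pd_leP d M : pd_le M d <-> pdI d M.
Proof.
split.
  elim: d M => [|d IH] M [P [del [eps [hP P0 es ex0 ex]]]].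
    apply: (@pdI_iso 0 _ _ eps) => //; last exact: hP.
    apply: lin_inj => x /ex0[y <-]; rewrite (P0 1%N isT y); exact: lin_0.
  have [Z [i [iI iE]]] := ex_kernel eps.
  have [|e' e'E] := lift_inj (f := del 0%N) iI.
    by move=> c; apply/iE/ex0; exists c.
  exists (P 0%N), Z, i, eps; split; [exact: hP | by split |].
  apply: IH; exists (fun n => P n.+1), (fun n => del n.+1), e'; split=> //.
  - by move=> n dn x; apply: P0.
  - move=> z; have /ex0[x xE] : eps (i z) = 0 by apply/iE; exists z.
    by exists x; apply: iI; rewrite e'E.
  - by move=> y; rewrite -ex -e'E; split=> [->|h]; [rewrite lin_0|apply: iI; rewrite h lin_0].
elim: d M => [|d IH] M.
  move=> hM.
  exists (fun n => if n is 0 then M else 'rV[R]_0), (fun n => lin0 _ _), (linid M).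
  split.
  - by case=> // n; apply: zero_projective.
  - by case=> // n _ x; rewrite (thinmx0 x).
  - by move=> m; exists m.
  - by move=> y; split=> [hy|[x <-]] //; exists 0; rewrite lin_0 -hy.
  - by move=> n y; split=> [_|//]; exists 0; rewrite (thinmx0 y) lin_0.
move=> [P [Q [i [e [hP [iI es ex] /IH[P' [del [eps [hP' P0 es' ex0 ex']]]]]]]]].
pose PP n := if n is n'.+1 then P' n' else P.
pose del' n : {linear PP n.+1 -> PP n} :=
  match n with
  | 0 => (i \o eps : {linear P' 0%N -> P})
  | n'.+1 => del n'
  end.
exists PP, del', e; split=> //.
- by case.
- by case=> // n dn x; apply: P0.
- move=> y; rewrite ex; split=> [[x <-]|[x <-]]; last by exists (eps x).
  by have [z <-] := es' x; exists z.
- case=> [|n] /=; last exact: ex'.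
  move=> y; rewrite -ex0 /=; split=> [h|->]; last exact: lin_0.
  by apply: iI; rewrite h lin_0.
Qed.

End ProjectiveDimension.


(** * Restriction of scalars and change of rings *)

Section RestrictionOfScalars.
Variables (R T : nzRingType).

Definition restr of {rmorphism R -> T} := fun M : lmodType T => M : Type.
Variable phi : {rmorphism R -> T}.

Section Instance.
Variable M : lmodType T.
HB.instance Definition _ := GRing.Zmodule.on (restr phi M).
Definition restr_scale (a : R) (m : restr phi M) : restr phi M := phi a *: (m : M).
Fact restr_scaleA a b m : restr_scale a (restr_scale b m) = restr_scale (a * b) m.
Proof. by rewrite /restr_scale scalerA rmorphM. Qed.
Fact restr_scale1 : left_id 1 restr_scale.
Proof. by move=> m; rewrite /restr_scale rmorph1 scale1r. Qed.
Fact restr_scaleDr : right_distributive restr_scale +%R.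
Proof. by move=> a x y; apply: scalerDr. Qed.
Fact restr_scaleDl m : {morph restr_scale^~ m : a b / a + b}.
Proof. by move=> a b; rewrite /restr_scale rmorphD scalerDl. Qed.
HB.instance Definition _ := GRing.Zmodule_isLmodule.Build R (restr phi M)
  restr_scaleA restr_scale1 restr_scaleDr restr_scaleDl.
End Instance.

Lemma restrZ (M : lmodType T) a (m : restr phi M) : a *: m = phi a *: (m : M).
Proof. by []. Qed.

Definition restr_fun (M N : lmodType T) (f : {linear M -> N}) :
  restr phi M -> restr phi N := f.
Lemma restr_fun_linear (M N : lmodType T) (f : {linear M -> N}) : linear (restr_fun f).
Proof. by move=> a u v; rewrite /restr_fun linD !restrZ linZ. Qed.
Definition restr_lin (M N : lmodType T) (f : {linear M -> N}) : {linear restr phi M -> restr phi N} :=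
  mklin (restr_fun_linear f).

Lemma ses_restr (A B C : lmodType T) (i : {linear A -> B}) (e : {linear B -> C}) :
  ses i e -> ses (restr_lin i) (restr_lin e).
Proof. by []. Qed.

End RestrictionOfScalars.

Section FinitelySupportedMap.
Variables (R T : nzRingType) (X : eqType) (V : lmodType R) (W : lmodType T).
Variables (f : {additive V -> W}).

Lemma fsmap_supported (u : fsfct X V) : fin_supported (fun x => f (fscoef u x)).
Proof.
have [s _ hs] := fscoefP u; exists s => x /hs ->; exact: raddf0.
Qed.

Definition fsmap (u : fsfct X V) : fsfct X W :=
  @Subm _ _ (@fsfct_pred T X W) _ (introT (asboolP _) (fsmap_supported u)).

Lemma fsmapE u x : fscoef (fsmap u) x = f (fscoef u x).
Proof. by []. Qed.

Lemma fsmap_single x v : fsmap (fsingle x v) = fsingle x (f v).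
Proof.
apply: fsfct_eq => y; rewrite fsmapE !fsingleE; case: ifP => // _.
exact: raddf0.
Qed.

Lemma fsmap_surj : surj f -> surj fsmap.
Proof.
move=> fs u; have [s us hs] := fscoefP u.
pose g y := projT1 (cid (fs y)); have gE y : f (g y) = y by rewrite /g; case: cid.
have [|v vE] := @mk_fsfct R X V (fun x => if x \in s then g (fscoef u x) else 0).
  by exists s => x /negbTE ->.
exists v; apply: fsfct_eq => x; rewrite fsmapE vE; case: ifP => [_|/negbT/hs ->].
  exact: gE.
exact: raddf0.
Qed.

Lemma fsmapD : {morph fsmap : u v / u + v}.
Proof. by move=> u v; apply: fsfct_eq => x; rewrite fsmapE !fscoefD raddfD. Qed.

End FinitelySupportedMap.

Section ChangeOfRings.
Variables (R T : comNzRingType) (phi : {rmorphism R -> T}) (alpha : R).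
Hypothesis phi_surj : surj phi.
Hypothesis phi_ker : forall a, phi a = 0 <-> exists b, a = alpha * b.
Hypothesis alpha_reg : forall b, alpha * b = 0 -> b = 0.

(** Multiplication by [alpha] on the free [R]-module with the same basis gives a resolution of
    length one. *)
Lemma pdI_restr_free (X : eqType) :
  pdI 1 (restr phi (freemod T X) : lmodType R).
Proof.
have l1 : linear (fun u : freemod R X => alpha *: u).
  by move=> a u v; rewrite scalerDr !scalerA mulrC.
pose phi' : {additive (R^o : lmodType R) -> (T^o : lmodType T)} := phi.
have l2 : linear (fsmap phi' : freemod R X -> restr phi (freemod T X)).
  move=> a u v; apply: fsfct_eq => x.
  by rewrite fsmapE !fscoefD raddfD fscoefZ /= rmorphM.
exists (freemod R X), (freemod R X), (mklin l1), (mklin l2); split; first exact: free_projective.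
  split.
  - apply: lin_inj => u hu; apply: fsfct_eq => x; apply: alpha_reg.
    by rewrite -[LHS]/(fscoef (alpha *: u) x) [alpha *: u]hu.
  - by apply: fsmap_surj.
  - move=> u; split=> [hu|[v <-]]; last first.
      apply: fsfct_eq => x; rewrite -[LHS]/(phi (alpha * fscoef v x)).
      by apply/phi_ker; eexists.
    have hx x : exists b, fscoef u x = alpha * b.
      by apply/phi_ker; rewrite -[LHS]/(fscoef (fsmap phi' u) x) [fsmap phi' u]hu.
    pose b x : R^o := projT1 (cid (hx x)).
    have bE x : fscoef u x = alpha * b x by rewrite /b; case: cid.
    have [|v vE] := @mk_fsfct R X R^o b.
      have [s _ hs] := fscoefP u; exists s => x /hs; rewrite bE; exact: alpha_reg.
    exists v; apply: fsfct_eq => x; rewrite -[LHS]/(alpha * fscoef v x) vE.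
    by rewrite bE.
exact: free_projective.
Qed.

(** The shift by one is paid once, on free [T]-modules; projective ones are summands of these, and
    each further syzygy raises both sides together. *)
Lemma pdI_restr d (M : lmodType T) :
  pdI d M -> pdI d.+1 (restr phi M : lmodType R).
Proof.
elim: d M => [|d IH] M.
  move=> hM; have [Q [i hs]] := ses_kernel (@free_cover_surj T M).
  have [s [r [es ri fE]]] := ses_split hs hM.
  have fl : linear (fun b : restr phi (freemod T M) =>
      (free_cover M b : restr phi M, r b : restr phi Q)).
    by move=> a u v; rewrite !(linD, linZ).
  apply: (@pdI_summand R 1 _ (restr phi Q)).
  apply: (@pdI_iso R 1 _ _ (mklin fl)); last exact: pdI_restr_free.
    move=> u v uv; have uv1 : free_cover M u = free_cover M v := congr1 fst uv.
    by have uv2 : r u = r v := congr1 snd uv; rewrite (fE u) (fE v) uv1 uv2.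
  move=> [m q]; exists (i q + s m); congr (_, _).
    by rewrite -[LHS]/(free_cover M (i q + s m)) linD es (ses_comp0 _ hs) add0r.
  have iI : injective i by case: hs.
  apply: iI; have /eqP := fE (i q + s m).
  rewrite (linD (free_cover M)) es (ses_comp0 _ hs) add0r (inj_eq (addIr _)) => /eqP h.
  by symmetry.
move=> [P [Q [i [e [hP hs hQ]]]]].
apply: (pdI_ses_quotient (ses_restr phi hs)); first exact: IH.
apply: pdI_mono (IH P _); first by [].
by case: (d) => // d'; apply: (@pdI_mono _ 0).
Qed.

End ChangeOfRings.

Section RingIsomorphism.
Variables (R T : nzRingType) (phi : {rmorphism R -> T}) (psi : {rmorphism T -> R}).
Hypotheses (phiK : cancel phi psi) (psiK : cancel psi phi).

Lemma projective_restr_iso (N : lmodType R) :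
  projective N -> projective (restr psi N : lmodType T).
Proof.
move=> hN A B g f gs.
have fl : linear (f : N -> restr phi B).
  move=> a u v; rewrite restrZ -(linZ f) -(linD f); congr (f _).
  by rewrite restrZ phiK.
have [h hE] := hN _ _ (restr_lin phi g) (mklin fl) gs.
have hl : linear (h : restr psi N -> A).
  by move=> a u v; rewrite restrZ (linD h) (linZ h) restrZ psiK.
by exists (mklin hl).
Qed.

Lemma pdI_restr_iso d (N : lmodType R) :
  pdI d N -> pdI d (restr psi N : lmodType T).
Proof.
elim: d N => [|d IH] N; first exact: projective_restr_iso.
move=> [P [Q [i [e [hP hs hQ]]]]].
exists (restr psi P), (restr psi Q), (restr_lin psi i), (restr_lin psi e).
split; [exact: projective_restr_iso | exact: ses_restr | exact: IH].
Qed.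

(** Restricting along [phi] and then along [psi] gives back the module one started from. *)
Lemma gldim_iso d : (forall N : lmodType R, pdI d N) ->
  forall M : lmodType T, pdI d M.
Proof.
move=> hR M; have := pdI_restr_iso (hR (restr phi M : lmodType R)).
have fl : linear (id : restr psi (restr phi M) -> M).
  by move=> a u v; rewrite !restrZ psiK.
apply: (@pdI_iso T d _ _ (mklin fl)) => // x; by exists x.
Qed.

End RingIsomorphism.

(** * Hilbert's syzygy theorem *)

Section ModuleWithEndomorphism.
Variables (R : comNzRingType) (V : lmodType R).

(** A module over [{poly R}] is an [R]-module with an endomorphism, the action of ['X]. *)
Definition polymod of {linear V -> V} : Type := V.
Variable X : {linear V -> V}.
HB.instance Definition _ := GRing.Zmodule.on (polymod X).

Definition pact (p : {poly R}) (v : V) : V := \sum_(i < size p) p`_i *: iter i X v.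

Lemma pactE (n : nat) (p : {poly R}) v : (size p <= n)%N ->
  pact p v = \sum_(i < n) p`_i *: iter i X v.
Proof.
move=> pn; rewrite /pact -!(big_mkord xpredT (fun i => p`_i *: iter i X v)).
rewrite [RHS](big_cat_nat (n := size p)) //= [X in _ + X]big1_seq ?addr0 // => i.
by rewrite mem_index_iota => /andP[_ /andP[pi _]]; rewrite nth_default // scale0r.
Qed.

Lemma pactDl p q v : pact (p + q) v = pact p v + pact q v.
Proof.
have s1 : (size p <= maxn (size p) (size q))%N by rewrite leq_maxl.
have s2 : (size q <= maxn (size p) (size q))%N by rewrite leq_maxr.
rewrite (pactE v s1) (pactE v s2) (pactE v (size_polyD p q)) -big_split.
by apply: eq_bigr => i _; rewrite coefD scalerDl.
Qed.

Lemma pact_linear p : linear (pact p).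
Proof.
move=> a u v; rewrite /pact scaler_sumr -big_split; apply: eq_bigr => i _.
have -> : iter i X (a *: u + v) = a *: iter i X u + iter i X v.
  by elim: (i : nat) => //= k ->; rewrite linearP.
by rewrite scalerDr !scalerA mulrC.
Qed.

Lemma pactC c v : pact c%:P v = c *: v.
Proof. by rewrite (pactE v (size_polyC_leq1 c)) big_ord1 coefC. Qed.

Lemma pactMX p v : pact (p * 'X) v = X (pact p v).
Proof.
have s1 : (size (p * 'X)%R <= (size p).+1)%N.
  by apply: leq_trans (size_polyMleq _ _) _; rewrite size_polyX addn2.
rewrite (pactE v s1) big_ord_recl coefMX scale0r add0r /pact raddf_sum.
by apply: eq_bigr => i _; rewrite coefMX /= linearZ.
Qed.

Lemma pact1 v : pact 1 v = v. Proof. by rewrite pactC scale1r. Qed.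

Lemma pactCM c q v : pact (c%:P * q) v = c *: pact q v.
Proof.
elim/poly_ind: q => [|q d IHq].
  by rewrite mulr0 -[0]/(0%:P) pactC scale0r scaler0.
rewrite mulrDr mulrA !pactDl !pactMX scalerDr IHq linearZ_LR !pactC.
by rewrite scalerA -polyCM pactC.
Qed.

Lemma pactA p q v : pact p (pact q v) = pact (p * q) v.
Proof.
elim/poly_ind: p => [|p c IH].
  by rewrite mul0r -[0]/(0%:P) !pactC !scale0r.
rewrite mulrDl !pactDl pactMX IH pactC pactCM; congr (_ + _).
by rewrite -pactMX -!mulrA ['X * q]mulrC.
Qed.

Fact pact_scaleA p q (v : polymod X) : pact p (pact q v) = pact (p * q) v.
Proof. exact: pactA. Qed.
Fact pact_scale1 : left_id 1 (pact : {poly R} -> polymod X -> polymod X).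
Proof. exact: pact1. Qed.
Fact pact_scaleDr :
  right_distributive (pact : {poly R} -> polymod X -> polymod X) +%R.
Proof. by move=> p u v; apply: (linD (mklin (pact_linear p))). Qed.
Fact pact_scaleDl (v : polymod X) : {morph pact^~ v : p q / p + q}.
Proof. by move=> p q; apply: pactDl. Qed.
HB.instance Definition _ := GRing.Zmodule_isLmodule.Build {poly R} (polymod X)
  pact_scaleA pact_scale1 pact_scaleDr pact_scaleDl.

Lemma polymodZ (p : {poly R}) (v : polymod X) : p *: v = pact p v.
Proof. by []. Qed.

Lemma polymodC c (v : polymod X) : c%:P *: v = c *: (v : V).
Proof. exact: pactC. Qed.

Lemma polymodX (v : polymod X) : 'X *: v = X v.
Proof. by rewrite -['X]mul1r polymodZ pactMX pact1. Qed.

Lemma polymod_linear (M : lmodType {poly R}) (f : polymod X -> M) :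
  {morph f : u v / u + v} -> (forall c (v : V), f (c *: v) = c%:P *: f v) ->
  (forall v, f (X v) = 'X *: f v) -> linear f.
Proof.
move=> fD fC fX p u v; rewrite fD; congr (_ + _).
elim/poly_ind: p => [|p c IH].
  by rewrite !scale0r; apply: (addIr (f 0)); rewrite -fD !add0r.
rewrite !scalerDl fD [p * _]mulrC -!scalerA polymodX fX IH; congr (_ + _).
by rewrite polymodC fC.
Qed.

End ModuleWithEndomorphism.

(** * Polynomial extension of a module and the characteristic sequence *)

Section PolynomialExtension.
Variable R : comNzRingType.
Implicit Types (W P Q : lmodType R) (M : lmodType {poly R}).

Section Shift.
Variable W : lmodType R.
Lemma shift_supported (u : fsfct nat W) :
  fin_supported (fun i => if i is j.+1 then fscoef u j else 0).
Proof.
have [s _ hs] := fscoefP u; exists (map S s) => -[|i] //.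
by rewrite mem_map => [/hs|? ? []].
Qed.
Definition shift (u : fsfct nat W) : fsfct nat W :=
  @Subm _ _ (@fsfct_pred R nat W) _ (introT (asboolP _) (shift_supported u)).
Lemma shiftE u i : fscoef (shift u) i = if i is j.+1 then fscoef u j else 0.
Proof. by []. Qed.
Lemma shift_linear : linear shift.
Proof.
move=> a u v; apply: fsfct_eq => -[|i]; rewrite fscoefD fscoefZ !shiftE //.
by rewrite scaler0 addr0.
Qed.
Lemma shift_single i w : shift (fsingle i w) = fsingle i.+1 w.
Proof. by apply: fsfct_eq => -[|j]; rewrite shiftE !fsingleE. Qed.
End Shift.

(** The module [W[X]]: a finitely supported sequence lists the coefficients, and ['X] shifts
    them. *)
Definition polyext W : lmodType {poly R} :=
  polymod (mklin (@shift_linear W)).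

Lemma polyextX W (u : polyext W) : 'X *: u = shift u.
Proof. exact: (@polymodX _ _ (mklin (@shift_linear W))). Qed.

Lemma polyextC W c (u : polyext W) : c%:P *: u = c *: (u : fsfct nat W).
Proof. exact: (@polymodC _ _ (mklin (@shift_linear W))). Qed.

Lemma polyext_linear W M (f : fsfct nat W -> M) :
  {morph f : u v / u + v} -> (forall c v, f (c *: v) = c%:P *: f v) ->
  (forall v, f (shift v) = 'X *: f v) -> linear (f : polyext W -> M).
Proof. exact: (@polymod_linear _ _ (mklin (@shift_linear W))). Qed.

Section Eval.
Variables (W : lmodType R) (M : lmodType {poly R}).
Variable g : {linear W -> restr polyC M}.
Definition pe_fun (i : nat) (w : W) : M := 'X^i *: (g w : M).
Lemma pe_fun_additive i : zmod_morphism (pe_fun i).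
Proof. by move=> u v; rewrite /pe_fun linB -scalerBr. Qed.
HB.instance Definition _ i := GRing.isZmodMorphism.Build W M (pe_fun i)
  (@pe_fun_additive i).

Definition polyext_eval : fsfct nat W -> M := fsext pe_fun.
Lemma polyext_eval_linear : linear (polyext_eval : polyext W -> M).
Proof.
apply: polyext_linear => [|c v|v]; first exact: fsextD.
  rewrite /polyext_eval (@fsextE _ _ _ _ _ (fssupp v)) ?fssupp_uniq //.
    rewrite /fsext scaler_sumr; apply: eq_bigr => i _.
    rewrite fscoefZ /= /pe_fun linZ restrZ !scalerA mulrC //.
  by move=> i /fssuppN h; rewrite fscoefZ h scaler0.
have sD : {morph @shift W : u v / u + v} by apply: (linD (mklin (@shift_linear W))).
have s0 : shift (0 : fsfct nat W) = 0 by apply: (lin_0 (mklin (@shift_linear W))).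
rewrite {1}(fsfctE v) (big_morph _ sD s0).
have fs : {morph polyext_eval : u v / u + v} by apply: fsextD.
have f0 : polyext_eval 0 = 0.
  by apply: (addIr (polyext_eval 0)); rewrite -fs !add0r.
rewrite (big_morph _ fs f0) /polyext_eval [in RHS]/fsext scaler_sumr.
apply: eq_bigr => i _; rewrite shift_single fsext_single /=.
by rewrite /pe_fun scalerA -exprS.
Qed.
Lemma polyext_eval_single i w : polyext_eval (fsingle i w) = 'X^i *: (g w : M).
Proof. exact: fsext_single. Qed.
End Eval.

Lemma polyext_projective P : projective P -> projective (polyext P).
Proof.
move=> hP A B g f gs.
have fl : linear (fun p : P => f (fsingle 0%N p : polyext P) : restr polyC B).
  move=> a u v; rewrite restrZ -(linZ f) -(linD f); congr (f _).
  by rewrite linearP polyextC.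
have [h hE] := hP _ _ (restr_lin polyC g) (mklin fl) gs.
exists (mklin (polyext_eval_linear h)) => u.
have ind (l1 l2 : fsfct nat P -> B) : {morph l1 : u v / u + v} ->
    {morph l2 : u v / u + v} -> (forall i w, l1 (fsingle i w) = l2 (fsingle i w)) ->
    l1 =1 l2.
  move=> a1 a2 e v; rewrite (fsfctE v).
  have z (l : fsfct nat P -> B) : {morph l : u v / u + v} -> l 0 = 0.
    by move=> la; apply: (addIr (l 0)); rewrite -la !add0r.
  rewrite (big_morph _ a1 (z _ a1)) (big_morph _ a2 (z _ a2)).
  by apply: eq_bigr => i _; apply: e.
apply: (ind (fun u => g (polyext_eval h u)) f) => {u} [u v|u v|i w].
- by rewrite -linD; congr (g _); apply: fsextD.
- exact: (linD f).
rewrite polyext_eval_single linZ.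
have -> : g (h w : A) = f (fsingle 0%N w : polyext P) := hE w.
rewrite -linZ; congr (f _); elim: i => [|i IH]; first by rewrite expr0 scale1r.
by rewrite exprS -scalerA IH polyextX shift_single.
Qed.

Lemma fsmap_polyext_linear W P (f : {linear W -> P}) :
  linear (fsmap f : polyext W -> polyext P).
Proof.
apply: polyext_linear => [|c v|v]; first exact: fsmapD.
  by apply: fsfct_eq => i; rewrite polyextC fsmapE !fscoefZ /= linZ.
rewrite polyextX; apply: fsfct_eq => -[|i]; rewrite !fsmapE !shiftE ?fsmapE //.
exact: lin_0.
Qed.

Lemma pdI_polyext d W : pdI d W -> pdI d (polyext W).
Proof.
elim: d W => [|d IH] W; first exact: polyext_projective.
move=> [P [Q [i [e [hP [iI es ex] hQ]]]]].
exists (polyext P), (polyext Q), (mklin (fsmap_polyext_linear i)),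
  (mklin (fsmap_polyext_linear e)).
split; [exact: polyext_projective | split | exact: IH].
- move=> u v uv; apply: fsfct_eq => x; apply: iI.
  by have := congr1 (fun w => fscoef w x) uv.
- by apply: fsmap_surj.
move=> u; split=> [hu|[v <-]].
  have hx x : exists q, i q = fscoef u x.
    by apply/ex; have := congr1 (fun w => fscoef w x) hu.
  have [s _ hs] := fscoefP u.
  pose b x := projT1 (cid (hx x)).
  have bE x : i (b x) = fscoef u x by rewrite /b; case: cid.
  have [|v vE] := @mk_fsfct R nat Q b.
    by exists s => x /hs h; apply: iI; rewrite bE h lin_0.
  exists v; apply: fsfct_eq => x.
  by rewrite -[LHS]/(i (fscoef v x)) vE.
apply: fsfct_eq => x.
by apply/ex; exists (fscoef v x).
Qed.

Section Resolution.
Variable M : lmodType {poly R}.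
Definition base : lmodType R := restr polyC M.
Lemma mulX_linear : linear (fun m : base => 'X *: (m : M) : base).
Proof.
move=> a u v; rewrite !restrZ scalerDr; congr (_ + _).
by rewrite !scalerA mulrC.
Qed.
Definition mulX : {linear base -> base} := mklin mulX_linear.

(** The difference of the two actions of ['X] on [M[X]], on coefficients and on degrees, as in the
    characteristic sequence [0 -> M[X] -> M[X] -> M -> 0]. *)
Definition pres_fun (u : fsfct nat base) : fsfct nat base := fsmap mulX u - shift u.

Lemma pres_funE u i : fscoef (pres_fun u) i =
  'X *: (fscoef u i : M) - (if i is j.+1 then fscoef u j else 0).
Proof. by []. Qed.

Lemma pres_linear : linear (pres_fun : polyext base -> polyext base).
Proof.
have sh := linD (mklin (@shift_linear base)).
apply: polyext_linear => [u v|c v|v].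
- by rewrite /pres_fun fsmapD [shift _]sh opprD addrACA.
- rewrite polyextC; apply: fsfct_eq => -[|i]; rewrite fscoefZ !pres_funE !fscoefZ.
    by rewrite !restrZ !subr0 !scalerA mulrC.
  by rewrite !restrZ scalerBr !scalerA mulrC.
rewrite polyextX; apply: fsfct_eq => -[|i]; rewrite shiftE !pres_funE !shiftE //.
by rewrite scaler0 subr0.
Qed.

Lemma id_linear : linear (id : base -> restr polyC M). Proof. by []. Qed.

Lemma polyext_presentation :
  ses (mklin pres_linear) (mklin (polyext_eval_linear (mklin id_linear))).
Proof.
set e := polyext_eval (mklin id_linear).
have eD : {morph e : u v / u + v} by apply: fsextD.
have e1 i m : e (fsingle i m) = 'X^i *: (m : M) by apply: polyext_eval_single.
split.
- apply: lin_inj => u hu.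
  have hi i : 'X *: (fscoef u i : M) = (if i is j.+1 then fscoef u j else 0).
    by apply/subr0_eq; rewrite -pres_funE [pres_fun u]hu.
  have [s _ hs] := fscoefP u.
  have big k : (\max_(i <- s) i < k)%N -> fscoef u k = 0.
    move=> sk; apply: hs; apply: contraL sk => ks; rewrite -leqNgt.
    by rewrite (big_rem k) //= leq_maxl.
  apply: fsfct_eq => i; rewrite fscoef0.
  (* By [hi] each coefficient is ['X] times the next one; descent from beyond the support kills them
     all. *)
  have [k ik] : exists k, (\max_(j <- s) j < i + k)%N.
    by exists (\max_(j <- s) j).+1; rewrite addnS ltnS leq_addl.
  elim: k i ik => [|k IH] i ik; first by apply: big; rewrite -[i]addn0.
  by have := hi i.+1; rewrite IH ?addSnnS // scaler0 => <-.
- by move=> m; exists (fsingle 0%N (m : base)); rewrite -[LHS]/(e _) e1 expr0 scale1r.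
move=> u; split=> [hu|[v <-]]; last first.
  have lin := mklin pres_linear.
  rewrite {1}(fsfctE v) -[LHS]/(e (pres_fun _)).
  have pD : {morph pres_fun : u v / u + v} by move=> u' v'; apply: (linD (mklin pres_linear)).
  have p0 : pres_fun 0 = 0 by apply: (lin_0 (mklin pres_linear)).
  have e0 : e 0 = 0 by apply: (addIr (e 0)); rewrite -eD !add0r.
  rewrite (big_morph _ pD p0) (big_morph _ eD e0) big1 // => i _.
  have eN w : e (- w) = - e w by apply: (addIr (e w)); rewrite -eD !addNr.
  rewrite /pres_fun fsmap_single shift_single eD eN !e1.
  by apply/eqP; rewrite subr_eq0 exprSr -scalerA.
(* Modulo the image, ['X] can be moved from degrees to coefficients, so every element is congruent
   to its value placed in degree 0. *)
suff H (v : fsfct nat base) : exists w, pres_fun w = v - fsingle 0%N (e v : base).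
  have [w wE] := H u; exists w; rewrite -[LHS]/(pres_fun w) wE.
  by have -> : e u = 0 := hu; rewrite (lin_0 (fsingle 0%N)) subr0.
have H1 i m : exists w, pres_fun w = fsingle i m - fsingle 0%N (e (fsingle i m) : base).
  elim: i m => [|i IH] m.
    exists 0; rewrite [LHS](lin_0 (mklin pres_linear)) e1 expr0 scale1r.
    by rewrite subrr.
  have [w wE] := IH ('X *: (m : M) : base).
  exists (w - fsingle i m); rewrite [LHS](linB (mklin pres_linear)).
  rewrite -![mklin _ _]/(pres_fun _) wE /pres_fun fsmap_single shift_single !e1.
  have -> : 'X^(i.+1) *: (m : M) = 'X^i *: ('X *: (m : M)) by rewrite scalerA -exprSr.
  have sub3 (a b c : fsfct nat base) : (a - b) - (a - c) = c - b.
    by rewrite opprB addrC addrA subrK.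
  exact: sub3.
have [s] : exists s, s = fssupp v by eexists.
rewrite (fsfctE v) => _; elim/big_rec: _ => [|i w _ [x xE]].
  exists 0; rewrite [LHS](lin_0 (mklin pres_linear)).
  have -> : e 0 = 0 by apply: (addIr (e 0)); rewrite -eD !add0r.
  by rewrite (lin_0 (fsingle 0%N)) subrr.
have [y yE] := H1 i (fscoef v i).
exists (y + x); rewrite [LHS](linD (mklin pres_linear)) -![mklin _ _]/(pres_fun _).
by rewrite yE xE eD (linD (fsingle 0%N)) opprD addrACA.
Qed.

End Resolution.

(** The first two terms of the characteristic sequence are extended from [R], hence of dimension at
    most [d]. *)
Lemma gldim_poly d : (forall W, pdI d W) -> forall M, pdI d.+1 M.
Proof.
move=> hR M; have h := pdI_polyext (hR (base M)).
exact: pdI_ses_quotient (polyext_presentation M) h (pdI_S h).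
Qed.

End PolynomialExtension.


(** * Modules over a field *)

Section VectorSpaces.
Variable R : comNzRingType.
Hypothesis inv : forall a : R, a != 0 -> exists b, b * a = 1.

(** Zorn's lemma on graphs of partial liftings of [f] through [g]: a maximal one is defined
    everywhere, as a missing point can be adjoined with any preimage of its value. *)
Lemma field_projective (P : lmodType R) : projective P.
Proof.
move=> M N g f gs.
pose ok (G : classical_sets.set (P * M)) :=
  [/\ submodule (G : (P * M)%type -> Prop), forall x, G x -> g x.2 = f x.1 &
      forall m, G (0, m) -> m = 0].
pose Q := fun G : classical_sets.set (P * M) => G = classical_sets.set0 \/ ok G.
have [G [QG Gmax]] : exists A, Q A /\ forall B, classical_sets.proper A B -> ~ Q B.
  apply: classical_sets.Zorn_bigcup => F FQ Ftot.
  have [[H FH [x Hx]]|F0] := pselect (exists2 H, F H & exists x, H x); last first.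
    left; apply/classical_sets.seteqP; split=> [x [H FH Hx]|//].
    by case: F0; exists H => //; exists x.
  have Fok B y : F B -> B y -> ok B.
    by move=> /FQ [->|].
  right; split; [split|..].
  - by exists H => //; have [[]] := Fok _ _ FH Hx.
  - move=> a u v [U FU Uu] [V FV Vv].
    have [UV|VU] := Ftot U V FU FV.
      by exists V => //; have [[_ VL] _ _] := Fok _ _ FV Vv; apply: VL (UV _ Uu) Vv.
    by exists U => //; have [[_ UL] _ _] := Fok _ _ FU Uu; apply: UL Uu (VU _ Vv).
  - by move=> y [U FU Uy]; have [_ h _] := Fok _ _ FU Uy; apply: h.
  - by move=> m [U FU Uy]; have [_ _ h] := Fok _ _ FU Uy; apply: h.
have okG : ok G.
  case: QG => // G0; exfalso.
  apply: (Gmax (fun x => x = 0)); last first.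
    right; split; [split=> //|by move=> x -> /=; rewrite !lin_0|by move=> m []].
    by move=> a u v -> ->; rewrite scaler0 addr0.
  by rewrite G0; split=> [x //|h]; apply: (h 0).
have [[G0 GL] Gf G1] := okG.
have total p : exists m, G (p, m).
  apply: contrapT => hp; have [m0 m0E] := gs (f p).
  pose B : classical_sets.set (P * M) := fun x => exists a y, G y /\ x = a *: (p, m0) + y.
  apply: (Gmax B).
    split=> [x Gx|h]; first by exists 0, x; rewrite scale0r add0r.
    apply: hp; exists m0; apply: h; exists 1, 0.
    by rewrite scale1r addr0.
  right; split; [split|..].
  - by exists 0, 0; rewrite scale0r addr0.
  - move=> c _ _ [a [y [Gy ->]]] [b [z [Gz ->]]].
    exists (c * a + b), (c *: y + z); split; first exact: GL.
    by rewrite scalerDr scalerDl scalerA addrACA.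
  - by move=> _ [a [y [Gy ->]]] /=; rewrite !(linD, linZ) m0E (Gf _ Gy).
  move=> m [a [y [Gy yE]]].
  have [a0|a0] := eqVneq a 0.
    by move: yE; rewrite a0 scale0r add0r => yE; apply: G1; rewrite yE.
  (* Dividing by [a] would place [p] in the domain of [G], against its choice. *)
  case: hp; have [b ba] := inv a0; exists (- (b *: y.2)).
  have -> : (p, - (b *: y.2)) = (- b) *: y + 0 :> (P * M)%type.
    rewrite addr0; case: y yE {Gy} => y1 y2 [yE _] /=; congr (_, _); last by rewrite scaleNr.
    have /eqP := esym yE; rewrite addrC addr_eq0 => /eqP ->.
    by rewrite scalerN scaleNr opprK scalerA ba scale1r.
  by apply: GL.
pose h p := projT1 (cid (total p)); have hE p : G (p, h p) by rewrite /h; case: cid.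
have uniq p m m' : G (p, m) -> G (p, m') -> m = m'.
  move=> h1 h2; apply/subr0_eq/G1.
  have := GL (-1) _ _ h2 h1; congr G; congr (_, _); first by rewrite /= scaleN1r addNr.
  by rewrite /= scaleN1r addrC.
have hl : linear h.
  by move=> a u v; apply: uniq (hE _) _; apply: (GL a _ _ (hE u) (hE v)).
by exists (mklin hl) => x; apply: (Gf _ (hE x)).
Qed.
End VectorSpaces.

Section HilbertSyzygy.
Variable K : fieldType.

Lemma mpoly_rmorph_eq (n : nat) (T : comNzRingType) (R : comNzRingType)
    (f g : {rmorphism {mpoly R[n]} -> T}) :
  (forall c, f c%:MP = g c%:MP) -> (forall i, f 'X_i = g 'X_i) -> f =1 g.
Proof.
move=> hC hX p; rewrite (mpolyE p) !rmorph_sum; apply: eq_bigr => m _.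
rewrite -mul_mpolyC !rmorphM hC; congr (_ * _).
rewrite mpolyXE_id !rmorph_prod; apply: eq_bigr => i _.
by rewrite !rmorphXn hX.
Qed.

Lemma poly_rmorph_eq (R T : comNzRingType) (f g : {rmorphism {poly R} -> T}) :
  (forall c, f c%:P = g c%:P) -> f 'X = g 'X -> f =1 g.
Proof.
move=> hC hX p; elim/poly_ind: p => [|p c IH]; first by rewrite !rmorph0.
by rewrite !rmorphD !rmorphM IH hX hC.
Qed.

Section Step.
Variable n : nat.

Lemma muniX_max : muni ('X_ord_max : {mpoly K[n.+1]}) = 'X.
Proof.
rewrite muniE msuppX big_seq1 mcoeffX eqxx mnmE eqxx scale1r expr1.
have -> : [multinom (U_(ord_max) : 'X_{1..n.+1})%MM (widen_ord (leqnSn n) i) | i < n] = 0%MM.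
  by apply/mnmP=> i; rewrite !mnmE -val_eqE /= gtn_eqF.
by rewrite mpolyX0 scale1r.
Qed.

Lemma muni_mwiden (p : {mpoly K[n]}) : muni (mwiden p) = p%:P.
Proof.
apply: (mpoly_rmorph_eq (f := @muni n K \o @mwiden n K) (g := polyC)) => [c|i] /=.
  by rewrite mwidenC muniC.
rewrite mwidenX mnmwiden1 muniE msuppX big_seq1 mcoeffX eqxx scale1r.
rewrite mnm1E -val_eqE /= ltn_eqF // expr0.
have -> : [multinom (U_(widen_ord (leqnSn n) i) : 'X_{1..n.+1})%MM (widen_ord (leqnSn n) j)
   | j < n] = U_(i)%MM.
  by apply/mnmP=> j; rewrite !mnmE -!val_eqE.
by rewrite -mul_polyC mulr1.
Qed.

Lemma mwiden_commr : commr_rmorph (@mwiden n K) ('X_ord_max : {mpoly K[n.+1]}).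
Proof. by move=> p; apply: mulrC. Qed.

Definition mmulti_morph : {rmorphism {poly {mpoly K[n]}} -> {mpoly K[n.+1]}} :=
  horner_morph mwiden_commr.

Lemma mmulti_morphK : cancel mmulti_morph (@muni n K).
Proof.
apply: (poly_rmorph_eq (f := @muni n K \o mmulti_morph) (g := idfun)) => [c|] /=.
  by rewrite horner_morphC muni_mwiden.
by rewrite horner_morphX muniX_max.
Qed.

Lemma muniK : cancel (@muni n K) mmulti_morph.
Proof.
apply: (mpoly_rmorph_eq (f := mmulti_morph \o @muni n K) (g := idfun)) => [c|i] /=.
  rewrite muniC horner_morphC; exact: mwidenC.
have [j ->|->] := unliftP ord_max i.
  have -> : lift ord_max j = widen_ord (leqnSn n) j by apply: val_inj; rewrite /= /bump leqNgt ltn_ord.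
  rewrite -mnmwiden1 -mwidenX muni_mwiden; exact: horner_morphC.
rewrite muniX_max; exact: horner_morphX.
Qed.
End Step.

(** Without variables the ring is a field and every module is projective; each further variable
    costs one by [gldim_poly]. *)
Theorem hilbert_syzygy (n : nat) (M : lmodType {mpoly K[n]}) : pdI n M.
Proof.
elim: n M => [|n IH] M.
  apply: field_projective => p p0; have pE : p = (p@_0)%:MP.
    apply/mpolyP => m; rewrite mcoeffC.
    have -> : m = 0%MM by apply/mnmP; case.
    by rewrite eqxx mulr1.
  exists ((p@_0)^-1)%:MP; rewrite pE mcoeffC eqxx mulr1 -mpolyCM mulVf ?mpolyC1 //.
  by apply: contra p0 => /eqP h; rewrite pE h mpolyC0.
apply: (gldim_iso (@mmulti_morphK n) (@muniK n)).
exact: gldim_poly.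
Qed.

(* [M] is a second syzygy. *)
Lemma pdI_kernel (n : nat) (M F0 F1 : lmodType {mpoly K[n]})
    (i : {linear M -> F0}) (f : {linear F0 -> F1}) :
  injective i -> exact_at i f -> projective F0 -> projective F1 -> pdI (n - 2) M.
Proof.
move=> iI ex h0 h1.
have [I [j [e [jI es jE]]]] := ex_image f.
have [C [p [ps pE]]] : exists (C : lmodType {mpoly K[n]}) (p : {linear F1 -> C}),
    surj p /\ forall y, p y = 0 <-> exists x, j x = y.
  apply: ex_quotient; split=> [|a u v [x <-] [y <-]]; first by exists 0; rewrite lin_0.
  by exists (a *: x + y); rewrite linD linZ.
have s1 : ses j p by split.
have s2 : ses i e.
  split=> // y; rewrite -ex -jE; split=> [->|h]; first exact: lin_0.
  by apply: jI; rewrite h lin_0.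
(* Truncated subtraction is harmless: [(n - 2).+2] is at least [n] also when [n < 2]. *)
have hC : pdI (n - 2).+2 C by apply: pdI_mono (hilbert_syzygy C); lia.
exact: pdI_syzygy s2 h0 (pdI_syzygy s1 h1 hC).
Qed.
End HilbertSyzygy.

(** * Koszul cohomology *)

Section Koszul.
Variable R : comNzRingType.
Implicit Types (M N A B C P Q : lmodType R) (gs : seq R).

(* Koszul cochains, built as iterated mapping cones: [kosz (g :: gs)] is the
   cone of [g] acting on [kosz gs]. *)
Fixpoint kosz M gs (q : nat) : lmodType R :=
  match gs, q with
  | [::], 0 => M
  | [::], _ => 'rV[R]_0
  | g :: gs', 0 => kosz M gs' 0
  | g :: gs', q'.+1 => (kosz M gs' q'.+1 * kosz M gs' q')%type
  end.

Fixpoint kd M gs {struct gs} : forall q, kosz M gs q -> kosz M gs q.+1 :=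
  match gs with
  | [::] => fun q _ => 0
  | g :: gs' => fun q => match q with
      | 0 => fun a : kosz M gs' 0 => (@kd M gs' 0 a, g *: a)
      | q'.+1 => fun ab : (kosz M gs' q'.+1 * kosz M gs' q')%type =>
          (@kd M gs' q'.+1 ab.1, g *: ab.1 - @kd M gs' q' ab.2)
      end
  end.
Arguments kd {M gs q}.

Lemma kd_linear M gs q : linear (@kd M gs q).
Proof.
elim: gs q => [|g gs IH] [|q] a u v /=; rewrite ?scaler0 ?addr0 //.
  by rewrite IH; congr (_, _); rewrite /= scalerDr !scalerA mulrC.
rewrite IH; congr (_, _); rewrite /= IH scalerDr scalerBr !scalerA mulrC opprD.
by rewrite addrACA.
Qed.
HB.instance Definition _ M gs q := GRing.isLinear.Build R _ _ *:%R
  (@kd M gs q) (@kd_linear M gs q).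

Lemma kdd M gs q (c : kosz M gs q) : kd (kd c) = 0.
Proof.
elim: gs q c => [|g gs IH] [|q] c //=; congr (_, _); try exact: IH.
  by rewrite (linZ (@kd M gs 0)) subrr.
by rewrite (linB (@kd M gs q.+1)) (linZ (@kd M gs q.+1)) /= (IH q) subr0 subrr.
Qed.

Fixpoint km M N (f : {linear M -> N}) gs : forall q, kosz M gs q -> kosz N gs q :=
  match gs with
  | [::] => fun q => match q with 0 => f | _ => id end
  | g :: gs' => fun q => match q with
      | 0 => @km M N f gs' 0
      | q'.+1 => fun ab : (kosz M gs' q'.+1 * kosz M gs' q')%type =>
          (@km M N f gs' q'.+1 ab.1, @km M N f gs' q' ab.2)
      end
  end.
Arguments km {M N} f {gs q}.

Lemma km_linear M N (f : {linear M -> N}) gs q : linear (@km M N f gs q).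
Proof.
elim: gs q => [|g gs IH] [|q] a u v //=; first exact: linearP.
  exact: (IH 0%N).
by congr (_, _); apply: IH.
Qed.
HB.instance Definition _ M N f gs q := GRing.isLinear.Build R _ _ *:%R
  (@km M N f gs q) (@km_linear M N f gs q).

Lemma km_kd M N (f : {linear M -> N}) gs q (c : kosz M gs q) :
  km f (kd c) = kd (km f c).
Proof.
elim: gs q c => [|g gs IH] [|q] c //=.
- congr (_, _); first exact: IH.
  exact: (linZ (@km M N f gs 0)).
congr (_, _); first exact: IH.
by rewrite (linB (@km M N f gs q.+1)) (linZ (@km M N f gs q.+1)) /= (IH q).
Qed.

Lemma km_inj M N (f : {linear M -> N}) gs q :
  injective f -> injective (km f : kosz M gs q -> kosz N gs q).
Proof.
move=> fI; elim: gs q => [|g gs IH] [|q] x y //=.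
- exact: fI.
- exact: (IH 0%N).
by case: x y => [a b] [a' b'] /= [/IH -> /IH ->].
Qed.

Lemma km_surj M N (f : {linear M -> N}) gs q :
  surj f -> surj (km f : kosz M gs q -> kosz N gs q).
Proof.
move=> fs; elim: gs q => [|g gs IH] [|q] y /=.
- exact: fs.
- by exists y.
- exact: (IH 0%N).
case: y => a b; have [x <-] := IH _ a; have [y <-] := IH _ b.
by exists (x, y).
Qed.

Lemma km_exact A B C (i : {linear A -> B}) (e : {linear B -> C}) gs q
    (c : kosz B gs q) :
  exact_at i e -> (km e c = 0 <-> exists a, km i a = c).
Proof.
move=> ex; elim: gs q c => [|g gs IH] [|q] c /=.
- exact: ex.
- by split=> [_|_]; [exists c | rewrite (thinmx0 c)].
- exact: (IH 0%N).
case: c => b b'; split=> [[/IH[a aE] /IH[a' aE']]|[[a a'] [<- <-]]].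
  by exists (a, a'); rewrite /= aE aE'.
by congr (_, _); apply/IH; eexists.
Qed.

Definition coboundary M gs q : kosz M gs q -> Prop :=
  match q with
  | 0 => fun c => c = 0
  | q'.+1 => fun c => exists b, kd b = c
  end.

(* [H^q(gs; M) = 0] *)
Definition acyc gs q M : Prop :=
  forall c : kosz M gs q, kd c = 0 -> coboundary c.

Lemma acyc_retract gs q M P (s : {linear M -> P}) (r : {linear P -> M}) :
  (forall x, r (s x) = x) -> acyc gs q P -> acyc gs q M.
Proof.
move=> rs hP c dc.
have rsK q' (b : kosz M gs q') : km r (km s b) = b.
  elim: (gs) q' b => [|g gs' IH] [|q'] //= [a b].
  by rewrite !IH.
have : coboundary (km s c) by apply: hP; rewrite -km_kd dc lin_0.
case: q c dc {hP} => [|q] c dc /=; first by rewrite -{2}[c]rsK => ->; rewrite lin_0.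
by move=> [b bE]; exists (km r b); rewrite -km_kd bE rsK.
Qed.

(** The portion [H^q(B) -> H^q(C) -> H^(q+1)(A)] of the long exact sequence. *)
Lemma acyc_quotient gs q A B C (i : {linear A -> B}) (e : {linear B -> C}) :
  ses i e -> acyc gs q.+1 A -> acyc gs q B -> acyc gs q C.
Proof.
move=> [iI es ex] hA hB c dc; have [b bE] := km_surj es c.
have /(km_exact _ ex)[a aE] : km e (kd b) = 0 by rewrite km_kd bE.
have [|a' aE'] := hA a.
  by apply: (km_inj iI); rewrite km_kd aE kdd lin_0.
have : coboundary (b - km i a').
  by apply: hB; rewrite linB /= -km_kd aE' aE subrr.
have ei (x : kosz A gs q) : km e (km i x) = 0 by apply/(km_exact _ ex); exists x.
have eE : km e (b - km i a') = c by rewrite linB /= ei subr0.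
rewrite -eE; case: (q) (b - km i a') => [|q'] x /=.
  by move=> ->; rewrite lin_0.
by move=> [y <-]; exists (km e y); rewrite km_kd.
Qed.

(** The portion [H^q(C) -> H^(q+1)(A) -> H^(q+1)(B)] of the long exact sequence. *)
Lemma acyc_kernel gs q A B C (i : {linear A -> B}) (e : {linear B -> C}) :
  ses i e -> acyc gs q.+1 B -> acyc gs q C -> acyc gs q.+1 A.
Proof.
move=> [iI es ex] hB hC c dc.
have [|b bE] := hB (km i c); first by rewrite -km_kd dc lin_0.
have kei (x : kosz A gs q.+1) : km e (km i x) = 0 by apply/(km_exact _ ex); exists x.
have : coboundary (km e b) by apply: hC; rewrite -km_kd bE kei.
case: q c b bE dc hB hC kei => [|q] c b bE dc _ _ _ /=.
  move=> /(km_exact _ ex)[a aE]; exists a; apply: (km_inj iI).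
  by rewrite km_kd aE.
move=> [y yE]; have [z zE] := km_surj es y.
have /(km_exact _ ex)[a aE] : km e (b - kd z) = 0.
  by rewrite linB /= km_kd zE yE subrr.
by exists a; apply: (km_inj iI); rewrite km_kd aE linB /= kdd subr0.
Qed.

Lemma acyc0_inj gs A B (i : {linear A -> B}) : injective i ->
  acyc gs 0 B -> acyc gs 0 A.
Proof.
move=> iI hB c dc; apply: (km_inj iI); rewrite lin_0.
by apply: hB; rewrite -km_kd dc lin_0.
Qed.

Lemma km_scale g M (i : {linear M -> M}) gs q (c : kosz M gs q) :
  (forall m, i m = g *: m) -> km i c = g *: c.
Proof.
move=> iE; elim: gs q c => [|h gs IH] [|q] c //=.
  by rewrite (thinmx0 c) scaler0.
by rewrite !IH.
Qed.

Lemma acyc_cons0 g M (i : {linear M -> M}) gs : (forall m, i m = g *: m) ->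
  injective i -> acyc (g :: gs) 0 M.
Proof.
move=> iE iI c /= [_ gc]; apply: (km_inj iI).
by rewrite lin_0 (km_scale _ iE).
Qed.

(** When [g] is regular on [M], the cone of [g] on [kosz M gs] has, up to a shift, the cohomology of
    [M / g M], which is [N] here. *)
Lemma acyc_cons g M N (i : {linear M -> M}) (p : {linear M -> N}) gs q :
  (forall m, i m = g *: m) -> ses i p -> acyc gs q N -> acyc (g :: gs) q.+1 M.
Proof.
move=> iE [iI ps ex] hN [a b] /= [da]; rewrite -(km_scale _ iE) => gab.
have {gab} gab : km i a = kd b by apply/subr0_eq.
have : coboundary (km p b).
  by apply: hN; rewrite -km_kd -gab; apply/(km_exact _ ex); exists a.
case: q a b da gab {hN} => [|q] a b da gab /=.
  move=> /(km_exact _ ex)[b' bE]; exists b'; rewrite -(km_scale _ iE) bE.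
  by congr (_, _); apply: (km_inj iI); rewrite km_kd bE.
move=> [c' cE]; have [c pc] := km_surj ps c'.
have /(km_exact _ ex)[b' bE] : km p (b - kd c) = 0.
  by rewrite linB /= km_kd pc cE subrr.
exists (b', - c); rewrite /= linN opprK -(km_scale _ iE) bE subrK.
by congr (_, _); apply: (km_inj iI); rewrite km_kd bE linB /= kdd subr0.
Qed.

Fixpoint k0 M gs : M -> kosz M gs 0 :=
  match gs with [::] => id | g :: gs' => @k0 M gs' end.
Arguments k0 {M gs}.

Lemma k0_bij M gs (c : kosz M gs 0) : exists m, k0 m = c.
Proof. by elim: gs c => [|g gs IH] //= c; exists c. Qed.

Lemma k0_inj M gs : injective (@k0 M gs).
Proof. by elim: gs => [|g gs IH] //=. Qed.

Lemma k0_km M N (f : {linear M -> N}) gs m : km f (k0 m : kosz M gs 0) = k0 (f m).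
Proof. by elim: gs => [|g gs IH] /=. Qed.

Lemma k0_linear M gs : linear (@k0 M gs).
Proof. by elim: gs => [|g gs IH] //=. Qed.

Lemma k0Z M gs a m : @k0 M gs (a *: m) = a *: k0 m.
Proof. exact: (linZ (mklin (@k0_linear M gs))). Qed.

Lemma kd0_divides g M gs (a : kosz M gs 1) (b : M) :
  g *: a = kd (k0 b) -> forall h, h \in gs -> exists c, h *: b = g *: c.
Proof.
elim: gs a => [|h gs IH] //= [a a'] [/IH ha haE] h'.
rewrite inE => /orP[/eqP -> | h'gs]; last exact: ha.
have [c cE] := k0_bij a'; exists c; apply: (@k0_inj _ gs).
by rewrite !k0Z cE haE.
Qed.

(** The second component of a 1-cocycle is a class of [M / g M] killed by all of [gs]; the colon
    condition makes that class zero. *)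
Lemma acyc1_cons g M (i : {linear M -> M}) gs : (forall m, i m = g *: m) ->
  injective i ->
  (forall b : M, (forall h, h \in gs -> exists c, h *: b = g *: c) ->
     exists c, b = g *: c) ->
  acyc (g :: gs) 1 M.
Proof.
move=> iE iI hg [a b'] /= [da]; have [b bE] := k0_bij b'; rewrite -bE => gab.
have {gab} gab : g *: a = kd (k0 b) by apply/subr0_eq.
have [c cE] := hg b (kd0_divides gab).
have kZ : k0 b = g *: k0 c :> kosz M gs 0.
  by rewrite cE k0Z.
exists (k0 c); rewrite kZ; congr (_, _); apply: (km_inj iI).
by rewrite !(km_scale _ iE) gab kZ linZ.
Qed.

Lemma kd0_image M N (f : {linear M -> N}) gs (m : N) :
  (forall g, g \in gs -> exists x, f x = g *: m) ->
  exists c : kosz M gs 1, km f c = kd (k0 m).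
Proof.
elim: gs => [|g gs IH] /= h; first by exists 0.
have [|c cE] := IH; first by move=> g' g'gs; apply: h; rewrite inE g'gs orbT.
have [|x xE] := h g; first by rewrite inE eqxx.
exists (c, k0 x); rewrite /= cE k0_km xE.
by rewrite k0Z.
Qed.

(** The elements [g *: m] form a 1-cocycle in the image [I] of [rho]. It is a coboundary since
    [H^1(gs; I) = 0], and the element of [I] so obtained differs from [m] by something killed by all
    of [gs], hence by zero. *)
Lemma koszul_lift gs M' M N (i : {linear M' -> M}) (rho : {linear M -> N}) (m : N) :
  injective i -> exact_at i rho -> acyc gs 2 M' -> acyc gs 1 M -> acyc gs 0 N ->
  (forall g, g \in gs -> exists x, rho x = g *: m) -> exists x, rho x = m.
Proof.
move=> iI ex h2 h1 h0 hm; have [I [j [e [jI es jE]]]] := ex_image rho.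
have hs : ses i e.
  split=> // y; rewrite -ex -jE; split=> [->|h]; first exact: lin_0.
  by apply: jI; rewrite h lin_0.
have hI : acyc gs 1 I := acyc_quotient hs h2 h1.
have [|c cE] := @kd0_image I N j gs m.
  by move=> g /hm[x xE]; exists (e x); rewrite jE.
have [|b bE] := hI c.
  by apply: (km_inj jI); rewrite km_kd cE kdd lin_0.
have [b' bE'] := k0_bij b.
have /h0 /subr0_eq : kd (km j b - k0 m) = 0.
  by rewrite linB /= -km_kd bE cE subrr.
rewrite -bE' k0_km => /k0_inj jb; have [x xE] := es b'.
by exists x; rewrite -jE xE.
Qed.

(** Each syzygy trades one unit of projective dimension for one degree of cohomology: depth drops
    from [n] by at most the projective dimension. *)
Lemma acyc_pdI gs n d q M : (forall q P, (q < n)%N -> projective P -> acyc gs q P) ->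
  pdI d M -> (q + d < n)%N -> acyc gs q M.
Proof.
move=> hP; elim: d q M => [|d IH] q M; first by rewrite addn0 => hM qn; apply: hP.
move=> [P [Q [i [e [pP hs hQ]]]]] qdn.
apply: (acyc_quotient hs); first by apply: IH => //; rewrite addSnnS.
by apply: hP => //; apply: leq_ltn_trans qdn; rewrite leq_addr.
Qed.

End Koszul.


(** * The powers [x_i^N] as a regular sequence on free modules *)

Section VariablePowers.
Variables (K : fieldType) (n N : nat).
Local Notation S := {mpoly K[n]}.

Definition var_pow (i : 'I_n) : S := 'X_[(U_(i) *+ N)%MM].

Lemma var_powE i : var_pow i = 'X_i ^+ N.
Proof. by rewrite /var_pow mpolyXn. Qed.

Definition below (k : nat) (m : 'X_{1..n}) : bool :=
  [forall i : 'I_n, (i < k)%N ==> (m i < N)%N].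

(** Membership in the ideal generated by the [N]-th powers of the first [k] variables, read on
    coefficients because the ideal is monomial. *)
Definition no_below (k : nat) (p : S) : Prop := forall m, below k m -> p@_m = 0.

Lemma no_below0 k : no_below k 0. Proof. by move=> m _; rewrite mcoeff0. Qed.

Lemma below_add (i : 'I_n) m : below i (U_(i) *+ N + m)%MM = below i m.
Proof.
apply: eq_forallb => j; case: (ltnP j i) => //= ji.
by rewrite mnmDE mulmnE mnm1E -val_eqE /= gtn_eqF // mul0n add0n.
Qed.

(** Multiplication by [var_pow i] leaves the exponents of the earlier variables alone, hence this
    power is regular modulo the earlier ones. *)
Lemma no_below_mul (i : 'I_n) p : no_below i (var_pow i * p) -> no_below i p.
Proof.
move=> h m hm; have := h (U_(i) *+ N + m)%MM; rewrite below_add => /(_ hm).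
by rewrite mulrC mcoeffMX.
Qed.

Lemma mcoeff_var_pow_low (i : 'I_n) (p : S) (m : 'X_{1..n}) : (m i < N)%N -> (var_pow i * p)@_m = 0.
Proof.
move=> mi; rewrite mcoeffM big1 // => -[k1 k2] /= /eqP mE.
rewrite mcoeffX; case: eqP => [k1E|_]; last by rewrite mul0r.
have : m i = ((U_(i) *+ N + k2) i)%MM by rewrite {1}mE -k1E.
by rewrite mnmDE mulmnE mnm1E eqxx mul1n => h; rewrite h ltnNge leq_addr in mi.
Qed.

(** The quotient in the division of [p] by [var_pow i]: monomials that are not divisible contribute
    nothing. *)
Lemma ex_shift_down (i : 'I_n) (p : S) :
  exists q : S, forall m, q@_m = p@_(U_(i) *+ N + m)%MM.
Proof.
elim/mpolyind: p => [|c m p _ _ [q qE]].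
  by exists 0 => m; rewrite !mcoeff0.
have [mi|mi] := boolP (U_(i) *+ N <= m)%MM.
  exists (c *: 'X_[m - U_(i) *+ N] + q) => m'.
  rewrite !mcoeffD qE !mcoeffZ !mcoeffX; congr (_ * _%:R + _).
  by rewrite -(inj_eq (@addmI _ (U_(i) *+ N)%MM)) addmC submK.
exists q => m'; rewrite mcoeffD mcoeffZ mcoeffX qE.
case: eqP => [mE|_]; last by rewrite mulr0 add0r.
by rewrite mE lem_addr in mi.
Qed.

Lemma no_belowS (i : 'I_n) (p : S) :
  no_below i.+1 p -> exists q, no_below i (p - var_pow i * q).
Proof.
move=> hp; have [q qE] := ex_shift_down i p; exists q => m hm; rewrite mcoeffB.
have [mi|mi] := ltnP (m i) N.
  rewrite mcoeff_var_pow_low // subr0; apply: hp.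
  apply/forallP => j; apply/implyP; rewrite ltnS leq_eqVlt => /orP[/eqP|ji].
    by move/val_inj => ->.
  by move/forallP: hm => /(_ j); rewrite ji.
have le : (U_(i) *+ N <= m)%MM.
  apply/mnm_lepP => j; rewrite mulmnE mnm1E; case: eqP => [<-|//].
  by rewrite mul1n.
by rewrite -(submK le) addmC mulrC mcoeffMX qE subrr.
Qed.

Lemma no_belowS_sum (i : 'I_n) (p q : S) :
  no_below i (p - var_pow i * q) -> no_below i.+1 p.
Proof.
move=> hp m hm; rewrite -[p](subrK (var_pow i * q)) mcoeffD hp ?add0r; last first.
  apply/forallP => j; apply/implyP => ji; move/forallP: hm => /(_ j).
  by rewrite ltnS ltnW.
apply: mcoeff_var_pow_low.
by move/forallP: hm => /(_ i); rewrite ltnSn.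
Qed.

Lemma no_below_linear k (a p q : S) :
  no_below k p -> no_below k q -> no_below k (a * p + q).
Proof.
move=> hp hq m hm; rewrite mcoeffD hq // addr0 mcoeffM big1 // => -[k1 k2] /= /eqP mE.
rewrite hp ?mulr0 //; apply/forallP => j; apply/implyP => jk.
move/forallP: hm => /(_ j); rewrite jk /=; apply: leq_ltn_trans.
by rewrite {2}mE mnmDE leq_addl.
Qed.

Definition var_pows (k : nat) : seq S := [seq var_pow i | i <- drop k (enum 'I_n)].

Section Free.
Variable X : eqType.
Local Notation F := (freemod S X).
Definition Uk k (u : F) : Prop := forall x, no_below k (fscoef u x).


Lemma Uk_submodule k : submodule (Uk k).
Proof.
split=> [x|a u v hu hv x]; first exact: no_below0.
rewrite fscoefD fscoefZ.
exact: (@no_below_linear k a (fscoef u x) (fscoef v x) (hu x) (hv x)).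
Qed.

Lemma Uk_mul (i : 'I_n) u : Uk i (var_pow i *: u) -> Uk i u.
Proof.
by move=> hu x; have := hu x; rewrite fscoefZ; apply: no_below_mul.
Qed.

Lemma UkS (i : 'I_n) u : Uk i.+1 u <-> exists v, Uk i (u - var_pow i *: v).
Proof.
split=> [hu|[v hv] x]; last first.
  by have := hv x; rewrite fscoefD fscoefN fscoefZ; apply: no_belowS_sum.
(* The quotient is set to 0 where [u] vanishes, so that the choice has finite support. *)
pose b x : S^o := if fscoef u x == 0 then 0 else projT1 (cid (no_belowS (hu x))).
have bE x : no_below i (fscoef u x - var_pow i * b x).
  rewrite /b; case: eqP => [->|_]; last by case: cid.
  by rewrite mulr0 subr0; apply: no_below0.
have [|v vE'] := @mk_fsfct _ X S^o b.
  by have [s _ hs] := fscoefP u; exists s => x /hs /eqP h; rewrite /b; case: ifP => //; rewrite h.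
by exists v => // x; rewrite fscoefD fscoefN fscoefZ vE'; apply: bE.
Qed.

(** [M] is the free module modulo the first [k] powers and [j] counts the remaining ones; each step
    divides by one more power, regular on the quotient, and lowers [q] by one. *)
Lemma acyc_var_pows_quotient j k (M : lmodType S) (p : {linear F -> M}) q :
  (j + k = n)%N -> surj p -> (forall u, p u = 0 <-> Uk k u) -> (q < j)%N ->
  acyc (var_pows k) q M.
Proof.
elim: j k M p q => // j IH k M p q jk ps pE qj.
have kn : (k < n)%N by rewrite -jk addSn ltnS leq_addl.
pose i := Ordinal kn.
have vE : var_pows k = var_pow i :: var_pows k.+1.
  rewrite /var_pows (drop_nth i) ?size_enum_ord //=; congr (var_pow _ :: _).
  by apply: val_inj; rewrite /= nth_enum_ord.
have ml : linear (fun m : M => var_pow i *: m).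
  by move=> a u v; rewrite scalerDr !scalerA mulrC.
have mI : injective (mklin ml).
  apply: lin_inj => m; have [u <-] := ps m.
  rewrite -[LHS]/(var_pow i *: p u) -linZ => /pE hu; apply/pE.
  exact: (@Uk_mul i).
case: q qj => [|q] qj; rewrite vE; first exact: (@acyc_cons0 _ _ _ (mklin ml)).
have [N' [p' [ps' pE']]] : exists (W : lmodType S) (p : {linear F -> W}),
    surj p /\ forall v, p v = 0 <-> Uk k.+1 v.
  exact/ex_quotient/Uk_submodule.
have lift m : exists n, forall u, p u = m -> p' u = n.
  have [u0 u0E] := ps m; exists (p' u0) => u uE; apply/subr0_eq.
  rewrite -linB; apply/pE'/(@UkS i); exists 0 => //.
  by rewrite scaler0 subr0; apply/pE; rewrite linB uE u0E subrr.
pose g m := projT1 (cid (lift m)).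
have gE u : g (p u) = p' u by rewrite /g; case: cid => y /= h; rewrite (h u).
have gl : linear g.
  move=> a m m'; have [u <-] := ps m; have [u' <-] := ps m'.
  by rewrite -linZ -linD !gE linD linZ.
apply: (@acyc_cons _ _ _ _ (mklin ml) (mklin gl)) => //; last first.
  by apply: (IH k.+1 _ p') => //; rewrite addnS -addSn.
split=> //; first by move=> y; have [u <-] := ps' y; exists (p u); exact: gE.
move=> m; have [u <-] := ps m; rewrite -[mklin gl _]/(g _) gE pE' (@UkS i).
split=> [[v /pE]|[m' m'E]].
  by rewrite linB linZ => /subr0_eq h; exists (p v).
have [v vE'] := ps m'; exists v => //; apply/pE.
by rewrite linB linZ -m'E vE' subrr.
Qed.

Lemma acyc_var_pows_free q : (q < n)%N -> acyc (var_pows 0) q (F : lmodType S).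
Proof.
move=> qn; apply: (@acyc_var_pows_quotient n 0 _ (linid _)) => //.
- by rewrite addn0.
- by move=> y; exists y.
move=> u; split=> [h x m _|hu]; first by rewrite [u]h mcoeff0.
apply: fsfct_eq => x; apply/mpolyP => m; rewrite (hu x) ?mcoeff0 //.
exact/forallP.
Qed.
End Free.

Lemma acyc_var_pows_projective q (P : lmodType S) : (q < n)%N -> projective P ->
  acyc (var_pows 0) q P.
Proof.
move=> qn hP; have [Z [i hs]] := ses_kernel (@free_cover_surj S P).
have [s [r [es _ _]]] := ses_split hs hP.
by apply: (acyc_retract es); apply: acyc_var_pows_free.
Qed.

Lemma mem_var_pows i : var_pow i \in var_pows 0.
Proof. by rewrite /var_pows drop0 map_f // mem_enum. Qed.

Lemma var_powsP g : g \in var_pows 0 -> exists i, g = 'X_i ^+ N.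
Proof. by rewrite /var_pows drop0 => /mapP[i _ ->]; exists i; rewrite var_powE. Qed.

End VariablePowers.

(** * Exterior algebra *)

Section ExteriorOperators.
Variables (R : comNzRingType) (n : nat).
Local Notation E := {ffun {set 'I_n} -> R^o}.
Implicit Types (w e : E) (a b v : 'I_n -> R) (i j : 'I_n) (I J : {set 'I_n}).

(** The sign for moving [dx_i] past the smaller indices of [I]; the comparison is strict, so it is
    the same for [I] with or without [i]. *)
Definition sg i I : R := (-1) ^+ #|[set j in I | (j < i)%N]|.

Lemma sg_sqr i I : sg i I * sg i I = 1.
Proof. by rewrite -expr2 sqrr_sign. Qed.

Lemma sg_ge i j I : (i <= j)%N -> sg i (j |: I) = sg i I.
Proof.
move=> ij; congr (_ ^+ #|pred_of_set _|); apply/setP=> k; rewrite !inE.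
by case: eqP => [->|] //=; rewrite [(j < i)%N]ltnNge ij !andbF.
Qed.

Lemma sg_lt i j I : (j < i)%N -> j \notin I -> sg i (j |: I) = - sg i I.
Proof.
move=> ji jI; rewrite /sg.
have -> : [set k in j |: I | (k < i)%N] = j |: [set k in I | (k < i)%N].
  by apply/setP=> k; rewrite !inE; case: eqP => [->|] //=; rewrite ji.
by rewrite cardsU1 inE (negbTE jI) add1n exprS mulN1r.
Qed.

Lemma sg_D1 i I : sg i (I :\ i) = sg i I.
Proof.
congr (_ ^+ #|pred_of_set _|); apply/setP=> k; rewrite !inE.
by case: eqP => [->|] //=; rewrite ltnn !andbF.
Qed.

Lemma sg_swap i j I : i != j -> i \notin I -> j \notin I ->
  sg i (j |: I) * sg j I = - (sg j (i |: I) * sg i I).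
Proof.
move=> ij iI jI; have [lt|lt] := ltnP i j.
  by rewrite sg_ge 1?ltnW // sg_lt // mulNr opprK mulrC.
have {}lt : (j < i)%N by rewrite ltn_neqAle lt andbT eq_sym.
by rewrite sg_lt // [in RHS]sg_ge 1?ltnW // mulNr mulrC.
Qed.

(* [dl a] is the left exterior product by [\sum_i a i dx_i], and [ct v] the
   contraction by the vector field [\sum_i v i d/dx_i]. *)
Definition dl a w : E := [ffun J : {set 'I_n} => \sum_(i in J) sg i J * a i * (w (J :\ i) : R)].
Definition ct v w : E := [ffun J : {set 'I_n} => \sum_(i | i \notin J) sg i J * v i * (w (i |: J) : R)].

Lemma dl_linear a : linear (dl a).
Proof.
move=> c u w; apply/ffunP=> J; rewrite !ffunE [X in _ = X]/= scaler_sumr -big_split.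
apply: eq_bigr => i _; rewrite !ffunE /= mulrDr -[c *: u _]/(c * _).
by rewrite -[c *: (_ * _)]/(c * (_ * _)) mulrCA.
Qed.
HB.instance Definition _ a := GRing.isLinear.Build R E E *:%R (dl a) (dl_linear a).

Lemma ct_linear v : linear (ct v).
Proof.
move=> c u w; apply/ffunP=> J; rewrite !ffunE [X in _ = X]/= scaler_sumr -big_split.
apply: eq_bigr => i _; rewrite !ffunE /= mulrDr -[c *: u _]/(c * _).
by rewrite -[c *: (_ * _)]/(c * (_ * _)) mulrCA.
Qed.
HB.instance Definition _ v := GRing.isLinear.Build R E E *:%R (ct v) (ct_linear v).

Lemma dl_add c a b w : dl (fun i => c * a i + b i) w = c *: dl a w + dl b w.
Proof.
apply/ffunP=> J; rewrite !ffunE [X in _ = X]/= scaler_sumr -big_split.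
apply: eq_bigr => i _; rewrite /= mulrDr mulrDl -[c *: (_ * _)]/(c * (_ * _)).
by rewrite [in RHS]mulrA [c * (_ * _)]mulrCA.
Qed.

Lemma eq_dl a b w : a =1 b -> dl a w = dl b w.
Proof.
by move=> ab; apply/ffunP=> J; rewrite !ffunE; apply: eq_bigr => i _; rewrite ab.
Qed.

Lemma dl0 w : dl (fun _ => 0) w = 0.
Proof. by apply/ffunP=> J; rewrite !ffunE big1 // => i _; rewrite mulr0 mul0r. Qed.

(** Antisymmetry alone would only show that twice the sum is zero; the vanishing diagonal makes the
    argument valid in characteristic two. *)
Lemma sum_antisym (T : finType) (V : zmodType) (lt : rel T) (F : T -> T -> V) :
  (forall i j : T, i != j -> lt j i = ~~ lt i j) ->
  (forall i : T, F i i = 0) -> (forall i j : T, i != j -> F i j = - F j i) ->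
  \sum_(i : T) \sum_(j : T) F i j = 0.
Proof.
move=> ltP F0 FN.
have -> : \sum_(i : T) \sum_(j : T) F i j =
    \sum_(i : T) \sum_(j : T | (j != i) && lt i j) F i j +
    \sum_(i : T) \sum_(j : T | (j != i) && lt j i) F i j.
  rewrite -big_split; apply: eq_bigr => i _ /=.
  rewrite (bigD1 i) //= F0 add0r (bigID (lt i)) /=; congr (_ + _).
  by apply: eq_bigl => j; case: eqP => //= /eqP ji; rewrite (ltP i j) 1?eq_sym // .
rewrite [X in _ + X](exchange_big_dep xpredT) //= -big_split big1 // => i _ /=.
rewrite [X in _ + X](eq_bigl (fun j : T => (j != i) && lt i j)); last first.
  by move=> j; rewrite eq_sym.
by rewrite -big_split big1 // => j /andP[ji _] /=; rewrite FN ?addNr // eq_sym.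
Qed.

Definition dl2 a b w J i j : R :=
  if [&& i \in J, j \in J & i != j] then
    sg i J * a i * (sg j (J :\ i) * b j * w (J :\ i :\ j)) else 0.

Lemma dl_dlE a b w J : dl a (dl b w) J = \sum_i \sum_j dl2 a b w J i j.
Proof.
rewrite ffunE big_mkcond; apply: eq_bigr => i _; rewrite /dl2.
case: (boolP (i \in J)) => iJ; last by rewrite big1.
rewrite ffunE mulr_sumr big_mkcond; apply: eq_bigr => j _.
by rewrite !inE eq_sym andbC.
Qed.

Lemma dl2N a b w J i j : i != j -> dl2 a b w J i j = - dl2 b a w J j i.
Proof.
move=> ij; rewrite /dl2 [j == i]eq_sym ij; case: (boolP (i \in J)) => iJ /=; last by rewrite andbF oppr0.
case: (boolP (j \in J)) => jJ /=; last by rewrite oppr0.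
have sE : J :\ j :\ i = J :\ i :\ j by rewrite setDDl setUC -setDDl.
rewrite sE; set I := J :\ i :\ j.
have iI : i \notin I by rewrite !inE eqxx andbF.
have jI : j \notin I by rewrite !inE eqxx.
have JiE : J :\ i = j |: I by rewrite setD1K // !inE eq_sym ij.
have JjE : J :\ j = i |: I by rewrite /I -sE setD1K // !inE ij.
rewrite -(sg_D1 i J) -(sg_D1 j J) JiE JjE.
rewrite (sg_ge (i := j)) // (sg_ge (i := i) (j := i)) //.
have E5 (x y z s t : R) : x * s * (y * t * z) = x * y * (s * t * z) by ring.
by rewrite E5 [in RHS]E5 sg_swap // mulNr [a i * b j]mulrC.
Qed.

Lemma dlC a b w : dl a (dl b w) = - dl b (dl a w).
Proof.
apply/ffunP=> J; rewrite [in RHS]ffunE !dl_dlE -sumrN exchange_big /=.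
apply: eq_bigr => j _; rewrite -sumrN; apply: eq_bigr => i _.
have [->|ij] := eqVneq i j; last exact: dl2N.
by rewrite /dl2 eqxx !andbF oppr0.
Qed.

Lemma dl_dl a w : dl a (dl a w) = 0.
Proof.
apply/ffunP=> J; rewrite dl_dlE ffunE (@sum_antisym _ _ (fun i j : 'I_n => (i < j)%N)) //.
- by move=> i j ij; rewrite ltnNge leq_eqVlt negb_or val_eqE ij.
- by move=> i; rewrite /dl2 eqxx !andbF.
- by move=> i j; apply: dl2N.
Qed.

(** Terms that add one index and remove another cancel by [sg_swap]. Terms that add and remove the
    same index come from the first summand when it is outside [J] and from the second when it is in
    [J]; together they give the pairing. *)
Lemma ct_dl a v w : ct v (dl a w) + dl a (ct v w) = (\sum_i a i * v i) *: w.
Proof.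
apply/ffunP=> J; rewrite !ffunE.
have -> : \sum_(i | i \notin J) sg i J * v i * (dl a w (i |: J) : R) =
   \sum_(i | i \notin J) a i * v i * (w J : R) +
   \sum_(i | i \notin J) \sum_(j in J)
      sg i J * v i * (sg j (i |: J) * a j * (w ((i |: J) :\ j) : R)).
  rewrite -big_split; apply: eq_bigr => i iJ; rewrite ffunE big_setU1 //= mulrDr.
  congr (_ + _); last by rewrite mulr_sumr.
  rewrite sg_ge // setU1K //; move: (w J : R) => z.
  have E4 (x y s : R) : x * y * (x * s * z) = x * x * (s * y * z) by ring.
  by rewrite E4 sg_sqr mul1r.
have -> : \sum_(j in J) sg j J * a j * (ct v w (J :\ j) : R) =
   \sum_(j in J) a j * v j * (w J : R) +
   \sum_(j in J) \sum_(i | i \notin J)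
      sg j J * a j * (sg i (J :\ j) * v i * (w (i |: (J :\ j)) : R)).
  rewrite -big_split; apply: eq_bigr => j jJ; rewrite ffunE (bigD1 j) /=; last first.
    by rewrite !inE eqxx.
  rewrite mulrDr; congr (_ + _).
    rewrite sg_D1 setD1K //; move: (w J : R) => z.
    have E4 (x y s : R) : x * s * (x * y * z) = x * x * (s * y * z) by ring.
    by rewrite E4 sg_sqr mul1r.
  rewrite mulr_sumr; apply: eq_bigl => i; rewrite !inE.
  by case: (eqVneq i j) => [->|ij] /=; rewrite ?jJ ?andbF ?andbT.
rewrite addrACA [X in _ + (_ + X)]exchange_big /= -big_split /= [X in _ + X]big1.
  rewrite addr0 -[_ *: _]/(_ * _) addrC -!mulr_suml -mulrDl; congr (_ * _).
  by rewrite [RHS](bigID (mem J)).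
move=> i iJ; rewrite -big_split big1 // => j jJ /=.
have ji : j != i by apply: contraNneq iJ => <-.
have iI : i \notin J :\ j by rewrite !inE (negbTE iJ) andbF.
have jI : j \notin J :\ j by rewrite !inE eqxx.
have <- : i |: (J :\ j) = (i |: J) :\ j.
  by apply/setP=> k; rewrite !inE; case: (eqVneq k i) => [->|] //=; rewrite eq_sym ji.
have -> : sg j (i |: J) = sg j (i |: (J :\ j)).
  by rewrite -[in LHS](setD1K jJ) setUCA sg_ge.
have -> : sg i J = sg i (j |: (J :\ j)) by rewrite setD1K.
rewrite -(sg_D1 j J).
have ij : i != j by rewrite eq_sym.
set I := J :\ j in iI jI *; set z : R := w _.
have {}h : sg i (j |: I) * sg j (i |: I) = - (sg j I * sg i I).
  rewrite -[sg i (j |: I)]mulr1 -(sg_sqr j I) mulrA sg_swap //.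
  have E4 (x y s : R) : - (x * y) * s * x = - (x * x) * (s * y) by ring.
  by rewrite E4 sg_sqr mulN1r.
have E6 (x y s t : R) : x * s * (y * t * z) = x * y * (s * t * z) by ring.
by rewrite E6 h E6 [a j * v i]mulrC mulNr addNr.
Qed.

End ExteriorOperators.


Notation formmod R n := {ffun {set 'I_n} -> (R^o : lmodType R)}.

Section Monomials.
Variables (T : comNzRingType) (n m : nat) (b : 'I_n -> 'I_m -> T).
Local Notation E := (formmod T m).

Definition one_form : E := [ffun I : {set 'I_m} => (I == set0)%:R].

(** The wedge product of the 1-forms with coefficients [b i], over the members [i] of [s] lying in
    [I], in the order of [s]. *)
Definition monl (s : seq 'I_n) (I : {set 'I_n}) : E :=
  foldr (fun i e => if i \in I then dl (b i) e else e) one_form s.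

Lemma monl_eq s (I J : {set 'I_n}) :
  {in s, forall i, (i \in I) = (i \in J)} -> monl s I = monl s J.
Proof.
elim: s => //= i s IH h; rewrite h ?inE ?eqxx // IH // => j js.
by apply: h; rewrite inE js orbT.
Qed.

Lemma monl_pull s (I : {set 'I_n}) j : sorted (fun i k : 'I_n => (i < k)%N) s -> j \in s -> j \in I ->
  monl s I = (-1) ^+ count (fun k : 'I_n => (k \in I) && (k < j)%N) s *:
    dl (b j) (monl s (I :\ j)) :> E.
Proof.
have tr : transitive (fun i k : 'I_n => (i < k)%N) by move=> ? ? ?; apply: ltn_trans.
elim: s => //= h s IH hs; rewrite inE; have ss := path_sorted hs.
have hmin := order_path_min tr hs.
case: (eqVneq j h) => [-> _ hI|jh /= js jI].
  rewrite hI !inE eqxx /= ltnn add0n.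
  rewrite (_ : count _ s = 0%N) ?expr0 ?scale1r; last first.
    apply/eqP; rewrite -leqn0 leqNgt -has_count; apply/hasPn => k ks.
    by rewrite negb_and -leqNgt ltnW ?orbT // (allP hmin).
  congr (dl _ _); apply: monl_eq => k ks; rewrite !inE.
  case: eqP => // kh; have := allP hmin k ks; by rewrite kh ltnn.
have hj : (h < j)%N := allP hmin j js.
rewrite !inE eq_sym jh /= hj andbT (IH ss js jI).
case: ifP => hI; rewrite ?add0n ?add1n // exprS mulN1r scaleNr.
by rewrite linearZ /= dlC scalerN.
Qed.

Definition mon (I : {set 'I_n}) : E := monl (enum 'I_n) I.

Lemma enum_ord_sorted : sorted (fun i k : 'I_n => (i < k)%N) (enum 'I_n).
Proof.
have := iota_ltn_sorted 0 n; rewrite -val_enum_ord sorted_map.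
by apply: sub_sorted.
Qed.

Lemma mon_pull (I : {set 'I_n}) j : j \in I -> mon I = sg T j I *: dl (b j) (mon (I :\ j)).
Proof.
move=> jI; rewrite /mon (monl_pull enum_ord_sorted (mem_enum _ j) jI) /sg.
congr ((-1) ^+ _ *: _); rewrite [in RHS]cardE [in RHS]/enum_mem -enumT size_filter.
by apply: eq_count => k; rewrite /= inE.
Qed.

Lemma dl_mon (I : {set 'I_n}) j : j \in I -> dl (b j) (mon I) = 0.
Proof. by move=> /mon_pull ->; rewrite linearZ /= dl_dl scaler0. Qed.

Lemma dl_monE (I : {set 'I_n}) j : j \notin I -> dl (b j) (mon I) = sg T j I *: mon (j |: I).
Proof.
move=> jI; rewrite [in RHS](mon_pull (setU11 j I)) setU1K // scalerA.
by rewrite sg_ge // sg_sqr scale1r.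
Qed.

Lemma mon0 : mon set0 = one_form.
Proof.
rewrite /mon; elim: (enum 'I_n) => //= i s ->; by rewrite inE.
Qed.

End Monomials.

Section Basis.
Variables (R : comNzRingType) (n : nat).
Local Notation E := (formmod R n).

Definition dx (i j : 'I_n) : R := (i == j)%:R.

Lemma mon_dx I : mon dx I = [ffun J : {set 'I_n} => (J == I)%:R] :> E.
Proof.
have [k] := ubnP #|I|; elim: k I => // k IH I kI.
have [->|[j jI]] := set_0Vmem I; first by rewrite mon0.
rewrite (mon_pull _ jI) IH; last by move: kI; rewrite (cardsD1 j I) jI.
apply/ffunP=> J; rewrite !ffunE -[_ *: _]/(_ * _).
case: (boolP (j \in J)) => jJ; last first.
  rewrite big1 => [|i iJ].
    by rewrite mulr0; case: eqP => // JI; rewrite JI jI in jJ.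
  rewrite /dx; case: eqP => [ji|]; last by rewrite mulr0 mul0r.
  by rewrite ji iJ in jJ.
rewrite (bigD1 j) //= big1 ?addr0 => [|i /andP[iJ ij]]; last first.
  by rewrite /dx eq_sym (negbTE ij) mulr0 mul0r.
rewrite /dx eqxx mulr1 ffunE.
have -> : (J :\ j == I :\ j) = (J == I).
  by apply/eqP/eqP => [h|->//]; rewrite -(setD1K jJ) h setD1K.
by case: eqP => [->|_]; rewrite ?mulr0 // mulr1 sg_sqr.
Qed.

Lemma formE (w : E) : w = \sum_I (w I : R) *: mon dx I.
Proof.
apply/ffunP=> J; rewrite sum_ffunE (bigD1 J) //= big1 ?addr0 => [|I IJ].
  by rewrite mon_dx !ffunE eqxx -[_ *: _]/(_ * _) mulr1.
by rewrite mon_dx !ffunE eq_sym (negbTE IJ) -[_ *: _]/(_ * _) mulr0.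
Qed.

(** The constant 1, linear combinations and wedging with coordinate differentials generate all
    forms; identities between pullbacks are checked on these three cases. *)
Lemma form_ind (P : E -> Prop) :
  P (one_form R n) -> (forall a u v, P u -> P v -> P (a *: u + v)) ->
  (forall i w, P w -> P (dl (dx i) w)) -> forall w, P w.
Proof.
move=> P1 PL Pd w; have P0 : P 0.
  have := PL (-1) _ _ P1 P1; by rewrite scaleN1r addNr.
rewrite (formE w); elim/big_rec: _ => // I v _ hv.
apply: PL => //; rewrite /mon; elim: (enum 'I_n) => //= i s IH.
by case: ifP => // _; apply: Pd.
Qed.

Lemma dl_dxE (a : 'I_n -> R) (w : E) : dl a w = \sum_i a i *: dl (dx i) w.
Proof.
apply/ffunP=> J; rewrite sum_ffunE ffunE big_mkcond; apply: eq_bigr => i _.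
rewrite !ffunE -[_ *: _]/(_ * _); case: ifP => iJ.
  rewrite (bigD1 i) //= big1 ?addr0 => [|j /andP[_ ji]].
    by rewrite /dx eqxx mulr1 mulrCA mulrA.
  by rewrite /dx eq_sym (negbTE ji) mulr0 mul0r.
rewrite big1 ?mulr0 // => j jJ; rewrite /dx; case: eqP => [ij|]; last by rewrite mulr0 mul0r.
by rewrite ij jJ in iJ.
Qed.
End Basis.

Fact lock_key : unit. Proof. exact: tt. Qed.

(** * Pullback of forms along a ring morphism *)

Section Pullback.
Variables (R T : comNzRingType) (phi : {rmorphism R -> T}).
Variables (n m : nat) (b : 'I_n -> 'I_m -> T).

(** Coefficients move along [phi], and [dx_i] becomes the 1-form with coefficients [b i]. *)
Definition pb : formmod R n -> formmod T m :=
  locked_with lock_key (fun w => \sum_I phi (w I) *: mon b I).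

Lemma pbE w : pb w = \sum_I phi (w I) *: mon b I.
Proof. by rewrite /pb unlock. Qed.

Lemma pbD u v : pb (u + v) = pb u + pb v.
Proof.
rewrite !pbE -big_split; apply: eq_bigr => I _.
by rewrite ffunE rmorphD scalerDl.
Qed.

Lemma pbZ a u : pb (a *: u) = phi a *: pb u.
Proof.
rewrite !pbE scaler_sumr; apply: eq_bigr => I _.
by rewrite ffunE -[a *: _]/(a * _) rmorphM scalerA.
Qed.

Lemma pb0 : pb 0 = 0.
Proof. by apply: (addIr (pb 0)); rewrite -pbD !add0r. Qed.

Lemma pb_sum (I : finType) (F : I -> formmod R n) :
  pb (\sum_i F i) = \sum_i pb (F i).
Proof. exact: (big_morph _ pbD pb0). Qed.

Lemma pb_mon I : pb (mon (@dx R n) I) = mon b I.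
Proof.
rewrite pbE (bigD1 I) //= big1 ?addr0 => [|J JI].
  by rewrite mon_dx ffunE eqxx rmorph1 scale1r.
by rewrite mon_dx ffunE (negbTE JI) rmorph0 scale0r.
Qed.

Lemma pb_one : pb (one_form R n) = one_form T m.
Proof. by rewrite -(mon0 (@dx R n)) pb_mon mon0. Qed.

Lemma pb_dl (a : 'I_n -> R) (w : formmod R n) :
  pb (dl a w) = dl (fun k => \sum_i phi (a i) * b i k) (pb w).
Proof.
have step i : pb (dl (@dx R n i) w) = dl (b i) (pb w).
  rewrite (formE w) raddf_sum !pb_sum raddf_sum; apply: eq_bigr => I _ /=.
  rewrite !linearZ /= !pbZ linearZ /=; congr (_ *: _).
  have [iI|iI] := boolP (i \in I); first by rewrite dl_mon // pb0 pb_mon dl_mon.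
  rewrite dl_monE // pbZ !pb_mon dl_monE //; congr (_ *: _).
  by rewrite /sg rmorphXn rmorphN1.
rewrite dl_dxE pb_sum; apply/ffunP=> J; rewrite sum_ffunE ffunE.
rewrite (eq_bigr (fun i => \sum_(k in J) sg T k J * (phi (a i) * b i k) *
   (pb w (J :\ k) : T))) => [|i _]; last first.
  rewrite pbZ step !ffunE -[_ *: _]/(_ * _) mulr_sumr; apply: eq_bigr => k _.
  by rewrite !mulrA; congr (_ * _ * _); rewrite mulrC.
rewrite exchange_big /=; apply: eq_bigr => k _.
by rewrite -mulr_suml -mulr_sumr.
Qed.

End Pullback.

Section Degree.
Variables (R : comNzRingType) (n : nat).
Local Notation E := (formmod R n).

Definition hcomp (p : nat) (w : E) : E :=
  [ffun I : {set 'I_n} => if #|I| == p then w I else 0].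

Lemma hcomp_linear p : linear (hcomp p).
Proof.
move=> a u v; apply/ffunP=> I; rewrite !ffunE; case: ifP => // _.
by rewrite scaler0 addr0.
Qed.
HB.instance Definition _ p := GRing.isLinear.Build R E E *:%R (hcomp p) (hcomp_linear p).

Lemma hcomp_homog p (w : E) : homogeneous p w -> hcomp p w = w.
Proof.
move=> hw; apply/ffunP=> I; rewrite ffunE; case: eqP => // /eqP h.
by rewrite hw.
Qed.

Lemma homog_hcomp p (w : E) : homogeneous p (hcomp p w).
Proof. by move=> I /negbTE h; rewrite ffunE h. Qed.

Lemma hcomp_dl p a (w : E) : hcomp p.+1 (dl a w) = dl a (hcomp p w).
Proof.
apply/ffunP=> J; rewrite !ffunE; case: ifP => hJ.
  apply: eq_bigr => i iJ; rewrite ffunE; move: hJ.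
  by rewrite (cardsD1 i J) iJ add1n eqSS => ->.
rewrite big1 // => i iJ; rewrite ffunE; move: hJ.
by rewrite (cardsD1 i J) iJ add1n eqSS => ->; rewrite mulr0.
Qed.

Lemma hcomp0_dl a (w : E) : hcomp 0 (dl a w) = 0.
Proof.
apply/ffunP=> J; rewrite !ffunE; case: ifP => // /eqP/cards0_eq ->.
by rewrite big1 // => i; rewrite inE.
Qed.

Lemma hcomp_ct p v (w : E) : hcomp p (ct v w) = ct v (hcomp p.+1 w).
Proof.
apply/ffunP=> J; rewrite !ffunE; case: ifP => hJ.
  apply: eq_bigr => i iJ; rewrite ffunE; move: hJ.
  by rewrite cardsU1 iJ add1n eqSS => ->.
rewrite big1 // => i iJ; rewrite ffunE; move: hJ.
by rewrite cardsU1 iJ add1n eqSS => ->; rewrite mulr0.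
Qed.

Lemma homog_one : homogeneous 0 (one_form R n).
Proof. by move=> I; rewrite cards_eq0 ffunE => /negbTE ->. Qed.
End Degree.

Lemma hcomp_one (R : comNzRingType) n p :
  hcomp p (one_form R n) = if p == 0%N then one_form R n else 0.
Proof.
apply/ffunP=> I; rewrite [LHS]ffunE; case: (eqVneq I set0) => [->|I0].
  by rewrite cards0; case: p => [|p] //=; rewrite !ffunE.
have one0 : one_form R n I = 0 by rewrite ffunE (negbTE I0).
by rewrite one0 if_same; case: ifP; rewrite ?one0 ?ffunE.
Qed.

Lemma hcomp_pb (R T : comNzRingType) (phi : {rmorphism R -> T}) n m
    (b : 'I_n -> 'I_m -> T) p w : hcomp p (pb phi b w) = pb phi b (hcomp p w).
Proof.
elim/form_ind: w p => [|a u v hu hv|i w hw] p.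
- rewrite pb_one !hcomp_one; case: ifP => _; first by rewrite pb_one.
  by rewrite pb0.
- by rewrite pbD pbZ !linearP /= hu hv pbD pbZ.
- case: p => [|p]; first by rewrite pb_dl !hcomp0_dl pb0.
  by rewrite pb_dl !hcomp_dl hw pb_dl.
Qed.


(** * Linear forms and restriction to a hyperplane *)

Section ModuleIdentities.
Variables (R : comNzRingType) (V : lmodType R).
Implicit Types (k l r : R) (u w : V).

Lemma lincomb_sub k k' u u' w w' : k *: u + w - (k' *: u' + w') =
  k *: (u - u') + (k - k') *: u' + (w - w').
Proof.
rewrite opprD addrACA; congr (_ + _).
by rewrite scalerBr scalerBl addrA subrK.
Qed.

Lemma lincomb_lin (D : {linear V -> V}) k l r u1 u2 u w1 w2 :
  k *: (D u1 + l *: u2) + (l * r) *: u + (D w1 + l *: w2) =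
  D (k *: u1 + w1) + l *: (k *: u2 + r *: u + w2).
Proof.
rewrite linearP !scalerDr !scalerA [k * l]mulrC -!addrA; congr (_ + _).
by rewrite [X in _ + X]addrCA addrCA.
Qed.

Lemma lincomb_shift (D : {linear V -> V}) k x y u :
  - D y + u + k *: D x = D (k *: x - y) + u.
Proof. by rewrite linearB linearZ /= addrAC [- _ + _]addrC. Qed.

End ModuleIdentities.

Section LinearForms.
Variable K : fieldType.

Definition lin n : 'cV[K]_n -> {mpoly K[n]} :=
  locked_with lock_key (fun b => \sum_i b i 0 *: 'X_i).

Lemma linE n (b : 'cV[K]_n) : lin b = \sum_i b i 0 *: 'X_i.
Proof. by rewrite /lin unlock. Qed.
Definition dcon n (b : 'cV[K]_n) (i : 'I_n) : {mpoly K[n]} := (b i 0)%:MP.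

Lemma lin_is_linear n : linear (@lin n).
Proof.
move=> k b b'; rewrite !linE scaler_sumr -big_split; apply: eq_bigr => i _ /=.
by rewrite !mxE scalerDl scalerA.
Qed.
HB.instance Definition _ n := GRing.isLinear.Build K 'cV[K]_n {mpoly K[n]} *:%R
  (@lin n) (@lin_is_linear n).

Lemma lin_delta n (i : 'I_n) : lin (delta_mx i 0) = 'X_i.
Proof.
rewrite linE (bigD1 i) //= big1 ?addr0 => [|j ji].
  by rewrite mxE !eqxx scale1r.
by rewrite mxE (negbTE ji) scale0r.
Qed.

Lemma lin_coef n (b : 'cV[K]_n) i : (lin b)@_U_(i) = b i 0.
Proof.
rewrite linE raddf_sum (bigD1 i) //= mcoeffZ mcoeffXU eqxx mulr1 big1 ?addr0 //.
by move=> j ji; rewrite mcoeffZ mcoeffXU (negbTE ji) mulr0.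
Qed.

Lemma linform_inj n : injective (@lin n).
Proof. by move=> b b' h; apply/colP => i; rewrite -!lin_coef h. Qed.

Lemma lin_eq0 n (b : 'cV[K]_n) : (lin b == 0) = (b == 0).
Proof. by rewrite -(inj_eq (@linform_inj n)) raddf0. Qed.

Lemma mpoly_ind n (P : {mpoly K[n]} -> Prop) : (forall c, P c%:MP) ->
  (forall i, P 'X_i) -> (forall p q, P p -> P q -> P (p + q)) ->
  (forall p q, P p -> P q -> P (p * q)) -> forall p, P p.
Proof.
move=> PC PX PD PM p; rewrite (mpolyE p).
apply: (big_ind P) => [|//|m _]; first by rewrite -mpolyC0.
rewrite -mul_mpolyC; apply: (PM) => //.
rewrite mpolyXE_id; apply: (big_ind P) => [|//|i _]; first by rewrite -mpolyC1.
elim: (m i) => [|k IH]; first by rewrite expr0 -mpolyC1.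
by rewrite exprS; apply: (PM).
Qed.

Section Substitution.
Variables (m n : nat) (c : 'M[K]_(m, n)).

(** Composition of polynomial functions with the linear map [u |-> u *m c] of row vectors; [pbm] is
    the pullback of forms along the same map. *)
Definition subst : {mpoly K[n]} -> {mpoly K[m]} :=
  locked_with lock_key (comp_mpoly [tuple lin (col i c) | i < n]).

Lemma substE : subst = comp_mpoly [tuple lin (col i c) | i < n].
Proof. exact: unlock. Qed.

Lemma subst_zmod_morphism : zmod_morphism subst.
Proof. by rewrite substE; apply: raddfB. Qed.
Lemma subst_monoid_morphism : monoid_morphism subst.
Proof. by rewrite substE; split; [apply: rmorph1 | apply: rmorphM]. Qed.
HB.instance Definition _ :=
  GRing.isZmodMorphism.Build {mpoly K[n]} {mpoly K[m]} subst subst_zmod_morphism.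
HB.instance Definition _ :=
  GRing.isMonoidMorphism.Build {mpoly K[n]} {mpoly K[m]} subst subst_monoid_morphism.

Lemma substC k : subst k%:MP = k%:MP.
Proof. by rewrite substE comp_mpolyC. Qed.

Lemma substX i : subst 'X_i = lin (col i c).
Proof. by rewrite substE comp_mpolyXU -tnth_nth tnth_mktuple. Qed.

Lemma substZ k p : subst (k *: p) = k *: subst p.
Proof. by rewrite substE comp_mpolyZ. Qed.

Lemma subst_lin b : subst (lin b) = lin (c *m b).
Proof.
rewrite {1}linE rmorph_sum (eq_bigr (fun i => b i 0 *: lin (col i c))) => [|i _]; last first.
  by rewrite -substX -substZ.
under eq_bigr do rewrite -linearZ.
rewrite -linear_sum; congr lin; apply/colP => j; rewrite summxE !mxE.
by apply: eq_bigr => i _; rewrite !mxE mulrC.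
Qed.

Definition pbm : formmod {mpoly K[n]} n -> formmod {mpoly K[m]} m :=
  locked_with lock_key (pb subst (fun i j => (c j i)%:MP)).

Lemma pbmE w : pbm w = pb subst (fun i j => (c j i)%:MP) w.
Proof. by rewrite /pbm unlock. Qed.

Lemma pbmD u w : pbm (u + w) = pbm u + pbm w.
Proof. by rewrite !pbmE pbD. Qed.

Lemma pbmZ k w : pbm (k *: w) = subst k *: pbm w.
Proof. by rewrite !pbmE pbZ. Qed.

Lemma pbm0 : pbm 0 = 0. Proof. by rewrite pbmE pb0. Qed.

Lemma pbm_one : pbm (one_form _ _) = one_form _ _.
Proof. by rewrite pbmE pb_one. Qed.

Lemma pbm_dl b w : pbm (dl (dcon b) w) = dl (dcon (c *m b)) (pbm w).
Proof.
rewrite !pbmE pb_dl; apply: eq_dl => j; rewrite /dcon !mxE raddf_sum.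
by apply: eq_bigr => i _ /=; rewrite substC -mpolyCM mulrC.
Qed.

Lemma pbm_dx i w :
  pbm (dl (dx _ i) w) = dl (fun j => (c j i)%:MP) (pbm w).
Proof.
rewrite !pbmE pb_dl; apply: eq_dl => j.
rewrite (bigD1 i) //= big1 ?addr0 => [|k ki].
  by rewrite /dx eqxx rmorph1 mul1r.
by rewrite /dx eq_sym (negbTE ki) rmorph0 mul0r.
Qed.

Lemma hcomp_pbm p w : hcomp p (pbm w) = pbm (hcomp p w).
Proof. by rewrite !pbmE hcomp_pb. Qed.

End Substitution.

Lemma subst_comp m n k (c : 'M[K]_(m, n)) (d : 'M[K]_(n, k)) p :
  subst c (subst d p) = subst (c *m d) p.
Proof.
apply: (mpoly_rmorph_eq (f := subst c \o subst d)) => [x|i] /=.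
  by rewrite !substC.
by rewrite !substX subst_lin colE mulmxA -colE.
Qed.

Lemma subst1 n p : subst (1%:M : 'M[K]_n) p = p.
Proof.
apply: (mpoly_rmorph_eq (g := idfun)) => [x|i] /=; first by rewrite substC.
by rewrite substX colE mul1mx lin_delta.
Qed.

Lemma pbm1 n w : pbm (1%:M : 'M[K]_n) w = w.
Proof.
elim/form_ind: w => [|k u w hu hw|i w hw]; first by rewrite pbm_one.
  by rewrite pbmD pbmZ hu hw subst1.
rewrite pbm_dx hw; apply: eq_dl => l.
by rewrite /dx mxE eq_sym; case: eqP => _; rewrite ?mpolyC1 ?mpolyC0.
Qed.

Lemma pbm_dcoef m n (c : 'M[K]_(m, n)) (x : 'I_n -> K) w :
  pbm c (dl (fun i => (x i)%:MP) w) =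
  dl (fun j => (\sum_i c j i * x i)%:MP) (pbm c w).
Proof.
have -> : dl (fun i => (x i)%:MP) w = dl (dcon (\col_i x i)) w.
  by apply: eq_dl => i; rewrite /dcon mxE.
rewrite pbm_dl; apply: eq_dl => j; rewrite /dcon mxE; congr _%:MP.
by apply: eq_bigr => i _; rewrite mxE.
Qed.

Lemma pbm_comp m n k (c : 'M[K]_(m, n)) (d : 'M[K]_(n, k)) w :
  pbm c (pbm d w) = pbm (c *m d) w.
Proof.
elim/form_ind: w => [|p u w hu hw|i w hw]; first by rewrite !pbm_one.
  rewrite (pbmD d) (pbmZ d) (pbmD c) (pbmZ c) hu hw (pbmD (c *m d)) (pbmZ (c *m d)).
  by rewrite subst_comp.
rewrite (pbm_dx d) pbm_dcoef hw (pbm_dx (c *m d)).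
by apply: eq_dl => l; rewrite mxE.
Qed.

Definition dvdm n (p q : {mpoly K[n]}) : Prop := exists r, q = p * r.
Definition dvdf n (p : {mpoly K[n]}) (w : formmod {mpoly K[n]} n) : Prop :=
  exists g, w = p *: g.

(** Row vectors decompose into the kernel of [a], embedded by [c], and the line of [v]; [d] reads
    off the coordinates of the first component. *)
Record splitting m n (a : 'cV[K]_n) (v : 'rV[K]_n) (c : 'M[K]_(m, n))
    (d : 'M[K]_(n, m)) : Prop := Splitting {
  split_ca : c *m a = 0;
  split_va : v *m a = 1%:M;
  split_cd : c *m d = 1%:M;
  split_dc : d *m c + a *m v = 1%:M }.

Lemma ex_splitting m n (a : 'cV[K]_n) (c : 'M[K]_(m, n)) :
  m.+1 = n -> a != 0 -> c *m a = 0 -> row_free c -> exists v d, splitting a v c d.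
Proof.
move=> mn a0 ca fc.
have [v va] : exists v : 'rV_n, v *m a = 1%:M.
  have [i ai] : exists i, a i 0 != 0.
    by apply/existsP; apply: contraNT a0 => /existsPn h; apply/eqP/colP => i;
      rewrite mxE; apply/eqP; have := h i; rewrite negbK.
  exists ((a i 0)^-1 *: delta_mx 0 i); rewrite -scalemxAl -rowE.
  by apply/matrixP => j k; rewrite !ord1 !mxE mulVf.
have [d0 cd0] := row_freeP fc.
(* A right inverse of [c], corrected so as to kill [v]. *)
pose d := d0 - a *m (v *m d0).
have cd : c *m d = 1%:M by rewrite /d mulmxBr cd0 (mulmxA c a) ca mul0mx subr0.
have vd : v *m d = 0 by rewrite /d mulmxBr (mulmxA v a) va mul1mx subrr.
exists v, d; split=> //.
(* [P] fixes [v] and the rows of [c], which span the whole space, hence it is the identity. *)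
set P := d *m c + a *m v.
have cP : c *m P = c by rewrite /P mulmxDr (mulmxA c d) (mulmxA c a) cd ca mul1mx mul0mx addr0.
have vP : v *m P = v by rewrite /P mulmxDr (mulmxA v d) (mulmxA v a) vd va mul1mx mul0mx add0r.
have full : row_full (col_mx c v).
  rewrite /row_full -addsmxE mxrank_disjoint_sum; last first.
    apply/eqP/rowV0P => u; rewrite sub_capmx => /andP[/submxP[x xE] /submxP[y yE]].
    have : u *m a = 0 by rewrite xE -mulmxA ca mulmx0.
    by rewrite yE -mulmxA va mulmx1 => ->; rewrite mul0mx.
  have v0 : v != 0.
    apply: contra_eqN va => /eqP ->; rewrite mul0mx; apply/eqP => /matrixP/(_ 0 0).
    by rewrite !mxE => /esym/eqP; rewrite oner_eq0.
  by rewrite (eqP fc) rank_rV v0 addn1 mn.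
have /row_fullP[B BE] := full.
by rewrite -[LHS]mul1mx -BE -mulmxA mul_col_mx cP vP.
Qed.

Lemma splitting_scale m n (a : 'cV[K]_n) v (c : 'M[K]_(m, n)) d b :
  splitting a v c d -> c *m b = 0 -> b = (v *m b) 0 0 *: a.
Proof.
move=> spl cb; rewrite -[LHS]mul1mx -(split_dc spl) mulmxDl -!mulmxA cb mulmx0.
by rewrite add0r {1}[v *m b]mx11_scalar mul_mx_scalar.
Qed.

Lemma ex_splitting_col n (a : 'cV[K]_n) : a != 0 ->
  exists m (v : 'rV[K]_n) (c : 'M[K]_(m, n)) d, splitting a v c d.
Proof.
move=> a0; exists (\rank (kermx a)).
have [||||v [d h]] := @ex_splitting _ n a (row_base (kermx a)) => //.
- rewrite mxrank_ker -mxrank_tr rank_rV; have -> : a^T != 0 by rewrite trmx_eq0.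
  case: n a a0 => [|n] a a0; last by rewrite subn1.
  by case/eqP: a0; apply/colP; case.
- by apply/sub_kermxP; rewrite eq_row_base.
- exact: row_base_free.
by exists v, (row_base (kermx a)), d.
Qed.

Section Splitting.
Variables (m n : nat) (a : 'cV[K]_n) (v : 'rV[K]_n) (c : 'M[K]_(m, n)) (d : 'M[K]_(n, m)).
Hypothesis spl : splitting a v c d.
Local Notation S := {mpoly K[n]}.
Local Notation F := (formmod S n).

Definition vcon (i : 'I_n) : S := (v 0 i)%:MP.

Lemma sum_dcon_vcon b : \sum_i dcon b i * vcon i = ((v *m b) 0 0)%:MP.
Proof.
rewrite mxE raddf_sum; apply: eq_bigr => i _.
by rewrite /dcon /vcon -mpolyCM mulrC.
Qed.

Lemma ct_dl_split b w : ct vcon (dl (dcon b) w) + dl (dcon b) (ct vcon w) =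
  ((v *m b) 0 0)%:MP *: w.
Proof. by rewrite ct_dl sum_dcon_vcon. Qed.

(** [v] pairs to 1 with the differential of [lin a], so contraction is a contracting homotopy for
    wedging with that differential. *)
Lemma homotopy w : w = ct vcon (dl (dcon a) w) + dl (dcon a) (ct vcon w).
Proof. by rewrite ct_dl_split (split_va spl) mxE eqxx mpolyC1 scale1r. Qed.

Lemma a_neq0 : a != 0.
Proof.
apply/eqP => a0; have /matrixP/(_ 0 0) := split_va spl.
by rewrite a0 mulmx0 !mxE => /esym/eqP; rewrite oner_eq0.
Qed.

Lemma substK p : subst c (subst d p) = p.
Proof. by rewrite subst_comp (split_cd spl) subst1. Qed.

Lemma pbmK w : pbm c (pbm d w) = w.
Proof. by rewrite pbm_comp (split_cd spl) pbm1. Qed.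

Lemma subst_a : subst c (lin a) = 0.
Proof. by rewrite subst_lin (split_ca spl) raddf0. Qed.

Lemma dcon_split i (j : 'I_n) :
  dx S i j - (\sum_k (c k i)%:MP * (d j k)%:MP) = vcon i * dcon a j.
Proof.
have /matrixP/(_ j i) := split_dc spl; rewrite !mxE big_ord1.
rewrite /dx /vcon /dcon => h.
have -> : (i == j)%:R = ((j == i)%:R : K)%:MP_[n].
  by rewrite eq_sym; case: eqP => _; rewrite ?mpolyC1 ?mpolyC0.
have -> : \sum_k (c k i)%:MP * (d j k)%:MP = (\sum_k d j k * c k i)%:MP_[n].
  by rewrite raddf_sum; apply: eq_bigr => k _; rewrite /= -mpolyCM mulrC.
by rewrite -h mpolyCD addrAC subrr add0r -mpolyCM mulrC.
Qed.

Lemma subst_retract p : dvdm (lin a) (p - subst d (subst c p)).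
Proof.
elim/mpoly_ind: p => [x|i|p q [p' pE] [q' qE]|p q [p' pE] [q' qE]].
- by exists 0; rewrite !substC subrr mulr0.
- exists (v 0 i)%:MP; rewrite substX subst_lin -lin_delta -raddfB /=.
  rewrite mulrC mul_mpolyC -linearZ /=; congr lin.
  rewrite colE mulmxA -[X in X - _]mul1mx -(split_dc spl) mulmxDl.
  rewrite [_ *m _ + _]addrC addrK -mulmxA -colE; apply/colP => k.
  by rewrite !mxE big_ord1 !mxE mulrC.
- by exists (p' + q'); rewrite !rmorphD opprD addrACA pE qE mulrDr.
- exists (p' * q + subst d (subst c p) * q'); rewrite !rmorphM mulrDr mulrA -pE.
  by rewrite mulrCA -qE mulrBl mulrBr addrA subrK.
Qed.

Lemma subst_ker p : subst c p = 0 <-> dvdm (lin a) p.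
Proof.
split=> [h|[q ->]]; last by rewrite rmorphM /= subst_a mul0r.
by have := subst_retract p; rewrite h rmorph0 subr0.
Qed.

(** [pbm d] is a section of [pbm c], and on [dx_i] the error is a constant multiple of the
    differential of [lin a]; on coefficients it is a multiple of [lin a]. Induction combines the
    two. *)
Lemma pbm_retract w : exists e1 e2,
  w - pbm d (pbm c w) = dl (dcon a) e1 + lin a *: e2.
Proof.
elim/form_ind: w => [|k u w [u1 [u2 uE]] [w1 [w2 wE]]|i w [w1 [w2 wE]]].
- by exists 0, 0; rewrite !pbm_one subrr raddf0 scaler0 addr0.
- have [r rE] := subst_retract k.
  exists (k *: u1 + w1), (k *: u2 + r *: pbm d (pbm c u) + w2).
  rewrite (pbmD c) (pbmZ c) (pbmD d) (pbmZ d) lincomb_sub uE wE rE.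
  exact: (lincomb_lin (dl (dcon a))).
- have -> : dl (dx S i) w - pbm d (pbm c (dl (dx S i) w)) =
     dl (dx S i) (w - pbm d (pbm c w)) + vcon i *: dl (dcon a) (pbm d (pbm c w)).
    rewrite raddfB /= -addrA; congr (_ + _).
    have -> : dl (dx S i) (pbm d (pbm c w)) =
      dl (fun j => vcon i * dcon a j + \sum_k (c k i)%:MP * (d j k)%:MP)
       (pbm d (pbm c w)).
      by apply: eq_dl => j; rewrite -dcon_split subrK.
    rewrite dl_add opprD addrC addrA addrN add0r; congr (- _).
    rewrite (pbm_dx c) pbm_dcoef; apply: eq_dl => j; rewrite raddf_sum.
    by apply: eq_bigr => k _; rewrite /= -mpolyCM mulrC.
  rewrite wE raddfD /= dlC linearZ /=.
  exists (vcon i *: pbm d (pbm c w) - dl (dx S i) w1), (dl (dx S i) w2).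
  exact: (lincomb_shift (dl (dcon a))).
Qed.

Lemma pbm_ker w : pbm c w = 0 -> exists e1 e2, w = dl (dcon a) e1 + lin a *: e2.
Proof.
move=> h; have [e1 [e2 wE]] := pbm_retract w; exists e1, e2.
by rewrite -wE h pbm0 subr0.
Qed.

(** The decomposition of a logarithmic numerator into a multiple of the differential and a multiple
    of [lin a]; since [v] has constant coefficients, no denominator appears. *)
Lemma dl_dvd w g : dl (dcon a) w = lin a *: g ->
  w = dl (dcon a) (ct vcon w) + lin a *: ct vcon g.
Proof. by move=> h; rewrite {1}(homotopy w) h linearZ addrC. Qed.

End Splitting.

Section Prime.
Variables (n : nat) (a : 'cV[K]_n).
Hypothesis a0 : a != 0.

(** Restriction to the hyperplane has the multiples of [lin a] as kernel and a domain as target. *)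
Lemma lin_prime p q : dvdm (lin a) (p * q) -> dvdm (lin a) p \/ dvdm (lin a) q.
Proof.
have [m [v [c [d spl]]]] := ex_splitting_col a0.
move=> /(subst_ker spl); rewrite rmorphM => /eqP; rewrite mulf_eq0.
by move=> /orP[/eqP|/eqP] /(subst_ker spl); [left|right].
Qed.

Lemma dvdm_lin b : dvdm (lin a) (lin b) -> exists k, b = k *: a.
Proof.
have [m [v [c [d spl]]]] := ex_splitting_col a0.
move=> /(subst_ker spl); rewrite subst_lin => /eqP; rewrite lin_eq0 => /eqP cb.
by exists ((v *m b) 0 0); apply: (splitting_scale spl).
Qed.

Lemma dvdm1 : ~ dvdm (lin a) 1.
Proof.
have [m [v [c [d spl]]]] := ex_splitting_col a0.
by move=> /(subst_ker spl); rewrite rmorph1 => /eqP; rewrite oner_eq0.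
Qed.

Lemma dvdm_prod (T : eqType) (s : seq T) (f : T -> {mpoly K[n]}) :
  dvdm (lin a) (\prod_(x <- s) f x) -> exists2 x, x \in s & dvdm (lin a) (f x).
Proof.
elim: s => [|x s IH]; first by rewrite big_nil => /dvdm1.
rewrite big_cons => /lin_prime[h|/IH[y ys h]]; first by exists x; rewrite ?inE ?eqxx.
by exists y; rewrite // inE ys orbT.
Qed.
End Prime.

Lemma dvdfP n (p : {mpoly K[n]}) (w : formmod {mpoly K[n]} n) :
  dvdf p w <-> forall I, dvdm p (w I).
Proof.
split=> [[g ->] I|h]; first by exists (g I); rewrite ffunE.
exists [ffun I => projT1 (cid (h I))]; apply/ffunP=> I; rewrite !ffunE.
by case: cid => r /= ->.
Qed.

Lemma dvdf_prime n (a : 'cV[K]_n) p w : a != 0 ->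
  dvdf (lin a) (p *: w) -> ~ dvdm (lin a) p -> dvdf (lin a) w.
Proof.
move=> a0 /dvdfP h hp; apply/dvdfP => I; have := h I; rewrite ffunE.
by case/(lin_prime a0).
Qed.

Lemma dvdf_prod n (T : eqType) (s : seq T) (b : T -> 'cV[K]_n) w : uniq s ->
  {in s, forall x, b x != 0} ->
  {in s &, forall x y, x != y -> forall k, b y <> k *: b x} ->
  {in s, forall x, dvdf (lin (b x)) w} -> dvdf (\prod_(x <- s) lin (b x)) w.
Proof.
elim: s w => [|x s IH] w; first by exists w; rewrite big_nil scale1r.
move=> /= /andP[xs us] b0 bb bw.
have xx : x \in x :: s by rewrite inE eqxx.
have ss y : y \in s -> y \in x :: s by move=> ys; rewrite inE ys orbT.
have [|||g gE] := IH w us.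
- by move=> y /ss; apply: b0.
- by move=> y z /ss ys /ss zs; apply: bb.
- by move=> y /ss; apply: bw.
have [||h hE] := dvdf_prime (b0 x xx) (p := \prod_(y <- s) lin (b y)) (w := g).
- by rewrite -gE; apply: bw.
- case/(dvdm_prod (b0 x xx)) => y ys /(dvdm_lin (b0 x xx))[k].
  have xy : x != y by apply: contraNneq xs => ->.
  exact: bb xx (ss _ ys) xy k.
exists h; have -> : \prod_(y <- x :: s) lin (b y) = \prod_(y <- s) lin (b y) * lin (b x).
  by rewrite big_cons mulrC.
by rewrite -scalerA -hE.
Qed.

End LinearForms.

(** * The residue sequence *)

Section FormSubmodules.
Variables (K : fieldType) (n : nat).
Local Notation S := {mpoly K[n]}.
Local Notation F := (formmod S n).

(** The logarithmic condition on the numerator alone: in [Q] times the wedge of the differential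
    with [e / Q], the denominator cancels. *)
Definition logform (b : 'cV[K]_n) (e : F) : Prop := dvdf (lin b) (dl (dcon b) e).

Lemma dvdf_submodule (p : S) : submodule (@dvdf K n p).
Proof.
split=> [|k u w [g ->] [h ->]]; first by exists 0; rewrite scaler0.
by exists (k *: g + h); rewrite scalerDr !scalerA mulrC.
Qed.

Lemma logform_submodule b : submodule (logform b).
Proof.
have [h0 hl] := dvdf_submodule (lin b).
split=> [|k u w hu hw]; first by rewrite /logform raddf0.
by rewrite /logform linearP; apply: hl.
Qed.

Lemma dvdfZ p k (w : F) : dvdf p w -> dvdf p (k *: w).
Proof. by move=> [g ->]; exists (k *: g); rewrite !scalerA mulrC. Qed.

Lemma dvdfD p (u w : F) : dvdf p u -> dvdf p w -> dvdf p (u + w).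
Proof. by move=> [g ->] [h ->]; exists (g + h); rewrite scalerDr. Qed.

Lemma dvdf_mul p q (w : F) : dvdm p q -> dvdf p (q *: w).
Proof. by move=> [r ->]; exists (r *: w); rewrite scalerA. Qed.

Lemma logformZ b k e : logform b e -> logform b (k *: e).
Proof. by move=> h; rewrite /logform linearZ; apply: dvdfZ. Qed.

Lemma logform_hcomp p b e : logform b e -> logform b (hcomp p e).
Proof.
move=> [g gE]; exists (hcomp p.+1 g); rewrite -hcomp_dl gE linearZ //.
Qed.

Lemma logform_dvdm b p e : dvdm (lin b) p -> logform b (p *: e).
Proof. by move=> h; rewrite /logform linearZ; apply: dvdf_mul. Qed.

Lemma logform_scale b b' k e : k != 0 -> b' = k *: b -> logform b' e -> logform b e.
Proof.
move=> k0 bE [g gE].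
have bE' : b = k^-1 *: b' by rewrite bE scalerA mulVf // scale1r.
have lE : lin b = k^-1%:MP * lin b' by rewrite mul_mpolyC {1}bE' linearZ.
rewrite /logform lE {1}bE'.
have -> : dl (dcon (k^-1 *: b')) e = k^-1%:MP *: dl (dcon b') e.
  rewrite -[RHS]addr0 -(dl0 e) -dl_add; apply: eq_dl => i.
  by rewrite addr0 /dcon mxE mpolyCM.
by exists g; rewrite -scalerA -gE.
Qed.

End FormSubmodules.

Lemma anticomm_pair (R : comNzRingType) (V : lmodType R) (A B : {linear V -> V})
    (k l : R) (x y : V) :
  (forall u, A (A u) = 0) -> (forall u, B (B u) = 0) ->
  (forall u, A (B u) = - B (A u)) ->
  B (k *: A x - l *: B x + A (B y)) = k *: B (A x) /\
  A (k *: A x - l *: B x + A (B y)) = l *: B (A x).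
Proof.
move=> AA BB AB; rewrite !linearD !linearN !linearZ /= !(AA, BB) !AB.
by rewrite !linearN /= !(AA, BB) !(scaler0, scalerN, oppr0, opprK, addr0, add0r).
Qed.

Section Residue.
Variables (K : fieldType) (m n : nat) (a : 'cV[K]_n) (v : 'rV[K]_n).
Variables (c : 'M[K]_(m, n)) (d : 'M[K]_(n, m)).
Hypothesis spl : splitting a v c d.
Variables (T : eqType) (s : seq T) (b : T -> 'cV[K]_n).
Hypotheses (s_uniq : uniq s)
  (b_a : {in s, forall x k, b x <> k *: a}).
Local Notation S := {mpoly K[n]}.
Local Notation F := (formmod S n).
Local Notation Sb := {mpoly K[m]}.
Local Notation Fb := (formmod Sb m).
Local Notation vv := (vcon v).

Definition logA' (e : F) : Prop := {in s, forall x, logform (b x) e}.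
Definition logA (e : F) : Prop := logA' e /\ logform a e.
Definition logAH (e : Fb) : Prop := {in s, forall x, logform (c *m b x) e}.

(* [splitting a v c d] identifies the hyperplane [lin a = 0] with [K^m] and
   [v] is a vector field with [v(lin a) = 1], so that contracting by [v] and
   restricting computes the residue of [e / Q] along the hyperplane. *)
Definition res (e : F) : Fb := pbm c (ct vv e).

Lemma b_neq0 x : x \in s -> b x != 0.
Proof. by move=> xs; apply/eqP => h; apply: (b_a xs (k := 0)); rewrite scale0r. Qed.

Lemma cb_neq0 x : x \in s -> c *m b x != 0.
Proof.
move=> xs; apply/eqP => h; apply: (b_a xs (k := (v *m b x) 0 0)).
exact: (splitting_scale spl).
Qed.

Lemma res_linear_for k u w : res (k *: u + w) = subst c k *: res u + res w.
Proof. by rewrite /res linearP pbmD pbmZ. Qed.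

Lemma resD u w : res (u + w) = res u + res w.
Proof. by rewrite /res linearD pbmD. Qed.

Lemma resZ k u : res (k *: u) = subst c k *: res u.
Proof. by rewrite /res linearZ pbmZ. Qed.

Lemma res0 : res 0 = 0. Proof. by rewrite /res linear0 pbm0. Qed.

Lemma resN u : res (- u) = - res u.
Proof. by apply: (addIr (res u)); rewrite -resD !addNr res0. Qed.

Lemma pbm_a w : pbm c (dl (dcon a) w) = 0.
Proof.
rewrite pbm_dl (split_ca spl).
rewrite (@eq_dl _ _ _ (fun _ => 0)) ?dl0 // => i.
by rewrite /dcon mxE mpolyC0.
Qed.

Lemma pbm_lin_a w : pbm c (lin a *: w) = 0.
Proof. by rewrite pbmZ (subst_a spl) scale0r. Qed.

Lemma dvdf_pbm p w : dvdf p w -> dvdf (subst c p) (pbm c w).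
Proof. by move=> [g ->]; exists (pbm c g); rewrite pbmZ. Qed.

Lemma pbm_log_a e : logform a e -> pbm c e = 0.
Proof.
by move=> [g gE]; rewrite (dl_dvd spl gE) pbmD pbm_a pbm_lin_a addr0.
Qed.

(** Wedging anticommutes with contraction up to a multiple of [e], and [e] restricts to zero on the
    hyperplane of [a] because it is logarithmic there. *)
Lemma res_log e : logA e -> logAH (res e).
Proof.
move=> [he /pbm_log_a pe] x xs; have [g gE] := he x xs.
rewrite /logform /res -pbm_dl -subst_lin.
have -> : dl (dcon (b x)) (ct vv e) = ((v *m b x) 0 0)%:MP *: e - ct vv (dl (dcon (b x)) e).
  by rewrite -ct_dl_split [X in X - _]addrC addrK.
rewrite pbmD pbmZ pe scaler0 add0r gE; apply: dvdf_pbm; exists (- ct vv g).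
by rewrite scalerN linearZ.
Qed.

Lemma logA_mul e : logA' e -> logA (lin a *: e).
Proof.
move=> he; split; first by move=> x xs; apply/logformZ/he.
by apply: logform_dvdm; exists 1; rewrite mulr1.
Qed.

Lemma res_mul e : res (lin a *: e) = 0.
Proof. by rewrite /res linearZ /= pbm_lin_a. Qed.

(** Zero residue makes [ct vv e] a combination of [lin a] and its differential. Wedging with the
    differential once more leaves a multiple of [lin a], which can be cancelled as the other forms
    are prime to it. *)
Lemma res_ker e : logA e -> res e = 0 -> exists2 e', logA' e' & e = lin a *: e'.
Proof.
move=> [he [g gE]] /(pbm_ker spl)[e1 [e2 eE]].
have e'E : e = lin a *: (ct vv g + dl (dcon a) e2).
  rewrite {1}(dl_dvd spl gE) eE linearD linearZ /= dl_dl add0r scalerDr.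
  exact: addrC.
exists (ct vv g + dl (dcon a) e2) => // x xs.
apply: (dvdf_prime (b_neq0 xs) (p := lin a)).
  by rewrite -(linZ (dl _)) /= -e'E; apply: he.
move=> /(dvdm_lin (b_neq0 xs))[k kE].
have k0 : k != 0 by apply: contraNneq (a_neq0 spl) => k0; rewrite kE k0 scale0r.
by apply: (b_a xs (k := k^-1)); rewrite kE scalerA mulVf // scale1r.
Qed.

(** For members of [s], this says that the two hyperplanes have the same trace on the kernel of
    [a]. *)
Definition assoc x y : bool := `[< exists k, c *m b y = k *: (c *m b x) >].

Definition ghat x : S := \prod_(y <- s | ~~ assoc x y) lin (b y).

Lemma assoc_lift x y : x \in s -> y \in s -> assoc x y ->
  exists k l, k != 0 /\ b y = k *: b x + l *: a.
Proof.
move=> xs ys /asboolP[k kE].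
have bE : b y = k *: b x + (v *m (b y - k *: b x)) 0 0 *: a.
  set z := b y - k *: b x; have <- : z = (v *m z) 0 0 *: a.
    apply: (splitting_scale spl).
    by rewrite mulmxBr kE -scalemxAr subrr.
  by rewrite addrC subrK.
exists k, ((v *m (b y - k *: b x)) 0 0); split=> //.
apply/eqP => k0; move: bE; rewrite k0 scale0r add0r; exact: b_a.
Qed.

Lemma assoc_refl x : assoc x x.
Proof. by apply/asboolP; exists 1; rewrite scale1r. Qed.

Lemma ghat_dvd x y : y \in s -> ~~ assoc x y -> dvdm (lin (b y)) (ghat x).
Proof.
move=> ys xy; rewrite /ghat -big_filter (bigD1_seq y) /=.
- by eexists.
- by rewrite mem_filter xy.
- exact: filter_uniq.
Qed.

(* Inverting the forms whose restrictions are not associated to that of [b x]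
   leaves an arrangement of rank two, where a logarithmic form on the
   restriction is [dl cbx e1 + lin cbx *: e2]; both terms have explicit
   liftings. *)
Lemma res_codim2 x e : x \in s -> logAH e ->
  exists2 w, logA w & res w = subst c (ghat x) *: e.
Proof.
move=> xs he; have [g gE] := he x xs.
have [m' [v' [c' [d' spl']]]] := ex_splitting_col (cb_neq0 xs).
have eE := dl_dvd spl' gE.
set e1 := ct _ e in eE; set e2 := ct _ g in eE.
pose A := dl (dcon a); pose B := dl (dcon (b x)).
(* The outer terms have residues [lin (c *m b x) *: e2] and [dl (dcon (c *m b x)) e1]. The middle
   one has residue zero and makes [w0] logarithmic along all the forms [k *: b x + l *: a] at
   once. *)
pose w0 : F := lin (b x) *: A (pbm d e2) - lin a *: B (pbm d e2) + A (B (pbm d e1)).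
have BB u : B (B u) = 0 by apply: dl_dl.
have AA u : A (A u) = 0 by apply: dl_dl.
have AB u : A (B u) = - B (A u) by apply: dlC.
have log_kl k l : dl (dcon (k *: b x + l *: a)) w0 =
    lin (k *: b x + l *: a) *: B (A (pbm d e2)).
  have -> : dl (dcon (k *: b x + l *: a)) w0 = k%:MP *: B w0 + l%:MP *: A w0.
    have h u : l%:MP *: A u = dl (dcon (l *: a)) u.
      rewrite -[LHS]addr0 -(dl0 u) -dl_add; apply: eq_dl => i.
      by rewrite addr0 /dcon mxE mpolyCM.
    rewrite h -dl_add; apply: eq_dl => i.
    by rewrite /dcon !mxE mpolyCD mpolyCM.
  have [-> ->] : B w0 = lin (b x) *: B (A (pbm d e2)) /\ A w0 = lin a *: B (A (pbm d e2)).
    exact: (anticomm_pair _ _ _ _ AA BB AB).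
  by rewrite !scalerA -scalerDl linearD !linearZ /= -!mul_mpolyC.
exists (ghat x *: w0).
  split=> [y ys|].
    have [xy|xy] := boolP (assoc x y); last exact: logform_dvdm (ghat_dvd ys xy).
    have [k [l [k0 yE]]] := assoc_lift xs ys xy.
    by apply: logformZ; rewrite /logform yE log_kl; eexists.
  apply: logformZ; exists (B (A (pbm d e2))).
  by have := log_kl 0 1; rewrite scale0r add0r scale1r.
rewrite -[ghat x *: w0]addr0 res_linear_for res0 addr0; congr (_ *: _).
have ctA u : res (A u) = pbm c u.
  by rewrite -[RHS](congr1 (pbm c) (esym (homotopy spl u))) pbmD pbm_a addr0.
rewrite /w0 (resD (_ - _)) (resD (lin (b x) *: _)) resN.
have -> : res (lin a *: B (pbm d e2)) = 0 by apply: res_mul.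
rewrite subr0 (resZ (lin (b x))).
rewrite (ctA (pbm d e2)) (ctA (B (pbm d e1))).
by rewrite (pbmK spl) subst_lin pbm_dl (pbmK spl) addrC -eE.
Qed.

Lemma res_surj_nil e : s = [::] -> logAH e -> exists2 w, logA w & res w = e.
Proof.
move=> s0 _; exists (dl (dcon a) (pbm d e)).
  split; first by move=> x; rewrite s0.
  by exists 0; rewrite dl_dl scaler0.
rewrite /res -[RHS](pbmK spl) {2}(homotopy spl (pbm d e)) pbmD.
by rewrite pbm_a addr0.
Qed.

Lemma logA'_submodule : submodule logA'.
Proof.
split=> [x xs|k u w hu hw x xs]; first by have [] := logform_submodule (b x).
by have [_] := logform_submodule (b x); apply; [apply: hu | apply: hw].
Qed.

Lemma logA_submodule : submodule logA.
Proof.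
have [h0 hl] := logA'_submodule; have [g0 gl] := logform_submodule a.
by split=> // k u w [hu hu'] [hw hw']; split; [apply: hl | apply: gl].
Qed.

(** The residue is linear once the target is restricted along [subst c]. Multiplying numerators by
    [lin a] is the inclusion of forms, since the denominator gains the same factor. *)
Lemma residue_sequence (U' U : F -> Prop) (V : Fb -> Prop)
    (M' M : lmodType S) (N : lmodType Sb)
    (i' : {linear M' -> F}) (i : {linear M -> F}) (j : {linear N -> Fb}) :
  injective i' -> (forall w, U' w <-> exists x, i' x = w) ->
  injective i -> (forall w, U w <-> exists x, i x = w) ->
  injective j -> (forall w, V w <-> exists x, j x = w) ->
  (forall w, U' w -> U (lin a *: w)) -> (forall w, U w -> V (res w)) ->
  (forall w, U w -> res w = 0 -> exists2 w', U' w' & w = lin a *: w') ->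
  exists (f : {linear M' -> M}) (r : {linear M -> restr (subst c) N}),
    [/\ injective f, exact_at f r & forall x, j (r x) = res (i x)].
Proof.
move=> i'I i'E iI iE jI jE h1 h2 h3.
have fl : linear (fun x => lin a *: i' x : F).
  by move=> k u w; rewrite linearP scalerDr !scalerA mulrC.
have [|f fE] := lift_inj (f := mklin fl) iI.
  by move=> x; apply/iE; apply: h1; apply/i'E; exists x.
have rl : linear (fun x => res (i x) : restr (subst c) Fb).
  by move=> k u w; rewrite linearP res_linear_for restrZ.
have [||r rE] := lift_inj (i := restr_lin (subst c) j) (f := mklin rl).
- exact: jI.
- by move=> x; apply/jE; apply: h2; apply/iE; exists x.
have areg (w w' : F) : lin a *: w = lin a *: w' -> w = w'.
  move=> h; apply/ffunP => I; have /ffunP/(_ I) := h; rewrite !ffunE => /mulfI; apply.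
  by rewrite lin_eq0; apply: a_neq0 spl.
have fI : injective f.
  move=> x y /(congr1 i); rewrite !fE => /areg; exact: i'I.
exists f, r; split=> // y; split=> [hy|[x <-]].
  have /h3[|w' /i'E[x <-] yE] : U (i y) by apply/iE; exists y.
    by rewrite -[LHS]/(mklin rl y) -rE hy lin_0.
  by exists x; apply: iI; rewrite fE.
apply: jI; rewrite -[LHS]/(restr_lin (subst c) j (r (f x))) rE.
by rewrite -[LHS]/(res (i (f x))) fE -[mklin fl x]/(lin a *: i' x) res_mul lin_0.
Qed.

End Residue.

(** * Numerators of logarithmic forms *)

Section FiniteSums.
Variables (R : comNzRingType) (I : finType) (V : I -> lmodType R) (M : lmodType R).
Variables (s : forall i, {linear V i -> M}) (r : forall i, {linear M -> V i}).
Hypothesis srE : forall x, x = \sum_i s i (r i x).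

Lemma km_sum gs q (c : kosz M gs q) : c = \sum_i km (s i) (km (r i) c).
Proof.
elim: gs q c => [|g gs IH] [|q] c //=.
  by rewrite [LHS]thinmx0 [RHS]thinmx0.
have fstE (F : I -> (kosz M gs q.+1 * kosz M gs q)%type) :
    \sum_i F i = (\sum_i (F i).1, \sum_i (F i).2).
  by elim/big_rec3: _ => // i x1 x2 y _ ->.
by rewrite fstE; case: c => c1 c2 /=; congr (_, _); apply: IH.
Qed.

Lemma acyc_sum gs q : (forall i, acyc gs q (V i)) -> acyc gs q M.
Proof.
move=> hV c dc; have h i : coboundary (km (r i) c).
  by apply: hV; rewrite -km_kd dc lin_0.
case: q c dc h {hV} => [|q] c dc h /=.
  rewrite (km_sum c) big1 // => i _.
  by have -> : km (r i) c = 0 := h i; rewrite lin_0.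
pose b i := projT1 (cid (h i)).
have bE i : kd (b i) = km (r i) c by rewrite /b; case: cid.
exists (\sum_i km (s i) (b i)); rewrite (linear_sum (@kd R M gs q)) [RHS]km_sum.
by apply: eq_bigr => i _ /=; rewrite -km_kd bE.
Qed.

Lemma projective_sum : (forall i, projective (V i)) -> projective M.
Proof.
move=> hV A B g f gs.
have ex i : exists h : {linear V i -> A}, forall x, g (h x) = f (s i x).
  exact: (hV i A B g (f \o s i : {linear V i -> B}) gs).
pose h i := projT1 (cid (ex i)).
have hE i x : g (h i x) = f (s i x) by rewrite /h; case: cid.
have hl : linear (fun x => \sum_i h i (r i x)).
  move=> a x y; rewrite scaler_sumr -big_split; apply: eq_bigr => i _ /=.
  by rewrite !linearP.
exists (mklin hl) => x; rewrite -[mklin hl x]/(\sum_i h i (r i x)).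
rewrite {2}(srE x) !linear_sum; apply: eq_bigr => i _ /=; exact: hE.
Qed.
End FiniteSums.

Section FiniteFunctions.
Variables (R : comNzRingType) (I : finType) (V : lmodType R).
Local Notation FV := {ffun I -> V}.

Definition ffun_in (i : I) (x : V) : FV := [ffun j => if j == i then x else 0].
Lemma ffun_in_linear i : linear (ffun_in i).
Proof.
move=> a x y; apply/ffunP => j; rewrite !ffunE; case: eqP => // _.
by rewrite scaler0 addr0.
Qed.
Definition ffun_at (i : I) (f : FV) : V := f i.
Lemma ffun_at_linear i : linear (ffun_at i).
Proof. by move=> a x y; rewrite /ffun_at !ffunE. Qed.

Lemma ffun_sumE (f : FV) :
  f = \sum_i mklin (@ffun_in_linear i) (mklin (ffun_at_linear i) f).
Proof.
apply/ffunP => j; rewrite sum_ffunE (bigD1 j) //= big1 ?addr0 => [|i ij].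
  by rewrite /ffun_in ffunE eqxx.
by rewrite /ffun_in ffunE eq_sym (negbTE ij).
Qed.

Lemma acyc_ffun gs q : acyc gs q V -> acyc gs q (FV : lmodType R).
Proof. by move=> h; apply: (acyc_sum ffun_sumE). Qed.

Lemma projective_ffun : projective V -> projective (FV : lmodType R).
Proof. by move=> h; apply: (projective_sum ffun_sumE). Qed.
End FiniteFunctions.

Lemma acyc0_mem (R : comNzRingType) (M : lmodType R) (gs : seq R) g :
  g \in gs -> (forall m : M, g *: m = 0 -> m = 0) -> acyc gs 0 M.
Proof.
move=> ggs gI c; have [m <-] := k0_bij c => dm /=.
suff -> : m = 0.
  by apply: (@k0_inj _ _ gs); rewrite -(scale0r (0 : M)) k0Z scale0r.
apply: gI; elim: gs ggs dm {c} => //= h gs IH.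
rewrite inE => /orP[/eqP <-|/IH h1] [dm]; last by move=> _; apply: h1.
rewrite -k0Z => gm; apply: (@k0_inj _ _ gs); rewrite gm.
by rewrite -(scale0r (0 : M)) k0Z scale0r.
Qed.

(** * Logarithmic forms as a kernel between free modules *)

Section LogPresentation.
Variables (K : fieldType) (n : nat).
Local Notation S := {mpoly K[n]}.
Local Notation F := (formmod S n).
Variables (B : seq 'cV[K]_n) (p : nat).
Hypothesis B0 : {in B, forall b, b != 0}.

(* The numerators [e] of the logarithmic [p]-forms [e / Q], where [B] lists the
   coefficient columns of the defining forms. *)
Definition logs (e : F) : Prop :=
  homogeneous p e /\ {in B, forall b, logform b e}.

Lemma logs_submodule : submodule logs.
Proof.
split=> [|k u w [hu lu] [hw lw]].
  split=> [I _|b bB]; first by rewrite ffunE.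
  by have [] := logform_submodule b.
split=> [I hI|b bB]; first by rewrite !ffunE hu // hw // scaler0 addr0.
by have [_] := logform_submodule b; apply; [apply: lu | apply: lw].
Qed.

Local Notation k := (size B).
Local Notation F0 := ({ffun 'I_k.+1 -> F} : lmodType S).
Local Notation F1 := ({ffun 'I_k.+1 -> F} : lmodType S).
Local Notation bb i := (nth 0 B i).

(** A linear system over [S] with unknowns [e], at [ord0], and one quotient [g_b] per form: it
    expresses that [e] is homogeneous of degree [p] and that [db /\ e = b g_b]. *)
Definition pres (u : F0) : F1 := [ffun i : 'I_k.+1 =>
  if unlift ord0 i is Some j then dl (dcon (bb j)) (u ord0) - lin (bb j) *: u i
  else u ord0 - hcomp p (u ord0)].

Lemma lincomb_subZ (R : comNzRingType) (V : lmodType R) (a l : R) (x y x' y' : V) :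
  a *: x + y - l *: (a *: x' + y') = a *: (x - l *: x') + (y - l *: y').
Proof.
rewrite scalerDr opprD addrACA scalerBr !scalerA [l * a]mulrC //.
Qed.

Lemma lincomb_sub1 (R : comNzRingType) (V : lmodType R) (a : R) (x y x' y' : V) :
  a *: x + y - (a *: x' + y') = a *: (x - x') + (y - y').
Proof. by rewrite opprD addrACA scalerBr. Qed.

Lemma presE u (i : 'I_k.+1) : pres u i =
  if unlift ord0 i is Some j then dl (dcon (bb j)) (u ord0) - lin (bb j) *: u i
  else u ord0 - hcomp p (u ord0).
Proof. by rewrite ffunE. Qed.

Lemma pres_is_linear : linear pres.
Proof.
have E (a : S) (x y : {ffun 'I_k.+1 -> F}) i : (a *: x + y) i = a *: x i + y i.
  by rewrite ffunE [X in X + _]ffunE.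
move=> a u w; apply/ffunP => i; rewrite E !presE !E.
case: unliftP => [j ij|_]; rewrite linearP; first exact: lincomb_subZ.
exact: lincomb_sub1.
Qed.

(** The quotients are determined by [e], as the linear forms are regular, so solutions of the system
    correspond to numerators. *)
Lemma logs_kernel (M : lmodType S) (i : {linear M -> F}) :
  injective i -> (forall w, logs w <-> exists x, i x = w) ->
  exists i' : {linear M -> F0}, injective i' /\ exact_at i' (mklin pres_is_linear).
Proof.
move=> iI iE.
have areg b (w w' : F) : b \in B -> lin b *: w = lin b *: w' -> w = w'.
  move=> bB h; apply/ffunP => I; have /ffunP/(_ I) := h; rewrite !ffunE => /mulfI; apply.
  by rewrite lin_eq0; apply: B0.
have bbB (j : 'I_k) : bb j \in B by apply: mem_nth.
have h x : exists u : F0, u ord0 = i x /\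
     forall j : 'I_k, dl (dcon (bb j)) (i x) = lin (bb j) *: u (lift ord0 j).
  have [hx lx] : logs (i x) by apply/iE; exists x.
  exists [ffun l => if unlift ord0 l is Some j then projT1 (cid (lx _ (bbB j))) else i x].
  split=> [|j]; rewrite ffunE; first by rewrite unlift_none.
  by rewrite liftK; case: cid.
pose f x := projT1 (cid (h x)).
have fE x : f x ord0 = i x /\
     forall j : 'I_k, dl (dcon (bb j)) (i x) = lin (bb j) *: f x (lift ord0 j).
  by rewrite /f; case: cid.
have fl : linear f.
  move=> a x y; have [e0 e1] := fE (a *: x + y).
  have [x0 x1] := fE x; have [y0 y1] := fE y.
  apply/ffunP => l; rewrite [RHS]ffunE [X in _ = X + _]ffunE.
  case: (unliftP ord0 l) => [j ->|->].
    apply: (areg _ _ _ (bbB j)); rewrite -e1 (linD i) (linZ i) (linD (dl _)) (linZ (dl _)) /= x1 y1.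
    by rewrite scalerDr !scalerA mulrC.
  by rewrite e0 x0 y0 (linD i) (linZ i).
exists (mklin fl); split.
  move=> x y xy; have xy' : f x = f y := xy; apply: iI.
  by rewrite -(fE x).1 -(fE y).1 xy'.
move=> u; split=> [hu|[x <-]].
  have /ffunP hu' : pres u = 0 := hu.
  have hom : u ord0 = hcomp p (u ord0).
    by apply/subr0_eq; have := hu' ord0; rewrite presE unlift_none ffunE.
  have lg (j : 'I_k) : dl (dcon (bb j)) (u ord0) = lin (bb j) *: u (lift ord0 j).
    by apply/subr0_eq; have := hu' (lift ord0 j); rewrite presE liftK ffunE.
  have /iE[x xE] : logs (u ord0).
    split; first by rewrite hom; apply: homog_hcomp.
    move=> b /(nthP 0)[j jk <-]; exists (u (lift ord0 (Ordinal jk))).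
    exact: (lg (Ordinal jk)).
  exists x; have [x0 x1] := fE x; apply/ffunP => l; rewrite -[mklin fl x]/(f x).
  case: (unliftP ord0 l) => [j ->|->]; last by rewrite x0 xE.
  by apply: (areg _ _ _ (bbB j)); rewrite -x1 -lg xE.
have [x0 x1] := fE x; apply/ffunP => l; rewrite -[LHS]/(pres (f x) l) presE [RHS]ffunE.
case: unliftP => [j ->|_]; first by rewrite x0 x1 subrr.
rewrite x0; have [hx _] : logs (i x) by apply/iE; exists x.
by rewrite hcomp_homog // subrr.
Qed.

(** The image of the presentation map sits in a free module, so its [H^0] vanishes; with [H^1] of
    the free source this gives [H^1] of the kernel. *)
Lemma acyc1_logs gs (M : lmodType S) (i : {linear M -> F}) :
  injective i -> (forall w, logs w <-> exists x, i x = w) ->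
  acyc gs 0 (S^o : lmodType S) -> acyc gs 1 (S^o : lmodType S) -> acyc gs 1 M.
Proof.
move=> iI iE h0 h1; have [i' [i'I ex]] := logs_kernel iI iE.
have [Im [j [e [jI es jE]]]] := ex_image (mklin pres_is_linear).
have hs : ses i' e.
  split=> // y; rewrite -ex -jE; split=> [->|h]; first exact: lin_0.
  by apply: jI; rewrite h lin_0.
apply: (acyc_kernel hs); first by do 2!apply: acyc_ffun.
by apply: (acyc0_inj jI); do 2!apply: acyc_ffun.
Qed.

Lemma pdI_logs (M : lmodType S) (i : {linear M -> F}) :
  injective i -> (forall w, logs w <-> exists x, i x = w) -> pdI (n - 2) M.
Proof.
move=> iI iE; have [i' [i'I ex]] := logs_kernel iI iE.
apply: (pdI_kernel i'I ex); do 2!apply: projective_ffun;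
  exact: regular_projective.
Qed.

End LogPresentation.


(** * Surjectivity of the residue from Koszul vanishing *)

Section ResidueSurjectivity.
Variables (K : fieldType) (m n : nat) (a : 'cV[K]_n) (v : 'rV[K]_n).
Variables (c : 'M[K]_(m, n)) (d : 'M[K]_(n, m)).
Hypothesis spl : splitting a v c d.
Variables (T : eqType) (s : seq T) (b : T -> 'cV[K]_n).
Hypotheses (s_uniq : uniq s)
  (b_a : {in s, forall x k, b x <> k *: a}).
Local Notation S := {mpoly K[n]}.
Local Notation F := (formmod S n).
Local Notation Sb := {mpoly K[m]}.
Local Notation Fb := (formmod Sb m).
Local Notation res := (res v c).
Local Notation ghat := (ghat c s b).

Lemma logsP p w : logs (map b s) p w <-> homogeneous p w /\ logA' s b w.
Proof.
split=> [] [hw lw]; split=> //; first by move=> x xs; apply: lw; apply: map_f.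
by move=> _ /mapP[x xs ->]; apply: lw.
Qed.

Lemma logs_consP p w :
  logs (a :: map b s) p w <-> homogeneous p w /\ logA a s b w.
Proof.
split=> [[hw lw]|[hw [lw la]]].
  split; [exact: hw | split; last by apply: lw; rewrite inE eqxx].
  by move=> x xs; apply: lw; rewrite inE map_f ?orbT.
split; first exact: hw.
move=> y; rewrite inE => /orP[/eqP ->|/mapP[x xs ->]]; [exact: la | exact: lw].
Qed.

Lemma logs_resP p w :
  logs [seq c *m b x | x <- s] p w <-> homogeneous p w /\ logAH c s b w.
Proof.
split=> [] [hw lw]; split=> //.
  by move=> x xs; apply: lw; apply/mapP; exists x.
by move=> _ /mapP[x xs ->]; apply: lw.
Qed.

Lemma res_hcomp p w : res (hcomp p.+1 w) = hcomp p (res w).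
Proof. by rewrite -[LHS]/(pbm c (ct (vcon v) (hcomp p.+1 w))) -hcomp_ct hcomp_pbm. Qed.

Lemma logA_hcomp p w : logA a s b w -> logs (a :: map b s) p (hcomp p w).
Proof.
move=> [lw la]; apply/logs_consP; split; first exact: homog_hcomp.
by split; [move=> x xs; apply/logform_hcomp/lw | apply: logform_hcomp].
Qed.

Lemma logs_sequence p (M' M : lmodType S) (N : lmodType Sb)
    (i' : {linear M' -> F}) (i : {linear M -> F}) (j : {linear N -> Fb}) :
  injective i' -> (forall w, logs (map b s) p.+1 w <-> exists x, i' x = w) ->
  injective i -> (forall w, logs (a :: map b s) p.+1 w <-> exists x, i x = w) ->
  injective j -> (forall w, logs [seq c *m b x | x <- s] p w <-> exists x, j x = w) ->
  exists (f : {linear M' -> M}) (r : {linear M -> restr (subst c) N}),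
    [/\ injective f, exact_at f r & forall x, j (r x) = res (i x)].
Proof.
move=> i'I i'E iI iE jI jE; apply: (residue_sequence spl i'I i'E iI iE jI jE).
- move=> w /logsP[hw lw]; apply/logs_consP; split; last exact: logA_mul.
  by move=> I hI; rewrite ffunE hw // scaler0.
- move=> w /logs_consP[hw lw]; apply/logs_resP; split; last exact: (res_log spl).
  by rewrite -(hcomp_homog hw) res_hcomp; apply: homog_hcomp.
- move=> w /logs_consP[hw lw] rw; have [w' lw' wE] := res_ker spl b_a lw rw.
  exists (hcomp p.+1 w').
    by apply/logsP; split; [apply: homog_hcomp | move=> x xs; apply/logform_hcomp/lw'].
  by rewrite -(linZ (hcomp p.+1)) /= -wE hcomp_homog.
Qed.

(** [koszul_lift] for the residue sequence. The lifts of multiples of [e] may have mixed degree and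
    are replaced by their components of degree [p.+1]. *)
Lemma koszul_surj gs p (M' : lmodType S) (i' : {linear M' -> F}) g0 e :
  injective i' -> (forall w, logs (map b s) p.+1 w <-> exists x, i' x = w) ->
  acyc gs 2 M' -> acyc gs 0 (S^o : lmodType S) -> acyc gs 1 (S^o : lmodType S) ->
  g0 \in gs -> subst c g0 != 0 -> logs [seq c *m b x | x <- s] p e ->
  (forall g, g \in gs -> exists2 w, logA a s b w & res w = subst c g *: e) ->
  exists2 w, logs (a :: map b s) p.+1 w & res w = e.
Proof.
move=> i'I i'E h2 h0 h1 g0gs cg0 he hg.
have [M [i [iI iE]]] := ex_submodule (logs_submodule (a :: map b s) p.+1).
have [N [j [jI jE]]] := ex_submodule (logs_submodule [seq c *m b x | x <- s] p).
have nz : {in a :: map b s, forall x, x != 0}.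
  move=> y; rewrite inE => /orP[/eqP ->|/mapP[x xs ->]]; first exact: a_neq0 spl.
  by have := b_neq0 b_a xs.
have [f [r [fI ex rE]]] := logs_sequence i'I i'E iI iE jI jE.
have /jE[y yE] := he.
have [||x xE] := koszul_lift (m := y : restr (subst c) N) fI ex h2 (acyc1_logs nz iI iE h0 h1).
- apply: (acyc0_mem g0gs) => z; rewrite restrZ => gz; apply: jI; rewrite lin_0.
  have /ffunP : j (subst c g0 *: (z : N)) = 0 by rewrite gz lin_0.
  rewrite linZ => hz; apply/ffunP => I; have := hz I; rewrite !ffunE => /eqP.
  by rewrite mulf_eq0 (negbTE cg0) => /eqP.
- move=> g /hg[w lw rw]; have /iE[x xE] := logA_hcomp p.+1 lw.
  exists x; apply: jI; rewrite rE xE res_hcomp rw restrZ (linZ j) yE (linZ (hcomp p)).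
  by rewrite /= hcomp_homog //; have [] := he.
exists (i x); first by apply/iE; exists x.
by rewrite -rE xE yE.
Qed.

Section CodimensionTwo.

Lemma subst_ghat x : subst c (ghat x) =
  \prod_(y <- [seq y <- s | ~~ assoc c b x y]) lin (c *m b y).
Proof.
rewrite big_filter rmorph_prod; apply: eq_bigr => y _ /=; exact: subst_lin.
Qed.

Lemma subst_ghat_neq0 x : subst c (ghat x) != 0.
Proof.
rewrite subst_ghat prodf_seq_neq0; apply/allP => y; rewrite mem_filter => /andP[_ ys] /=.
by rewrite lin_eq0; apply: (cb_neq0 spl b_a).
Qed.

Lemma ghat_ndvd y : y \in s -> ~ dvdm (lin (c *m b y)) (subst c (ghat y)).
Proof.
move=> ys; rewrite subst_ghat => /(dvdm_prod (cb_neq0 spl b_a ys))[z].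
rewrite mem_filter => /andP[yz zs] /(dvdm_lin (cb_neq0 spl b_a ys))[k kE].
by case/negP: yz; apply/asboolP; exists k.
Qed.

(** One linear factor is removed at a time: the prime [lin (be y)] does not divide [g], so it
    divides [f]. Repeated factors are allowed, as distinct hyperplanes may have the same trace. *)
Lemma dvdm_prod_colon (U : eqType) (t : seq U) (be : U -> 'cV[K]_m) (f : Sb) :
  {in t, forall y, be y != 0} ->
  {in t, forall y, exists2 g, ~ dvdm (lin (be y)) g &
     dvdm (\prod_(z <- t) lin (be z)) (g * f)} ->
  dvdm (\prod_(z <- t) lin (be z)) f.
Proof.
elim: t f => [|y t IH] f; first by exists f; rewrite big_nil mul1r.
move=> b0 h; have yt : y \in y :: t by rewrite inE eqxx.
have y0 := b0 y yt.
have [g gy [q qE]] := h y yt.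
have [|//|[f' f'E]] := lin_prime y0 (p := g) (q := f).
  by rewrite qE big_cons -mulrA; eexists.
have [||q' q'E] := IH f'.
- by move=> z zt; apply: b0; rewrite inE zt orbT.
- move=> z zt; have [|g' gz [q' q'E]] := h z; first by rewrite inE zt orbT.
  exists g' => //; exists q'; apply: (@mulfI _ (lin (be y))); first by rewrite lin_eq0.
  by rewrite mulrCA -f'E q'E big_cons mulrA.
by exists q'; rewrite big_cons -mulrA -q'E.
Qed.

Lemma mulg_linear (R : comNzRingType) (M : lmodType R) (g : R) :
  linear (fun x : M => g *: x).
Proof. by move=> k x y; rewrite scalerDr !scalerA mulrC. Qed.

(** Depth three of the ideal generated by [lin a] and the products [ghat x]: modulo [lin a] no prime
    divides all these products, since a prime factor of one is the restricted form of some [y], and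
    [ghat y] avoids it. *)
Lemma acyc_ghat q : (q < 3)%N -> s != [::] ->
  acyc (lin a :: map ghat s) q (S^o : lmodType S).
Proof.
move=> q3 s0; pose N : lmodType S := restr (subst c) (Sb^o : lmodType Sb).
have aI : injective (mklin (@mulg_linear S S^o (lin a))).
  apply: lin_inj => x /eqP; rewrite mulf_eq0 lin_eq0 (negbTE (a_neq0 spl)) => /eqP //.
case: q q3 => [|q] q3; first exact: acyc_cons0 aI.
have pl : linear (subst c : (S^o : lmodType S) -> N).
  by move=> k x y; rewrite rmorphD rmorphM.
have sesN : ses (mklin (@mulg_linear S S^o (lin a))) (mklin pl).
  split=> // [y|y]; first by exists (subst d y); apply: (substK spl).
  split=> [/(subst_ker spl)[x xE]|[x <-]]; first by exists x.
  by apply/(subst_ker spl); exists x.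
apply: acyc_cons sesN _ => //.
case: q q3 => [|q] q3.
  have [x xs] : exists x, x \in s by case: (s) s0 => // x t _; exists x; rewrite inE eqxx.
  apply: (acyc0_mem (map_f ghat xs)) => z /eqP; rewrite restrZ mulf_eq0.
  by rewrite (negbTE (subst_ghat_neq0 x)) => /eqP.
have -> : q = 0%N by lia.
case sE : s s0 => [//|x0 t] _ /=; rewrite -sE.
have gI : injective (mklin (@mulg_linear S N (ghat x0))).
  apply: lin_inj => x /eqP; rewrite -[_ == 0]/(subst c (ghat x0) * (x : Sb) == 0).
  by rewrite mulf_eq0 (negbTE (subst_ghat_neq0 x0)) => /eqP.
apply: acyc1_cons gI _ => // f hf.
have [||q' q'E] := @dvdm_prod_colon _ [seq y <- s | ~~ assoc c b x0 y]
  (fun y => c *m b y) (f : Sb).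
- by move=> y; rewrite mem_filter => /andP[_ ys]; apply: (cb_neq0 spl b_a).
- move=> y; rewrite mem_filter => /andP[xy ys].
  exists (subst c (ghat y)); first exact: ghat_ndvd.
  have yt : y \in t.
    by move: ys; rewrite sE inE => /orP[/eqP yx|//]; rewrite yx assoc_refl in xy.
  have [q' q'E] := hf _ (map_f ghat yt); exists (q' : Sb).
  by rewrite -subst_ghat; exact: q'E.
by exists (q' : N); rewrite -subst_ghat in q'E; exact: q'E.
Qed.

End CodimensionTwo.

(** The hypothesis on [M'] is the form in which freeness enters: degree 2 cohomology is controlled
    by that of free modules. An empty [s] offers no products to glue along and is lifted
    directly. *)
Lemma res_surj_acyc p (M' : lmodType S) (i' : {linear M' -> F}) e :
  injective i' -> (forall w, logs (map b s) p.+1 w <-> exists x, i' x = w) ->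
  (forall gs, acyc gs 2 (F : lmodType S) -> acyc gs 2 M') ->
  logs [seq c *m b x | x <- s] p e ->
  exists2 w, logs (a :: map b s) p.+1 w & res w = e.
Proof.
move=> i'I i'E hM he; have [hom lh] := (logs_resP p e).1 he.
have [s0|s0] := eqVneq s [::].
  have [w lw rw] := res_surj_nil spl s0 lh.
  exists (hcomp p.+1 w); first exact: logA_hcomp.
  by rewrite res_hcomp rw hcomp_homog.
have [x xs] : exists x, x \in s by case: (s) s0 => // x t _; exists x; rewrite inE eqxx.
apply: (koszul_surj (gs := lin a :: map ghat s) (g0 := ghat x) i'I i'E) => //.
- by apply: hM; apply: acyc_ffun; apply: acyc_ghat.
- exact: acyc_ghat.
- exact: acyc_ghat.
- by rewrite inE map_f ?orbT.
- exact: subst_ghat_neq0.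
move=> g; rewrite inE => /orP[/eqP ->|/mapP[y ys ->]].
  (* [lin a] kills the target, so 0 lifts this multiple. *)
  exists 0; first by have [] := logA_submodule a s b.
  by rewrite (subst_a spl) scale0r res0.
exact: (res_codim2 spl s_uniq b_a ys lh).
Qed.

End ResidueSurjectivity.

(** * Free arrangements *)

Section DegreeScaling.
Variables (R : comNzRingType) (n : nat).
Local Notation F := (formmod R n).
Local Notation one := (one_form R n).

Lemma dlZ l (x : 'I_n -> R) (w : F) : dl (fun i => l * x i) w = l *: dl x w.
Proof.
rewrite -[RHS]addr0 -(dl0 w) -dl_add; apply: eq_dl => i.
by rewrite addr0.
Qed.

Lemma dl_one (x : 'I_n -> R) (i : 'I_n) : dl x one [set i] = x i.
Proof.
rewrite ffunE big_set1 setDv ffunE eqxx mulr1 /sg.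
rewrite (_ : [set j in [set i] | (j < i)%N] = set0) ?cards0 ?mul1r //.
by apply/setP=> j; rewrite !inE; case: eqP => // ->; rewrite ltnn.
Qed.

Lemma form1E (w : F) : homogeneous 1 w -> w = dl (fun i => w [set i]) one.
Proof.
move=> hw; have h1 : homogeneous 1 (dl (fun i => w [set i]) one).
  rewrite -(hcomp_homog (@homog_one R n)) -hcomp_dl; exact: homog_hcomp.
apply/ffunP=> I; have [I1|I1] := eqVneq #|I| 1%N; last by rewrite hw // h1.
by have /eqP/cards1P[i ->] := I1; rewrite dl_one.
Qed.

Lemma dl_one_sum (x : 'I_n -> 'I_n -> R) (f : 'I_n -> R) :
  \sum_j f j *: dl (x j) one = dl (fun i => \sum_j f j * x j i) one.
Proof.
have h1 y : homogeneous 1 (dl y one).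
  rewrite -(hcomp_homog (@homog_one R n)) -hcomp_dl; exact: homog_hcomp.
apply/ffunP=> I; rewrite sum_ffunE.
have [/eqP I1|I1] := eqVneq #|I| 1%N; last first.
  by rewrite h1 // big1 // => j _; rewrite ffunE h1 // scaler0.
have /cards1P[i ->] := I1; rewrite dl_one.
by apply: eq_bigr => j _; rewrite ffunE dl_one.
Qed.

(** The effect of replacing each [dx_i] by [Q dx_i]; it keeps track of denominators that grow with
    the degree. *)
Definition scale_deg (Q : R) : F -> F :=
  locked_with lock_key (fun w => [ffun I : {set 'I_n} => Q ^+ #|I| * w I]).

Lemma scale_degE Q w : scale_deg Q w = [ffun I : {set 'I_n} => Q ^+ #|I| * w I].
Proof. by rewrite /scale_deg unlock. Qed.

Lemma scale_swap (x y z s t : R) : x * (y * z * (s * t)) = x * s * (y * z * t).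
Proof. by ring. Qed.

Lemma pb_scale_deg Q w : pb idfun (fun i j => Q * dx R i j) w = scale_deg Q w.
Proof.
elim/form_ind: w => [|a u w hu hw|i w hw].
- rewrite pb_one scale_degE; apply/ffunP=> I; rewrite !ffunE; case: eqP => [->|_].
    by rewrite cards0 expr0 mul1r.
  by rewrite mulr0.
- rewrite pbD pbZ hu hw !scale_degE; apply/ffunP=> I; rewrite !ffunE mulrDr.
  by rewrite [in RHS]mulrCA.
rewrite pb_dl hw.
rewrite (@eq_dl _ _ _ (fun k => Q * dx R i k)) => [|k]; last first.
  rewrite (bigD1 i) //= big1 ?addr0 => [|l li]; first by rewrite /dx eqxx mul1r.
  by rewrite /dx eq_sym (negbTE li) mul0r.
rewrite dlZ !scale_degE; apply/ffunP=> J; rewrite !ffunE -[_ *: _]/(_ * _) !mulr_sumr.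
apply: eq_bigr => j jJ; rewrite ffunE (cardsD1 j J) jJ add1n exprS.
exact: scale_swap.
Qed.

Lemma scale_degD Q u w : scale_deg Q (u + w) = scale_deg Q u + scale_deg Q w.
Proof. by rewrite !scale_degE; apply/ffunP=> I; rewrite !ffunE mulrDr. Qed.

Lemma scale_degZ Q a w : scale_deg Q (a *: w) = a *: scale_deg Q w.
Proof. by rewrite !scale_degE; apply/ffunP=> I; rewrite !ffunE mulrCA. Qed.

Lemma scale_deg_dl Q x w : scale_deg Q (dl x w) = Q *: dl x (scale_deg Q w).
Proof.
rewrite !scale_degE; apply/ffunP=> J; rewrite !ffunE -[_ *: _]/(_ * _) !mulr_sumr.
apply: eq_bigr => j jJ; rewrite ffunE (cardsD1 j J) jJ add1n exprS.
symmetry; exact: scale_swap.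
Qed.

Lemma scale_deg_hcomp Q p w : scale_deg Q (hcomp p w) = hcomp p (scale_deg Q w).
Proof.
by rewrite !scale_degE; apply/ffunP=> I; rewrite !ffunE; case: ifP => //; rewrite mulr0.
Qed.
End DegreeScaling.

Lemma scale_deg_inj (R : idomainType) n (Q : R) : Q != 0 ->
  injective (@scale_deg R n Q).
Proof.
move=> Q0 u w; rewrite !scale_degE => /ffunP h; apply/ffunP=> I; have := h I; rewrite !ffunE.
by apply: mulfI; rewrite expf_neq0.
Qed.

Lemma scaler_lincomb (R : comNzRingType) (V : lmodType R) (k l : R) (x y : V) :
  l *: (k *: x + y) = k *: (l *: x) + l *: y.
Proof. by rewrite scalerDr !scalerA mulrC. Qed.

Lemma linear_via_inj (R : comNzRingType) (V W Z : lmodType R) (f : W -> Z)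
    (r : V -> W) (h : V -> Z) :
  injective f -> linear f -> linear h -> (forall u, f (r u) = h u) -> linear r.
Proof. by move=> fI fl hl E k u w; apply: fI; rewrite E hl fl !E. Qed.

Section FreeLogForms.
Variables (K : fieldType) (n : nat).
Local Notation S := {mpoly K[n]}.
Local Notation F := (formmod S n).
Local Notation one := (one_form S n).
Variable B : seq 'cV[K]_n.
Hypotheses (B_uniq : uniq B) (B0 : {in B, forall b, b != 0})
  (BB : {in B &, forall b b', b != b' -> forall k, b' <> k *: b}).

Definition logB (e : F) : Prop := {in B, forall b, logform b e}.
Definition Qp : S := \prod_(b <- B) lin b.

Lemma Qp_neq0 : Qp != 0.
Proof. by rewrite prodf_seq_neq0; apply/allP => b bB /=; rewrite lin_eq0 B0. Qed.

Lemma form_regZ (q : S) (u w : F) : q != 0 -> q *: u = q *: w -> u = w.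
Proof.
move=> q0 h; apply/ffunP => I; have /ffunP/(_ I) := h; rewrite !ffunE => /mulfI; exact.
Qed.

Lemma Qp_dvd b : b \in B -> dvdm (lin b) Qp.
Proof. by move=> bB; rewrite /Qp (bigD1_seq b) //=; eexists. Qed.

Lemma dvdf_Qp (w : F) : {in B, forall b, dvdf (lin b) w} -> dvdf Qp w.
Proof. exact: (dvdf_prod (b := id)). Qed.

Definition Qb b : S := \prod_(b' <- B | b' != b) lin b'.

Lemma Qp_Qb b : b \in B -> Qp = lin b * Qb b.
Proof. by move=> bB; rewrite /Qp (bigD1_seq b). Qed.

Lemma Qb_ndvd b : b \in B -> ~ dvdm (lin b) (Qb b).
Proof.
move=> bB; rewrite /Qb -big_filter => /(dvdm_prod (B0 bB))[b'].
rewrite mem_filter => /andP[b'b b'B] /(dvdm_lin (B0 bB))[k kE].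
by apply: (BB bB b'B _ kE); rewrite eq_sym.
Qed.

Lemma dl_logform_coef b x v : v *m b = 1%:M -> logform b (dl x one) ->
  exists k y, x =1 (fun i => k * dcon b i + lin b * y i).
Proof.
move=> vb [g gE]; set k := \sum_i x i * vcon v i.
have kE : ct (vcon v) (dl x one) = k *: one.
  rewrite /k -ct_dl; have -> : ct (vcon v) one = 0; last by rewrite raddf0 addr0.
  apply/ffunP=> J; rewrite !ffunE big1 // => i iJ; rewrite ffunE.
  case: eqP => [h|_]; last by rewrite mulr0.
  by have := setU11 i J; rewrite h inE.
have dE : dl x one = k *: dl (dcon b) one + lin b *: ct (vcon v) g.
  have h w : w = ct (vcon v) (dl (dcon b) w) + dl (dcon b) (ct (vcon v) w).
    rewrite ct_dl (_ : \sum_i _ = 1) ?scale1r //.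
    have -> : \sum_i dcon b i * vcon v i = ((v *m b) 0 0)%:MP.
      rewrite mxE raddf_sum; apply: eq_bigr => i _.
      by rewrite /dcon /vcon /= -mpolyCM mulrC.
    by rewrite vb mxE eqxx mpolyC1.
  have := h (dl x one); rewrite kE gE (linZ (dl _)) (linZ (ct _)) /= => ->.
  exact: addrC.
exists k, (fun i => ct (vcon v) g [set i]) => i.
have /ffunP/(_ [set i]) := dE; rewrite dl_one [RHS]ffunE => ->.
by rewrite [X in X + _]ffunE [X in _ + X]ffunE dl_one.
Qed.

Lemma lincomb_dl2 (R : comNzRingType) (V : lmodType R) (A D : {linear V -> V})
    (k l : R) (x y : V) :
  (forall u, A (A u) = 0) -> (forall u, A (D u) = - D (A u)) ->
  k *: A (A x + l *: y) + l *: D (A x + l *: y) =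
    l *: (k *: A y + D (A x) + l *: D y) /\
  A (k *: A y + D (A x) + l *: D y) = l *: A (D y).
Proof.
move=> AA AD; split.
  rewrite (linD A) (linZ A) (linD D) (linZ D) AA add0r !scalerDr !scalerA.
  by rewrite [k * l]mulrC addrA.
rewrite !linearD !linearZ /= AA scaler0 add0r AD AA.
by rewrite (lin_0 D) oppr0 add0r.
Qed.

(* [dl x one] and [e] are numerators over [Qp], hence the division by [Qp]. *)
Lemma log_wedge x e : logB (dl x one) -> logB e ->
  exists2 e', logB e' & dl x e = Qp *: e'.
Proof.
move=> hx he.
have key b : b \in B -> exists2 g, dl x e = lin b *: g & dvdf (lin b) (dl (dcon b) g).
  move=> bB; have [m [v [c [d spl]]]] := ex_splitting_col (B0 bB).
  have [k [y xE]] := dl_logform_coef (split_va spl) (hx b bB).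
  have [g gE] := he b bB; have eE := dl_dvd spl gE.
  set e1 := ct _ e in eE; set e2 := ct _ g in eE.
  have [h1 h2] := @lincomb_dl2 _ _ (dl (dcon b)) (dl y) k (lin b) e1 e2
    (dl_dl _) (dlC _ _).
  exists (k *: dl (dcon b) e2 + dl y (dl (dcon b) e1) + lin b *: dl y e2).
    have -> : dl x e = k *: dl (dcon b) e + lin b *: dl y e.
      by rewrite -[lin b *: _]dlZ -dl_add; apply: eq_dl.
    move: h1; rewrite -eE; exact.
  by rewrite h2; eexists.
have [|e' e'E] := dvdf_Qp (w := dl x e).
  by move=> b /key[g gE _]; exists g.
exists e' => // b bB; have [g gE hg] := key b bB.
have l0 : lin b != 0 by rewrite lin_eq0 B0.
have gE' : g = Qb b *: e'.
  apply: (form_regZ l0); move: e'E; rewrite gE (Qp_Qb bB) -scalerA; exact.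
apply: (dvdf_prime (B0 bB) (p := Qb b)); last exact: Qb_ndvd.
by rewrite -linearZ -gE'.
Qed.

Section Basis.
Variable E : 'I_n -> F.
Hypotheses (E_log : forall j, logs B 1 (E j))
  (E_gen : forall w, logs B 1 w -> exists f : 'I_n -> S, w = \sum_j f j *: E j)
  (E_free : forall f : 'I_n -> S, \sum_j f j *: E j = 0 -> forall j, f j = 0).

Definition Ac j i : S := E j [set i].

Lemma log_basisE j : E j = dl (Ac j) one.
Proof. by have [h _] := E_log j; apply: form1E. Qed.

Lemma homog_dl_one (x : 'I_n -> S) : homogeneous 1 (dl x one).
Proof. rewrite -(hcomp_homog (@homog_one S n)) -hcomp_dl; exact: homog_hcomp. Qed.

Lemma homogZ p k (w : F) : homogeneous p w -> homogeneous p (k *: w).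
Proof. by move=> hw I hI; rewrite ffunE hw // scaler0. Qed.

Lemma ex_theta i : exists f : 'I_n -> S, Qp *: dl (dx S i) one = \sum_j f j *: E j.
Proof.
apply: E_gen; split; first exact/homogZ/homog_dl_one.
by move=> b bB; apply/logform_dvdm/Qp_dvd.
Qed.

(** The coordinates of [dx_i] in the basis [E j / Qp]. The columns of [theta] are the dual basis of
    logarithmic derivations. *)
Definition theta i j : S := projT1 (cid (ex_theta i)) j.

Lemma thetaE i : Qp *: dl (dx S i) one = \sum_j theta i j *: E j.
Proof. by rewrite /theta; case: cid. Qed.

Lemma theta_Ac i k : \sum_j theta i j * Ac j k = Qp * dx S i k.
Proof.
have := thetaE i; under eq_bigr do rewrite log_basisE.
rewrite dl_one_sum => /ffunP/(_ [set k]); rewrite dl_one => <-.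
by rewrite ffunE dl_one.
Qed.

(** [Qb b] times the differential of [lin b] is the numerator of the logarithmic form [db / b]. Its
    coordinates are [t], and multiplied by [lin b] they are the coordinates of [db]. *)
Lemma theta_log b : b \in B ->
  exists t, forall j, \sum_i dcon b i * theta i j = lin b * t j.
Proof.
move=> bB; have [|t tE] := E_gen (w := Qb b *: dl (dcon b) one).
  split; first exact/homogZ/homog_dl_one.
  move=> b' b'B; have [<-|bb'] := eqVneq b b'.
    by apply: logformZ; exists 0; rewrite dl_dl scaler0.
  apply: logform_dvdm; rewrite /Qb -big_filter (bigD1_seq b') /=; first by eexists.
    by rewrite mem_filter eq_sym bb'.
  exact: filter_uniq.
exists t => j; apply/subr0_eq.
have /(_ (fun j => \sum_i dcon b i * theta i j - lin b * t j)) h := E_free.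
have e1 : \sum_j (lin b * t j) *: E j = Qp *: dl (dcon b) one.
  rewrite (Qp_Qb bB) -scalerA tE scaler_sumr; apply: eq_bigr => j' _.
  by rewrite scalerA.
have e2 : Qp *: dl (dcon b) one = \sum_j (\sum_i dcon b i * theta i j) *: E j.
  rewrite dl_dxE scaler_sumr.
  transitivity (\sum_i \sum_j (dcon b i * theta i j) *: E j).
    apply: eq_bigr => i _; rewrite scalerA [Qp * _]mulrC -scalerA thetaE scaler_sumr.
    by apply: eq_bigr => j' _; rewrite scalerA.
  rewrite exchange_big /=; apply: eq_bigr => j' _.
  by rewrite -scaler_suml.
apply: h; under eq_bigr do rewrite scalerBl.
rewrite sumrB; apply/eqP; rewrite subr_eq0; apply/eqP.
exact: etrans (esym e2) (esym e1).
Qed.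

(** Rewrites a form in the basis [E j / Qp], with [dx_j] standing for the [j]-th basis element. *)
Definition Theta (w : F) : F := pb idfun theta w.

(** Along each [b], a numerator is a multiple of [db] plus a multiple of [lin b], and by [theta_log]
    the image of [db] is divisible by [lin b]. *)
Lemma Theta_dvd w : logB w -> dvdf Qp (Theta w).
Proof.
move=> hw; apply: dvdf_Qp => b bB.
have [m [v [c [d spl]]]] := ex_splitting_col (B0 bB).
have [g gE] := hw b bB; rewrite (dl_dvd spl gE) /Theta pbD pbZ.
apply: dvdfD; last by eexists.
have [t tE] := theta_log bB; rewrite pb_dl.
by exists (dl t (pb idfun theta (ct (vcon v) w))); rewrite -dlZ; apply: eq_dl.
Qed.

Lemma Ac_Theta w : pb idfun Ac (Theta w) = scale_deg Qp w.
Proof.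
rewrite /Theta -pb_scale_deg.
elim/form_ind: w => [|k u w hu hw|i w hw]; first by rewrite !pb_one.
  by rewrite !(pbD, pbZ) hu hw.
rewrite !pb_dl hw; apply: eq_dl => k /=.
rewrite (eq_bigr (fun j => theta i j * Ac j k)) => [|j _]; last first.
  congr (_ * _); rewrite (bigD1 i) //= big1 ?addr0 => [|l li]; first by rewrite /dx eqxx mul1r.
  by rewrite /dx eq_sym (negbTE li) mul0r.
rewrite theta_Ac (bigD1 i) //= big1 ?addr0 => [|l li]; first by rewrite /dx eqxx mul1r.
by rewrite /dx eq_sym (negbTE li) mul0r.
Qed.

(** Substituting [E j / Qp] for [dx_j] in [w] gives a logarithmic form, by [log_wedge]; [N] is its
    numerator, and the equation is cleared of powers of [Qp]. *)
Lemma ex_log_preimage (w : F) :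
  exists2 N, logB N & scale_deg Qp N = Qp *: pb idfun Ac w.
Proof.
elim/form_ind: w => [|k u w [Nu hu uE] [Nw hw wE]|i w [N hN NE]].
- exists (Qp *: one); first by move=> b bB; apply/logform_dvdm/Qp_dvd.
  rewrite pb_one scale_degZ scale_degE; congr (_ *: _); apply/ffunP=> I; rewrite !ffunE.
  by case: eqP => [->|_]; rewrite ?cards0 ?mul1r // mulr0.
- exists (k *: Nu + Nw).
    by move=> b bB; have [_] := logform_submodule b; apply; [apply: hu | apply: hw].
  rewrite scale_degD scale_degZ uE wE pbD pbZ scalerDr !scalerA mulrC //.
have hE : logB (dl (Ac i) one) by rewrite -log_basisE; have [] := E_log i.
have [N' hN' N'E] := log_wedge hE hN.
exists N'; first exact: hN'.
apply: (form_regZ Qp_neq0); rewrite -(scale_degZ Qp Qp N') -N'E scale_deg_dl NE.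
rewrite (linZ (dl _)) /= pb_dl; congr (_ *: (_ *: _)); apply: eq_dl => k.
rewrite (bigD1 i) //= big1 ?addr0 => [|l li]; first by rewrite /dx eqxx mul1r.
by rewrite /dx eq_sym (negbTE li) mul0r.
Qed.

(** Coordinates in the wedge basis, [Theta (i x)] divided by [Qp], embed [M] in [F]; substituting
    the basis and taking degree [p] is a retraction. No determinant is computed. *)
Lemma acyc_free p q gs (M : lmodType S) (i : {linear M -> F}) :
  injective i -> (forall w, logs B p w <-> exists x, i x = w) ->
  acyc gs q (F : lmodType S) -> acyc gs q M.
Proof.
move=> iI iE.
have hi x : logs B p (i x) by apply/iE; exists x.
have psi_ex x : exists g, Theta (i x) = Qp *: g by apply: Theta_dvd; have [] := hi x.
pose psi x := projT1 (cid (psi_ex x)).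
have psiE x : Theta (i x) = Qp *: psi x by rewrite /psi; case: cid.
have psi_lin : linear psi.
  apply: (linear_via_inj (f := fun w : F => Qp *: w) _ _ _ (fun x => esym (psiE x))).
  - by move=> x y; apply: form_regZ Qp_neq0.
  - by move=> k x y; apply: scaler_lincomb.
  - by move=> k x y; rewrite (linD i) (linZ i) /Theta pbD pbZ.
have rho_ex w : exists x, scale_deg Qp (i x) = Qp *: hcomp p (pb idfun Ac w).
  have [N hN NE] := ex_log_preimage w.
  have /iE[x xE] : logs B p (hcomp p N).
    by split; [apply: homog_hcomp | move=> b bB; apply/logform_hcomp/hN].
  by exists x; rewrite xE scale_deg_hcomp NE (linZ (hcomp p)).
pose rho w := projT1 (cid (rho_ex w)).
have rhoE w : scale_deg Qp (i (rho w)) = Qp *: hcomp p (pb idfun Ac w).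
  by rewrite /rho; case: cid.
have rho_lin : linear rho.
  apply: (linear_via_inj (f := fun x => scale_deg Qp (i x)) _ _ _ rhoE).
  - by move=> x y /(scale_deg_inj Qp_neq0)/iI.
  - by move=> k x y; rewrite (linD i) (linZ i) scale_degD scale_degZ.
  - move=> k x y; rewrite pbD pbZ (linD (hcomp p)) (linZ (hcomp p)).
    exact: scaler_lincomb.
apply: (acyc_retract (s := mklin psi_lin) (r := mklin rho_lin)) => x.
apply: iI; apply: (scale_deg_inj Qp_neq0); apply: etrans (rhoE (psi x)) _.
apply: (@etrans _ _ (hcomp p (pb idfun Ac (Qp *: psi x)))).
  by rewrite pbZ (linZ (hcomp p)).
rewrite -psiE Ac_Theta -scale_deg_hcomp hcomp_homog //.
by have [] := hi x.
Qed.

End Basis.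
End FreeLogForms.

(** * Arrangements of hyperplanes *)

Section Coefficients.
Variables (K : fieldType) (n : nat).
Local Notation S := {mpoly K[n]}.
Local Notation F := (formmod S n).
Implicit Types (L H : {vspace 'rV[K]_n}) (A : {fset {vspace 'rV[K]_n}}).

Definition bcol L : 'cV[K]_n := \col_i alpha L (delta_mx 0 i).

Lemma alphaE L (w : 'rV[K]_n) : alpha L w = (w *m bcol L) 0 0.
Proof.
rewrite {1}[w]row_sum_delta linear_sum mxE; apply: eq_bigr => j _.
by rewrite linearZ mxE.
Qed.

Lemma alpha_polyE L : alpha_poly L = lin (bcol L).
Proof. by rewrite linE; apply: eq_bigr => i _; rewrite mxE. Qed.

Lemma mem_bcol L (w : 'rV[K]_n) : hyperplane L -> (w \in L) = (w *m bcol L == 0).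
Proof.
move=> hL; rewrite -{1}(lker_alpha hL) memv_ker alphaE.
apply/eqP/eqP => [h|->]; last by rewrite mxE.
by rewrite [LHS]mx11_scalar h raddf0.
Qed.

Lemma bcol_neq0 L : hyperplane L -> bcol L != 0.
Proof.
move=> hL; apply/eqP => b0; have LE : L = fullv.
  by apply/vspaceP => w; rewrite mem_bcol // b0 mulmx0 eqxx memvf.
by have := hL; rewrite /hyperplane LE dimvf /dim /= mul1n => /eqP; rewrite eqn_leq ltnn.
Qed.

Lemma bcol_scale L L' k : hyperplane L -> hyperplane L' ->
  bcol L' = k *: bcol L -> L = L'.
Proof.
move=> hL hL' E; apply/eqP; rewrite eqEdim; apply/andP; split.
  apply/subvP => w; rewrite !mem_bcol // E -scalemxAr => /eqP ->.
  by rewrite scaler0.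
by rewrite -ltnS hL hL'.
Qed.

Lemma mderiv_lin (b : 'cV[K]_n) i : (lin b)^`M(i) = (b i 0)%:MP.
Proof.
rewrite linE raddf_sum (bigD1 i) //= mderivZ mderivX mnmE eqxx big1 => [|j ji].
  have -> : (U_(i) - U_(i) = 0 :> 'X_{1..n})%MM.
    by apply/mnmP => j; rewrite mnmBE subnn mnm0E.
  by rewrite addr0 mpolyX0 scaler_nat mulr1n -[LHS]mul_mpolyC mulr1.
by rewrite mderivZ mderivX mnm1E (negbTE ji) scale0r scaler0.
Qed.

(** Matches the sign in [wedge] with [sg] when the left factor is a 1-form. *)
Lemma inversions1 (i : 'I_n) (J : {set 'I_n}) :
  inversions [set i] (J :\ i) = #|[set j in J | (j < i)%N]|.
Proof.
rewrite /inversions -[RHS](card_imset _ (f := pair i)) => [|x y [] //].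
apply: eq_card => -[k j]; rewrite !inE /=.
apply/idP/imsetP => [/and3P[/eqP -> /andP[_ jJ] ji]|[l + [-> ->]]].
  by exists j; rewrite ?inE ?jJ.
by rewrite !inE => /andP[lJ li]; rewrite eqxx lJ li neq_ltn li.
Qed.

Definition ratdiv (q : S) (e : F) : extform (ratfun K n) n :=
  [ffun I => ratpoly (e I) / ratpoly q].

Lemma wedge_ratdiv L q (e : F) :
  wedge (ratform (exterior_d (alpha_poly L))) (ratdiv q e) =
  ratdiv q (dl (dcon (bcol L)) e).
Proof.
apply/ffunP => J; rewrite !ffunE /ratpoly raddf_sum mulr_suml.
under eq_bigr => I IJ.
  rewrite !ffunE /ratpoly raddf_sum mulr_suml mulr_sumr; over.
rewrite (exchange_big_dep xpredT) //= [RHS]big_mkcond; apply: eq_bigr => i _.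
case: ifP => iJ; last first.
  by rewrite big1 // => I /andP[IJ /eqP E]; rewrite E sub1set iJ in IJ.
rewrite (big_pred1 [set i]) => [|I]; last first.
  by apply/andP/eqP => [[_ /eqP]|->]; rewrite ?sub1set.
rewrite inversions1 alpha_polyE mderiv_lin /dcon !tofracM !mulrA /sg.
by rewrite rmorphXn rmorphN1.
Qed.

End Coefficients.

Section LogarithmicForms.
Variables (K : fieldType) (n : nat) (A : {fset {vspace 'rV[K]_n}}).
Hypothesis hA : arrangement A.
Local Notation S := {mpoly K[n]}.
Local Notation F := (formmod S n).
Local Notation Q := (defpoly A).
Local Notation B := [seq bcol L | L <- A].

Lemma defpoly_neq0 : Q != 0.
Proof.
rewrite prodf_seq_neq0; apply/allP => L LA /=.
by rewrite alpha_polyE lin_eq0 bcol_neq0 //; apply: hA.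
Qed.

Lemma ratpoly_Q_neq0 : ratpoly Q != 0.
Proof. by rewrite tofrac_eq0 defpoly_neq0. Qed.

Lemma ratdiv_inj : injective (ratdiv Q).
Proof.
move=> e e' /ffunP h; apply/ffunP => I; have := h I; rewrite !ffunE.
by move=> /(mulIf (invr_neq0 ratpoly_Q_neq0)) /eqP; rewrite tofrac_eq => /eqP.
Qed.

Lemma ratdiv_is_linear k (e e' : F) :
  ratdiv Q (k *: e + e') = k *: ratdiv Q e + ratdiv Q e'.
Proof.
apply/ffunP => I; rewrite !ffunE ratfun_scaleE /ratpoly.
by rewrite tofracD tofracM mulrDl mulrA.
Qed.

Lemma scale_ratdiv (e : F) : Q *: ratdiv Q e = ratform e.
Proof.
apply/ffunP => I; rewrite !ffunE ratfun_scaleE mulrCA mulfV ?mulr1 //.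
exact: ratpoly_Q_neq0.
Qed.

Lemma ratform_inj : injective (@ratform K n).
Proof.
move=> e e' /ffunP h; apply/ffunP => I; have := h I; rewrite !ffunE.
by move=> /eqP; rewrite tofrac_eq => /eqP.
Qed.

Lemma scale_ratform k (e : F) : k *: ratform e = ratform (k *: e).
Proof. by apply/ffunP => I; rewrite !ffunE ratfun_scaleE -tofracM. Qed.

Lemma logarithmicP p w :
  logarithmic A p w <-> exists2 e, logs B p e & w = ratdiv Q e.
Proof.
split=> [[[e he ->] hL]|[e [he le] ->]].
  exists e => //; split=> // _ /mapP[L LA ->]; have [g _] := hL L LA.
  rewrite wedge_ratdiv scale_ratdiv scale_ratform alpha_polyE => /ratform_inj gE.
  by exists g.
split=> [|L LA]; first by exists e.
have [|g gE] := le (bcol L); first exact: map_f.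
(* The definition asks for a homogeneous quotient, while [logform] provides an arbitrary one. *)
exists (hcomp p.+1 g); first exact: homog_hcomp.
rewrite wedge_ratdiv scale_ratdiv scale_ratform alpha_polyE; congr ratform.
by rewrite -(linZ (hcomp p.+1)) /= -gE hcomp_dl hcomp_homog.
Qed.

Lemma logmod_embedding p : exists psi : {linear logmod A p -> F},
  injective psi /\ forall w, logs B p w <-> exists x, psi x = w.
Proof.
have ex (x : logmod A p) : exists e, logs B p e /\ logval x = ratdiv Q e.
  by have /asboolP/logarithmicP[e] := valP x; exists e.
pose f x := projT1 (cid (ex x)).
have fE x : logs B p (f x) /\ logval x = ratdiv Q (f x) by rewrite /f; case: cid.
have fl : linear f.
  move=> k x y; apply: ratdiv_inj.
  by rewrite ratdiv_is_linear -!(fE _).2.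
exists (mklin fl); split=> [x y xy|w].
  by apply: val_inj; rewrite /= (fE x).2 (fE y).2; congr ratdiv.
split=> [hw|[x <-]]; last by have [] := fE x.
have lw : ratdiv Q w \in logforms A p by apply/asboolP/logarithmicP; exists w.
exists (LogForm lw); apply: ratdiv_inj.
by rewrite -[RHS]/(logval (LogForm lw)) (fE (LogForm lw)).2.
Qed.

Lemma pdI_logmod p d (M : lmodType S) (i : {linear M -> F}) :
  injective i -> (forall w, logs B p w <-> exists x, i x = w) ->
  pdI d M <-> pdI d (logmod A p).
Proof.
have [psi [psiI psiE]] := logmod_embedding p => iI iE.
have iso (X Y : lmodType S) (f : {linear X -> F}) (g : {linear Y -> F}) :
    injective f -> (forall w, logs B p w <-> exists x, f x = w) ->
    injective g -> (forall w, logs B p w <-> exists x, g x = w) ->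
    pdI d X -> pdI d Y.
  move=> fI fE gI gE; have [|h hE] := lift_inj (f := f) gI.
    by move=> c; apply/gE/fE; exists c.
  apply: (pdI_iso (f := h)) => [x y xy|y]; first by apply: fI; rewrite -!hE xy.
  have /fE[x xE] : logs B p (g y) by apply/gE; exists y.
  by exists x; apply: gI; rewrite hE.
by split; [apply: (iso _ _ i psi) | apply: (iso _ _ psi i)].
Qed.

Lemma free_basis : free_arrangement A -> exists E : 'I_n -> F,
  [/\ forall j, logs B 1 (E j),
     forall w, logs B 1 w -> exists f : 'I_n -> S, w = \sum_j f j *: E j &
     forall f : 'I_n -> S, \sum_j f j *: E j = 0 -> forall j, f j = 0].
Proof.
have [psi [psiI psiE]] := logmod_embedding 1 => -[b bE].
have psi_sum (f : 'I_n -> S) : \sum_j f j *: psi (b j) = psi (\sum_j f j *: b j).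
  by rewrite linear_sum; apply: eq_bigr => j _; rewrite linZ.
exists (fun j => psi (b j)); split=> [j|w /psiE[x <-]|f].
- by apply/psiE; exists (b j).
- have [f [-> _]] := bE x; exists f; symmetry; exact: psi_sum.
rewrite psi_sum => f0 j.
have fb : \sum_j f j *: b j = 0 by apply: psiI; rewrite f0 lin_0.
have [f1 [_ f1E]] := bE 0.
have f1f : f1 = finfun f.
  by apply: f1E; rewrite -[LHS]fb; apply: eq_bigr => k _; rewrite ffunE.
have f10 : f1 = 0.
  by apply: f1E; rewrite big1 // => k _; rewrite ffunE scale0r.
by rewrite -[f j]ffunE -f1f f10 ffunE.
Qed.

End LogarithmicForms.

(** * Lifting along the deleted hyperplane *)

Lemma count_lt (T : eqType) (a1 a2 : pred T) (s : seq T) y :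
  subpred a1 a2 -> y \in s -> a2 y -> ~~ a1 y -> (count a1 s < count a2 s)%N.
Proof.
move=> sub + a2y a1y; elim: s => //= z s IH; rewrite inE => /orP[/eqP <-|/IH lt].
  by rewrite a2y (negbTE a1y) ltnS; apply: sub_count.
by rewrite -addnS; apply: leq_add lt; have := sub z; case: (a1 z) => // ->.
Qed.

(** * Ideals containing powers of the variables *)

Section IdealPowers.
Variables (K : fieldType) (n : nat).
Local Notation S := {mpoly K[n]}.
Variables (T : eqType) (s : seq T) (b : T -> 'cV[K]_n) (a : 'cV[K]_n).

Definition ideal (J : S -> Prop) : Prop :=
  J 0 /\ forall k u v, J u -> J v -> J (k * u + v).

Section Ideal.
Variables (J : S -> Prop) (hJ : ideal J).

Lemma idealD u v : J u -> J v -> J (u + v).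
Proof. by move=> hu hv; have [_] := hJ; rewrite -[u]mul1r; apply. Qed.

Lemma idealM k u : J u -> J (k * u).
Proof. by move=> hu; have [h0] := hJ; rewrite -[k * u]addr0; apply. Qed.

Lemma ideal_add g : ideal (fun p => exists2 r, J r & exists k, p = r + k * g).
Proof.
have [J0 Jl] := hJ; split=> [|k u v [r hr [l ->]] [r' hr' [l' ->]]].
  by exists 0 => //; exists 0; rewrite mul0r addr0.
exists (k * r + r'); first exact: Jl.
by exists (k * l + l'); rewrite mulrDr mulrDl mulrA addrACA.
Qed.

Lemma ideal_lin_mulmx m (M : 'M[K]_(n, m)) (z : 'cV_m) :
  (forall j, J (lin (col j M))) -> J (lin (M *m z)).
Proof.
move=> h; have -> : M *m z = \sum_j z j 0 *: col j M.
  apply/colP => i; rewrite !mxE summxE; apply: eq_bigr => j _.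
  by rewrite !mxE mulrC.
rewrite linear_sum; elim/big_ind: _ => [||j _]; first by have [] := hJ.
  exact: idealD.
by rewrite linearZ /= -mul_mpolyC; apply: idealM.
Qed.

Lemma ideal_prod_pow (t : seq T) f :
  (forall y, y \in t -> exists N, exists2 r, J r & exists k, f ^+ N = r + k * lin (b y)) ->
  exists N, exists2 r, J r & exists k, f ^+ N = r + k * \prod_(y <- t) lin (b y).
Proof.
elim: t => [|y t IH] h.
  by exists 0%N, 0; [have [] := hJ | exists 1; rewrite expr0 big_nil add0r mul1r].
have [|N [r hr [k kE]]] := h y; first by rewrite inE eqxx.
have [|N' [r' hr' [k' kE']]] := IH.
  by move=> z zt; apply: h; rewrite inE zt orbT.
exists (N + N')%N, ((r' + k' * \prod_(y <- t) lin (b y)) * r + (k * lin (b y)) * r').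
  by apply: idealD; apply: idealM.
exists (k * k'); rewrite exprD kE kE' big_cons; ring.
Qed.

End Ideal.

(* Elementary replacement for the Nullstellensatz: induction on the number of
   forms [lin (b y)] outside [J]. The forms in [J] either span all linear forms,
   or vanish together with [lin a] at some [x != 0], and then the factors of the
   product given for [x] can be adjoined to [J] one at a time. *)
Lemma var_pow_in_ideal (J : S -> Prop) i : ideal J -> J (lin a) ->
  (forall x : 'rV[K]_n, x != 0 -> x *m a = 0 ->
     J (\prod_(y <- s | x *m b y != 0) lin (b y))) ->
  exists N, J ('X_i ^+ N).
Proof.
have [k le_k] := ubnP (count (fun y => ~~ `[< J (lin (b y)) >]) s).
elim: k => // k IH in J le_k *; move=> hJ Ja hg.
have [[x [x0 xa xb]]|nx] := pselect (exists x : 'rV[K]_n,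
    [/\ x != 0, x *m a = 0 & forall y, y \in s -> J (lin (b y)) -> x *m b y = 0]).
  have [|N [r hr [l lE]]] := @ideal_prod_pow J hJ [seq y <- s | x *m b y != 0] 'X_i.
    move=> y; rewrite mem_filter => /andP[xy ys].
    have sub u : J u -> exists2 r, J r & exists k, u = r + k * lin (b y).
      by move=> hu; exists u => //; exists 0; rewrite mul0r addr0.
    apply: (IH (fun p => exists2 r, J r & exists k, p = r + k * lin (b y))); last 3 first.
    - exact: (ideal_add hJ).
    - exact: sub.
    - by move=> z z0 za; apply/sub/hg.
    rewrite -ltnS; apply: leq_trans le_k; rewrite ltnS.
    apply: (count_lt (y := y)) => // [z||].
    - by apply: contraNN => /asboolP hz; apply/asboolP/sub.
    - by apply/asboolP => Jy; rewrite xb ?eqxx in xy.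
    apply/negPn/asboolP; exists 0; first by have [] := hJ.
    by exists 1; rewrite mul1r add0r.
  exists N; rewrite lE; apply: (idealD hJ) => //; apply: (idealM hJ).
  by rewrite big_filter; apply: hg.
exists 1%N; rewrite expr1 -lin_delta.
pose t := a :: [seq b y | y <- s & `[< J (lin (b y)) >]].
pose M := \matrix_(i < n, j < size t) (nth a t j) i 0.
have colM j : col j M = nth a t j by apply/colP => l; rewrite !mxE.
have tJ z : z \in t -> J (lin z).
  rewrite inE => /orP[/eqP -> //|/mapP[y]].
  by rewrite mem_filter => /andP[/asboolP hy _] ->.
have /row_freeP[R MR] : row_free M.
  apply: inj_row_free => x xM; apply: contrapT => /eqP x0; apply: nx.
  have xt z : z \in t -> x *m z = 0.
    move=> /(nthP a)[j jt <-]; rewrite -(colM (Ordinal jt)) colE mulmxA xM.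
    by rewrite mul0mx.
  exists x; split=> // [|y ys Jy]; apply: xt; first by rewrite inE eqxx.
  by rewrite inE map_f ?orbT // mem_filter ys andbT; apply/asboolP.
rewrite -[delta_mx _ _]mul1mx -MR -mulmxA; apply: (ideal_lin_mulmx hJ) => j.
by rewrite colM; apply/tJ/mem_nth.
Qed.

End IdealPowers.


Lemma scale_of_ker (K : fieldType) n (a x : 'cV[K]_n) : a != 0 ->
  (forall u : 'rV_n, u *m a = 0 -> u *m x = 0) -> exists k, x = k *: a.
Proof.
move=> a0 h; have [m [v [c [d spl]]]] := ex_splitting_col a0.
exists ((v *m x) 0 0); apply: (splitting_scale spl).
apply/row_matrixP => i; rewrite row_mul h ?row0 // -row_mul (split_ca spl).
by rewrite row0.
Qed.

Lemma eq_logs (K : fieldType) n (B B' : seq 'cV[K]_n) p w : B =i B' ->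
  logs B p w <-> logs B' p w.
Proof.
move=> BE; split=> -[hw lw]; split=> // b hb; apply: lw; first by rewrite BE.
by rewrite -BE.
Qed.

(** * The restricted arrangement, lifting on it, and deletion *)

Section Restriction.
Variables (K : fieldType) (n : nat) (A : {fset {vspace 'rV[K]_n}}).
Variable H : {vspace 'rV[K]_n}.
Hypotheses (hA : arrangement A) (HA : H \in A).
Local Notation S := {mpoly K[n]}.
Local Notation F := (formmod S n).
Local Notation Sb := {mpoly K[\dim H]}.
Local Notation Fb := (formmod Sb (\dim H)).
Local Notation A' := (A `\ H)%fset.

Definition cmx : 'M[K]_(\dim H, n) := \matrix_j coords H (delta_mx 0 j).
Local Notation c := cmx.

Lemma mul_cmx u : u *m c = coords H u.
Proof.
rewrite {2}[u]row_sum_delta linear_sum mulmx_sum_row; apply: eq_bigr => j _.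
by rewrite linearZ rowK.
Qed.

Lemma row_free_cmx : row_free c.
Proof.
apply: inj_row_free => u; rewrite mul_cmx => /eqP; rewrite -memv_ker lker_coords.
by rewrite memv0 => /eqP.
Qed.

Lemma coords_mem u : coords H u \in H.
Proof. by have := memv_img (coords H) (memvf u); rewrite limg_coords. Qed.

Lemma cmx_bcol : c *m bcol H = 0.
Proof.
apply/row_matrixP => i; rewrite row_mul rowK row0; apply/eqP.
by rewrite -mem_bcol ?coords_mem //; apply: hA.
Qed.

Lemma cmx_splitting : exists v d, splitting (bcol H) v c d.
Proof.
apply: ex_splitting; [exact: hA | | exact: cmx_bcol | exact: row_free_cmx].
by apply: bcol_neq0; apply: hA.
Qed.

Lemma bcol_not_scale : {in A', forall L k, bcol L <> k *: bcol H}.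
Proof.
move=> L /fsetD1P[/eqP LH LA] k /bcol_scale E.
by apply: LH; symmetry; apply: E; apply: hA.
Qed.

(** The restriction merges hyperplanes with the same trace and chooses its linear forms anew. Forms
    change only by nonzero scalars, which [logform_scale] absorbs, and [logs] does not see
    repetitions. *)
Lemma logs_restriction p e :
  logs [seq bcol U | U <- restriction A H] p e <->
  logs [seq c *m bcol L | L <- A'] p e.
Proof.
have [v [d spl]] := cmx_splitting.
have hU := restriction_arrangement hA HA.
have scale L (U := (coords H @^-1: (H :&: L))%VS) : L \in A' ->
    exists k l, [/\ k != 0, l != 0, bcol U = k *: (c *m bcol L) &
                    c *m bcol L = l *: bcol U].
  move=> LA'; have /fsetD1P[LH LA] := LA'.
  have UA : U \in restriction A H by apply/imfsetP; exists L.
  have memU (u : 'rV_(\dim H)) : (u *m bcol U == 0) = (u *m (c *m bcol L) == 0).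
    rewrite -(mem_bcol u (hU _ UA)) -memv_preim memv_cap coords_mem mulmxA mul_cmx.
    by rewrite (mem_bcol _ (hA LA)).
  have cL0 := cb_neq0 spl bcol_not_scale LA'.
  have U0 : bcol U != 0 by apply: bcol_neq0; apply: hU.
  have [k kE] : exists k, bcol U = k *: (c *m bcol L).
    by apply: scale_of_ker cL0 _ => u /eqP; rewrite -memU => /eqP.
  have [l lE] : exists l, c *m bcol L = l *: bcol U.
    by apply: scale_of_ker U0 _ => u /eqP; rewrite memU => /eqP.
  exists k, l; split=> //.
    by apply/eqP => k0; have /eqP[] := U0; rewrite kE k0 scale0r.
  by apply/eqP => l0; have /eqP[] := cL0; rewrite lE l0 scale0r.
split=> -[he le]; split=> //.
  move=> _ /mapP[L LA ->]; have [k [l [k0 l0 kE lE]]] := scale L LA.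
  apply: (logform_scale k0 kE); apply: le; apply: map_f.
  by apply/imfsetP; exists L.
move=> _ /mapP[_ /imfsetP[L /= LA ->] ->]; have [k [l [k0 l0 kE lE]]] := scale L LA.
by apply: (logform_scale l0 lE); apply: le; apply: (map_f (fun L => c *m bcol L)).
Qed.

Lemma bcol_cons : [seq bcol L | L <- A] =i bcol H :: [seq bcol L | L <- A'].
Proof.
move=> b; rewrite inE; apply/mapP/orP => [[L LA ->]|[/eqP ->|/mapP[L + ->]]].
- have [->|LH] := eqVneq L H; [by left | right].
  by apply: map_f; rewrite in_fsetD1 LH.
- by exists H.
by rewrite in_fsetD1 => /andP[_ LA]; exists L.
Qed.

Lemma arrangement_sub A1 : {subset A1 <= A} -> arrangement A1.
Proof. by move=> sub L /sub/hA. Qed.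

Section FixedSplitting.
Variables (v : 'rV[K]_n) (d : 'M[K]_(n, \dim H)).
Hypothesis spl : splitting (bcol H) v c d.
Local Notation a := (bcol H).
Local Notation res := (res v c).

(** A basis of 1-forms makes the module of numerators a retract of [F], so [acyc_free] supplies the
    vanishing that [res_surj_acyc] asks for. *)
Lemma local_surj A1 p e : {subset A1 <= A'} -> free_arrangement A1 ->
  logs [seq c *m bcol L | L <- A1] p e ->
  exists2 w, logs (a :: [seq bcol L | L <- A1]) p.+1 w & res w = e.
Proof.
move=> sub frA1 he.
have hA1 : arrangement A1 by apply: arrangement_sub => L /sub/fsetD1P[].
have [E [E_log E_gen E_free]] := free_basis hA1 frA1.
have [M' [i' [i'I i'E]]] := ex_submodule (logs_submodule [seq bcol L | L <- A1] p.+1).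
apply: (res_surj_acyc spl _ _ i'I i'E _ he) => // [|L /sub|gs].
- exact: fset_uniq.
- exact: bcol_not_scale.
apply: (acyc_free _ _ _ E_log E_gen E_free i'I i'E).
- rewrite map_inj_in_uniq ?fset_uniq // => L L' LA LA' LE.
  by apply: (bcol_scale (k := 1)); [apply: hA1 | apply: hA1 | rewrite scale1r].
- by move=> _ /mapP[L LA ->]; apply: bcol_neq0; apply: hA1.
move=> _ _ /mapP[L LA ->] /mapP[L' LA' ->] LL k /bcol_scale LE.
by case/eqP: LL; congr bcol; apply: LE; apply: hA1.
Qed.

Hypothesis lf : locally_free_along A' (mem H).

(* This ideal contains a power of every variable because, by local freeness, no
   point of [H] other than the origin is in its zero locus. *)
Definition lift_ideal e (g : S) : Prop :=
  exists2 w, logA a A' (@bcol K n) w & res w = subst c g *: e.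

Lemma lift_ideal_pow p e : logs [seq c *m bcol L | L <- A'] p e ->
  exists N, forall i, lift_ideal e ('X_i ^+ N).
Proof.
move=> he.
have idl : ideal (lift_ideal e).
  have [l0 ll] := logA_submodule a A' (@bcol K n).
  split=> [|k u w [x lx xE] [y ly yE]].
    by exists 0; rewrite ?res0 // rmorph0 scale0r.
  exists (k *: x + y); first exact: ll.
  rewrite res_linear_for xE yE rmorphD rmorphM scalerDl scalerA //.
have ex i : exists N, lift_ideal e ('X_i ^+ N).
  apply: (@var_pow_in_ideal K n _ A' (@bcol K n) a (lift_ideal e) i idl).
    exists 0; first by have [] := logA_submodule a A' (@bcol K n).
    by rewrite res0 (subst_a spl) scale0r.
  move=> x x0 xa.
  have xH : x \in mem H by rewrite -[_ \in _]/(x \in H) mem_bcol ?xa //; apply: hA.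
  have frx := lf xH x0.
  have sub : {subset localization A' x <= A'} by move=> L; rewrite !inE => /andP[].
  have [|w [hw lw] rw] := local_surj sub frx (p := p) (e := e).
    have [he1 he2] := he; split=> // _ /mapP[L LA ->]; apply: he2.
    by apply: (map_f (fun L => c *m bcol L)); apply: sub.
  (* The hyperplanes missing [x] are put back: the product of their forms makes the local lift
     logarithmic along them too. *)
  set g := \prod_(L <- _ | _) _; exists (g *: w); last by rewrite resZ rw.
  have la : logform a w by apply: lw; rewrite inE eqxx.
  split; last exact: logformZ.
  move=> L LA'; have [xL|xL] := eqVneq (x *m bcol L) 0.
    have /fsetD1P[LH LA] := LA'; apply/logformZ/lw.
    by rewrite inE map_f ?orbT // !inE LH LA (mem_bcol _ (hA LA)) xL eqxx.
  apply: logform_dvdm; rewrite /g -big_filter (bigD1_seq L) /=.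
  - by eexists.
  - by rewrite mem_filter xL.
  exact/filter_uniq/fset_uniq.
pose N i := projT1 (cid (ex i)).
have hN i : lift_ideal e ('X_i ^+ N i) by rewrite /N; case: cid.
exists (\max_i N i)%N => i; have le : (N i <= \max_i N i)%N by apply: leq_bigmax.
by rewrite -(subnK le) exprD; apply: (idealM idl).
Qed.

Lemma subst_var_neq0 : (0 < \dim H)%N -> exists i, subst c 'X_i != 0.
Proof.
move=> m0; have [i ci] : exists i, c *m delta_mx i 0 != 0 :> 'cV_(\dim H).
  apply: contrapT => nc; have c0 : c = 0.
    apply/matrixP => k i; rewrite [RHS]mxE; apply: contrapT => /eqP cki.
    apply: nc; exists i; apply/eqP => /colP/(_ k).
    by rewrite -colE mxE [RHS]mxE => /eqP; apply/negP.
  have /matrixP/(_ (Ordinal m0) (Ordinal m0)) := split_cd spl.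
  by rewrite c0 mul0mx !mxE eqxx => /esym/eqP; rewrite oner_eq0.
by exists i; rewrite -lin_delta subst_lin lin_eq0.
Qed.

(** Contraction vanishes in degree 0, so by [res_ker] multiplication by [lin a] is a bijection on
    numerators. *)
Lemma pdI_residue0 (M' M : lmodType S) (i' : {linear M' -> F}) (i : {linear M -> F}) :
  injective i' -> (forall w, logs [seq bcol L | L <- A'] 0 w <-> exists x, i' x = w) ->
  injective i -> (forall w, logs (a :: [seq bcol L | L <- A']) 0 w <-> exists x, i x = w) ->
  pdI 0 M' -> pdI 0 M.
Proof.
move=> i'I i'E iI iE.
have mulE (x : F) : mklin (@mulg_linear S F (lin a)) x = lin a *: x by [].
have a0 : lin a != 0 by rewrite lin_eq0; apply: a_neq0 spl.
have [|f fE] := lift_inj (f := mklin (@mulg_linear S F (lin a)) \o i') iI.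
  move=> x; apply/iE/logs_consP; have /logsP[hx lx] : logs [seq bcol L | L <- A'] 0 (i' x).
    by apply/i'E; exists x.
  by split; [move=> I hI; rewrite ffunE hx // scaler0 | apply: logA_mul].
apply: (pdI_iso (f := f)) => [x y xy|y].
  by apply: i'I; apply: (form_regZ a0); rewrite -[LHS]fE xy [LHS]fE.
have /logs_consP[hy ly] : logs (a :: [seq bcol L | L <- A']) 0 (i y).
  by apply/iE; exists y.
have [|w lw wE] := res_ker spl bcol_not_scale ly.
  rewrite /res (_ : ct _ _ = 0) ?pbm0 //; apply/ffunP => J; rewrite !ffunE.
  by rewrite big1 // => k kJ; rewrite hy ?mulr0 // cardsU1 kJ.
have /i'E[x xE] : logs [seq bcol L | L <- A'] 0 (hcomp 0 w).
  by apply/logsP; split; [apply: homog_hcomp | move=> L LA; apply/logform_hcomp/lw].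
exists x; apply: iI; rewrite fE /= mulE xE wE -[RHS](hcomp_homog (p := 0)) -?wE //.
by rewrite wE (linZ (hcomp 0)).
Qed.

(** [p] is the degree on the restriction, so [p.+3 < n] reads [2 + (p + 1) < n], which is what
    [acyc_pdI] requires for [H^2] of the deletion. *)
Lemma pdI_residue p (M' M : lmodType S) (N : lmodType Sb)
    (i' : {linear M' -> F}) (i : {linear M -> F}) (j : {linear N -> Fb}) :
  injective i' -> (forall w, logs [seq bcol L | L <- A'] p.+1 w <-> exists x, i' x = w) ->
  injective i -> (forall w, logs (a :: [seq bcol L | L <- A']) p.+1 w <-> exists x, i x = w) ->
  injective j -> (forall w, logs [seq c *m bcol L | L <- A'] p w <-> exists x, j x = w) ->
  (p.+3 < n)%N -> pdI p.+1 M' -> pdI p N -> pdI p.+1 M.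
Proof.
move=> i'I i'E iI iE jI jE pn pM' pN.
have [f [r [fI ex rE]]] := logs_sequence spl bcol_not_scale i'I i'E iI iE jI jE.
apply: (horseshoe (i := f) (e := r)) (pM') _; last first.
  apply: (pdI_restr (alpha := lin a)) pN => [y|y|y].
  - by exists (subst d y); apply: (substK spl).
  - exact: (subst_ker spl).
  by move=> /eqP; rewrite mulf_eq0 lin_eq0 (negbTE (a_neq0 spl)) => /eqP.
split=> // y; have he : logs [seq c *m bcol L | L <- A'] p (j y) by apply/jE; exists y.
have [k hk] := lift_ideal_pow he.
(* A variable that does not vanish on [H] has a power regular on the target, whence [H^0 = 0]
   there. *)
have [l cl] : exists l, subst c 'X_l != 0.
  by apply: subst_var_neq0; have := hA HA; rewrite /hyperplane; lia.
have acS q : (q < n)%N -> acyc (var_pows K n k 0) q (S^o : lmodType S).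
  by move=> qn; apply: acyc_var_pows_projective qn _; apply: regular_projective.
have [||||||g|w lw rw] := @koszul_surj _ _ _ _ _ _ _ spl _ _ _ bcol_not_scale
  (var_pows K n k 0) p M' i' (var_pow K k l) (j y) i'I i'E.
- apply: (acyc_pdI (n := n) (d := p.+1)) => // q P.
  exact: acyc_var_pows_projective.
- by apply: acS; lia.
- by apply: acS; lia.
- exact: mem_var_pows.
- by rewrite var_powE rmorphXn expf_neq0.
- exact: he.
- by move=> /var_powsP[o ->]; apply: hk.
by have /iE[x xE] := lw; exists x; apply: jI; rewrite rE xE.
Qed.

End FixedSplitting.

Lemma tame_deletion : tame (restriction A H) -> locally_free_along A' (mem H) ->
  tame A' -> tame A.
Proof.
move=> tH lf tA' p pn; apply/pd_leP.
have [v [d spl]] := cmx_splitting.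
have hA' : arrangement A' by apply: arrangement_sub => L /fsetD1P[].
have [M' [i' [i'I i'E]]] := ex_submodule (logs_submodule [seq bcol L | L <- A'] p).
have [M [i [iI iE]]] := ex_submodule (logs_submodule (bcol H :: [seq bcol L | L <- A']) p).
have iE' w : logs [seq bcol L | L <- A] p w <-> exists x, i x = w.
  by apply: iff_trans (iE w); apply: eq_logs bcol_cons.
apply/(pdI_logmod hA _ iI iE').
have pM' : pdI p M' by apply/(pdI_logmod hA' _ i'I i'E)/pd_leP/tA'.
(* For [n <= 2] truncated subtraction puts every [p] in the first case. *)
have [p2|p2] := leqP (n - 2) p.
  apply: pdI_mono p2 _; apply: pdI_logs iI iE' => _ /mapP[L LA ->].
  by apply: bcol_neq0; apply: hA.
case: p pn i'E iE p2 pM' {iE'} => [|p] pn i'E iE p2 pM'.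
  exact: (pdI_residue0 spl i'I i'E iI iE).
have [N [j [jI jE]]] := ex_submodule (logs_submodule [seq c *m bcol L | L <- A'] p).
apply: (pdI_residue spl lf i'I i'E iI iE jI jE) => //; first by lia.
have jE' w : logs [seq bcol U | U <- restriction A H] p w <-> exists x, j x = w.
  by apply: iff_trans (jE w); apply: logs_restriction.
apply/(pdI_logmod (restriction_arrangement hA HA) _ jI jE')/pd_leP/tH.
by have := hA HA; rewrite /hyperplane; lia.
Qed.

End Restriction.


Theorem theorem1p6 (K : fieldType) (n : nat)
    (A : {fset {vspace 'rV[K]_n}}) (H : {vspace 'rV[K]_n}) :
  arrangement A -> H \in A ->
  tame (restriction A H) ->
  locally_free_along (A `\ H)%fset (mem H) ->
  tame (A `\ H)%fset -> tame A.
Proof.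
by move=> hA HA tH lf tA'; apply: (tame_deletion hA HA tH lf tA').
Qed.
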